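(* Let $m\ge 3$ be an integer, $a_0\in\mathbb{C}$, and $f(z)=z^{m}+a_{0}$. If $\Omega(f)$ is simply connected, then the Brennan conjecture holds for $\Omega(f)$.
   Context: For a polynomial $f$ of degree $\ge 2$, the basin of attraction of infinity is $\Omega(f)=\{z\in\hat{\mathbb{C}}: f^{n}(z)\to\infty \text{ as } n\to+\infty\}$, where $f^n$ denotes the $n$-th iterate (it contains $\infty$). We say the Brennan conjecture holds for a simply connected domain $\Omega\subsetneq\hat{\mathbb{C}}$ if for a (equivalently any) biholomorphic map $F:\Omega\to\mathbb{D}$ onto the unit disk and every $p\in(\tfrac43,4)$, one has $\int_{\Omega\cap\mathbb{C}}|F'(z)|^{p}\,dA(z)<+\infty$, where $dA$ is Lebesgue area measure. *)

(* Defs.v *)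
From HB Require Import structures.
From mathcomp Require Import all_boot all_order all_algebra.
From mathcomp Require Import all_classical all_reals all_analysis.
From mathcomp Require Export complex.
Import Order.TTheory GRing.Theory Num.Theory ComplexField.
Import numFieldNormedType.Exports.

Set Implicit Arguments.
Unset Strict Implicit.
Unset Printing Implicit Defensive.

Local Open Scope classical_set_scope.
Local Open Scope ring_scope.
Local Open Scope complex_scope.

(* The usual normed-space (hence topological) structure on C = R[i],
   with complex scalars; complex derivatives are then 'D_1 / derivable. *)
HB.instance Definition _ (R : rcfType) := GRing.ComAlgebra.copy R[i] R[i]^o.
HB.instance Definition _ (R : rcfType) := Vector.copy R[i] R[i]^o.
HB.instance Definition _ (R : rcfType) := NormedModule.copy R[i] R[i]^o.

(* The Riemann sphere: one-point compactification of C; None is infinity. *)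
Definition Chat (R : realType) : topologicalType :=
  one_point_compactification R[i].

Definition cabs (R : realType) (z : R[i]) : R := Normc.normc z.

(* Basin of attraction of infinity of f : C -> C, as a subset of the sphere
   (it contains infinity, since f(infinity) = infinity). *)
Definition basin_infty (R : realType) (f : R[i] -> R[i]) : set (Chat R) :=
  fun x => match x with
           | None => True
           | Some z => (fun n : nat => cabs (iter n f z)) @ \oo --> +oo
           end.

Definition simply_connected (R : realType) (X : topologicalType) (U : set X)
  : Prop :=
  U !=set0 /\
  (forall x y, U x -> U y ->
     exists g : R -> X,
       {within `[0%R, 1%R], continuous g} /\ g @` `[0%R, 1%R] `<=` U /\
       g 0 = x /\ g 1 = y) /\
  (forall g : R -> X,
     {within `[0%R, 1%R], continuous g} -> g @` `[0%R, 1%R] `<=` U ->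
     g 0 = g 1 ->
     exists H : (R * R)%type -> X,
       {within `[0%R, 1%R] `*` `[0%R, 1%R], continuous H} /\
       H @` (`[0%R, 1%R] `*` `[0%R, 1%R]) `<=` U /\
       (forall s, 0 <= s <= 1 -> H (s, 0) = g s /\ H (s, 1) = g 0) /\
       (forall t, 0 <= t <= 1 -> H (0, t) = g 0 /\ H (1, t) = g 0)).

(* F : Om -> D is biholomorphic onto the unit disk: a bijection of Om onto D
   that is holomorphic at every finite point of Om and, if infinity lies in
   Om, holomorphic at infinity (i.e. w |-> F(1/w), F(infinity) at w = 0, is
   complex-differentiable at 0).  (A holomorphic bijection automatically has
   a holomorphic inverse.) *)
Definition biholomorphic_onto_disk (R : realType) (Om : set (Chat R))
    (F : Chat R -> R[i]) : Prop :=
  set_bij Om [set w : R[i] | cabs w < 1] F /\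
  (forall z : R[i], Om (Some z) -> derivable (F \o Some) z 1) /\
  (Om None ->
     derivable (fun w : R[i] => if w == 0 then F None else F (Some w^-1)) 0 1).

Definition area (R : realType) :=
  ((@lebesgue_measure R) \x (@lebesgue_measure R))%E.

Definition brennan_holds (R : realType) (Om : set (Chat R)) : Prop :=
  forall F : Chat R -> R[i], biholomorphic_onto_disk Om F ->
  forall p : R, 4 / 3 < p < 4 ->
  (\int[@area R]_(xy in [set xy : R * R | Om (Some (xy.1 +i* xy.2))])
      ((cabs ('D_1 (F \o Some) (xy.1 +i* xy.2))) `^ p)%:E < +oo)%E.

(* Main.v *)
(* Let Om be the finite part of the basin and f(z) = z^m + a0.  Compose F with the
   automorphism of the disk sending F(infinity) to 0, and call the result phi.
   By the maximum principle, applied in the chart 1 / (z - b) with b a fixed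
   point of f, |phi o f| = |phi|^m.  Hence phi o f / phi^m is unimodular on Om, its
   derivative vanishes, and u = |phi'| / |phi| satisfies
     u(z) = u(f z) |z|^(m-1).
   If 0 were in Om this would give phi'(0) = 0, which is impossible for an
   injective function; so the critical point does not escape and |a0|^2 <= 2.

   Near infinity |F'(z)| = O(|z|^-2), whose p-th power is integrable since p > 1.
   On |z| <= R, |F'|^p <= 1 + |F'|^4 and |F'| = O(u), so that it remains to
   integrate u^4.  Split Om into the sets D_n of points leaving the disk of radius R
   at time n + 1 and put J_n = int_{D_n} u^4 (1 + |z - a0|^2).  Replace u(z) by
   u(f z) |z|^(m-1), average the weight over the rotations by the powers of omega,
   where 1 + omega + ... + omega^(m-1) = 0, and substitute w = z^m: with t = |z|^2,
     t^(m-1) (1 + t + |a0|^2) <= t^(m-1) (3 + t) <= rho (1 + t^m),  rho < m,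
   gives J_{n+1} <= (rho / m) J_n, a convergent geometric series. *)

Require Import Defs.
From HB Require Import structures.
From mathcomp Require Import all_boot all_order all_algebra.
From mathcomp Require Import all_classical all_reals all_analysis.
From mathcomp Require Import complex.
From mathcomp Require Import measurable_realfun.
From mathcomp Require Import ring lra.
Import Order.TTheory GRing.Theory Num.Theory ComplexField.
Import numFieldNormedType.Exports.

Set Implicit Arguments.
Unset Strict Implicit.
Unset Printing Implicit Defensive.

Local Open Scope classical_set_scope.
Local Open Scope ring_scope.
Local Open Scope complex_scope.

(** * The modulus on the complex plane *)

Section ComplexBasics.
Variable R : realType.
Implicit Types (x y z : R[i]) (A K : set R[i]).

(** The weight is dictated by how it transforms. Pulling back [u^4] produces [|z|^(4(m-1))]; the
    substitution [w = z^m] absorbs half of these powers and gains a factor [1/m], since the Jacobian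
    is [m^2 |z|^(2(m-1))] and a point has [m] preimages. The other half, [t^(m-1)], exceeds [m] for
    large [t]. Centred at the critical value [a0], the weight becomes [1 + t^m] at [f z], which
    outgrows it. At [z] itself the weight has a cross term between [z] and [a0], and this is what
    the rotations average away. At [t = 1] the final inequality reads [4 <= 2 rho], so [rho < m]
    forces [m >= 3]. The substitution is not done with local branches: [|z|^-2 dA] is invariant
    under multiplication by nonzero constants, and so is its composition with [z^m], hence the two
    integrals are proportional. On the analytic side everything is drawn from the maximum principle,
    applied to difference quotients and their reciprocals: derivative estimates, open mapping, and
    nonvanishing derivatives of injective functions. *)

Lemma normC_cabs z : `|z| = (cabs z)%:C.
Proof. by case: z. Qed.

Lemma cabs0 : cabs (0 : R[i]) = 0. Proof. exact: Normc.normc0. Qed.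
Lemma cabs1 : cabs (1 : R[i]) = 1. Proof. exact: Normc.normc1. Qed.
Lemma cabsM x y : cabs (x * y) = cabs x * cabs y.
Proof. exact: Normc.normcM. Qed.
Lemma cabsV x : cabs x^-1 = (cabs x)^-1.
Proof. exact: Normc.normcV. Qed.
Lemma cabsN x : cabs (- x) = cabs x. Proof. exact: normcN. Qed.
Lemma cabsC x y : cabs (x - y) = cabs (y - x).
Proof. by rewrite -cabsN opprB. Qed.
Lemma ler_cabsD x y : cabs (x + y) <= cabs x + cabs y.
Proof. exact: le_normcD. Qed.
Lemma cabs_ge0 x : 0 <= cabs x.
Proof. by case: x => a b; exact: sqrtr_ge0. Qed.
Lemma cabs_eq0 x : (cabs x == 0) = (x == 0).
Proof.
apply/eqP/eqP => [|->]; last exact: cabs0.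
exact: Normc.eq0_normc.
Qed.
Lemma cabs_gt0 x : (0 < cabs x) = (x != 0).
Proof. by rewrite lt_def cabs_eq0 cabs_ge0 andbT. Qed.
Lemma cabsX x n : cabs (x ^+ n) = cabs x ^+ n.
Proof. by elim: n => [|n IH]; rewrite ?expr0 ?cabs1// !exprS cabsM IH. Qed.
Lemma cabs_real (a : R) : cabs a%:C = `|a|.
Proof. by rewrite /cabs /= expr0n/= addr0 sqrtr_sqr. Qed.
Lemma ler_cabsB x y : cabs x - cabs y <= cabs (x - y).
Proof. by rewrite lerBlDr -{1}(subrK y x) ler_cabsD. Qed.
Lemma ler_cabs_distD y x z : cabs (x - z) <= cabs (x - y) + cabs (y - z).
Proof. by rewrite -{1}(subrK y x) -addrA ler_cabsD. Qed.

Lemma sqr_cabs z : cabs z ^+ 2 = complex.Re z ^+ 2 + complex.Im z ^+ 2.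
Proof. by case: z => a b; rewrite sqr_sqrtr// addr_ge0// sqr_ge0. Qed.
Lemma ler_Re_cabs z : `|complex.Re z| <= cabs z.
Proof.
rewrite -(@ler_pXn2r _ 2)// ?nnegrE ?cabs_ge0// sqr_cabs real_normK ?num_real//.
by rewrite lerDl sqr_ge0.
Qed.
Lemma ler_Im_cabs z : `|complex.Im z| <= cabs z.
Proof.
rewrite -(@ler_pXn2r _ 2)// ?nnegrE ?cabs_ge0// sqr_cabs real_normK ?num_real//.
by rewrite lerDr sqr_ge0.
Qed.
Lemma ler_cabs_ReIm z : cabs z <= `|complex.Re z| + `|complex.Im z|.
Proof.
rewrite -(@ler_pXn2r _ 2)// ?nnegrE ?cabs_ge0// ?addr_ge0// sqr_cabs sqrrD.
by rewrite !real_normK ?num_real// lerD2r lerDl mulrn_wge0 ?mulr_ge0.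
Qed.

Lemma ReD x y : complex.Re (x + y) = complex.Re x + complex.Re y.
Proof. by case: x; case: y. Qed.
Lemma ImD x y : complex.Im (x + y) = complex.Im x + complex.Im y.
Proof. by case: x; case: y. Qed.
Lemma ReB x y : complex.Re (x - y) = complex.Re x - complex.Re y.
Proof. by case: x; case: y. Qed.
Lemma ImB x y : complex.Im (x - y) = complex.Im x - complex.Im y.
Proof. by case: x; case: y. Qed.
Lemma ReM x y : complex.Re (x * y) =
  complex.Re x * complex.Re y - complex.Im x * complex.Im y.
Proof. by case: x; case: y. Qed.
Lemma ImM x y : complex.Im (x * y) =
  complex.Re x * complex.Im y + complex.Im x * complex.Re y.
Proof. by case: x; case: y. Qed.

(** The norm of [R[i]] takes values in [R[i]], and so do the radii of its balls. A positive complex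
    number is real, which brings neighbourhoods back to real radii; the later epsilon arguments rest
    on this. *)
Lemma nbhs_cabsP z A :
  nbhs z A <-> exists2 e : R, 0 < e & forall y, cabs (y - z) < e -> A y.
Proof.
split.
  move/nbhs_ballP => [e /= e0 H].
  have er : e = (complex.Re e)%:C by apply/esym/RRe_real; exact: gtr0_real.
  exists (complex.Re e); first by move: e0; rewrite {1}er ltcR.
  move=> y hy; apply: H.
  by rewrite -ball_normE /= distrC er (normC_cabs (y - z)) ltcR.
move=> [e e0 H]; apply/nbhs_ballP; exists e%:C; first by rewrite /= ltcR.
by move=> y; rewrite -ball_normE /= distrC (normC_cabs (y - z)) ltcR; exact: H.
Qed.

Lemma open_cabsP A : open A <->
  forall z, A z -> exists2 e : R, 0 < e & forall y, cabs (y - z) < e -> A y.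
Proof.
rewrite openE; split=> H z Az; first by apply/nbhs_cabsP; exact: H.
by apply/nbhs_cabsP; exact: H.
Qed.

Lemma cont_cabsP (f : R[i] -> R[i]) z : {for z, continuous f} <->
  forall e : R, 0 < e -> exists2 d : R, 0 < d &
    forall y, cabs (y - z) < d -> cabs (f y - f z) < e.
Proof.
split=> [cf e e0|H A /nbhs_cabsP[e e0 he]].
  have /cf/nbhs_cabsP // : nbhs (f z) [set w | cabs (w - f z) < e].
  by apply/nbhs_cabsP; exists e.
have [d d0 hd] := H e e0.
by apply/nbhs_cabsP; exists d => // y /hd; exact: he.
Qed.

Lemma contR_cabsP (f : R[i] -> R) z : {for z, continuous f} <->
  forall e : R, 0 < e -> exists2 d : R, 0 < d &
    forall y, cabs (y - z) < d -> `|f y - f z| < e.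
Proof.
split=> [cf e e0|H A /nbhs_ballP[e /= e0 he]].
  have /cf/nbhs_cabsP // : nbhs (f z) [set w | `|w - f z| < e].
  by apply/nbhs_ballP; exists e => //= w; rewrite -ball_normE/= distrC.
have [d d0 hd] := H e e0.
apply/nbhs_cabsP; exists d => // y /hd h; apply: he.
by rewrite -ball_normE/= distrC.
Qed.

Lemma cabs_lip x y : `|cabs x - cabs y| <= cabs (x - y).
Proof. by rewrite ler_norml ler_cabsB andbT lerNl opprB cabsC ler_cabsB. Qed.

Lemma continuous_cabs : continuous (@cabs R).
Proof.
move=> z; apply/contR_cabsP => e e0; exists e => // y.
exact/le_lt_trans/cabs_lip.
Qed.

Lemma continuous_cabsB z : continuous (fun y => cabs (y - z)).
Proof.
move=> x; apply/contR_cabsP => e e0; exists e => // y h.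
by apply: le_lt_trans h; rewrite (le_trans (cabs_lip _ _))// opprB addrA subrK.
Qed.

Lemma continuous_Re : continuous (@complex.Re R).
Proof.
move=> z; apply/contR_cabsP => e e0; exists e => // y.
by apply/le_lt_trans; rewrite -ReB ler_Re_cabs.
Qed.

Lemma continuous_Im : continuous (@complex.Im R).
Proof.
move=> z; apply/contR_cabsP => e e0; exists e => // y.
by apply/le_lt_trans; rewrite -ImB ler_Im_cabs.
Qed.

Lemma continuous_toC : continuous (fun p : R * R => p.1 +i* p.2).
Proof.
move=> [a b] A /nbhs_cabsP[e e0 he].
exists (ball a (e / 2), ball b (e / 2)) => /=.
  by split; apply: nbhsx_ballx; rewrite divr_gt0.
move=> [a' b'] [/=]; rewrite -!ball_normE/= => h1 h2; apply: he.
apply: (le_lt_trans (ler_cabs_ReIm _)).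
by rewrite ReB ImB /= distrC (distrC b') (splitr e) ltrD.
Qed.

Lemma compact_cabs_bounded K (B : R) :
  closed K -> (forall z, K z -> cabs z <= B) -> compact K.
Proof.
move=> cK hB.
have cS : compact (`[- B, B]%classic `*` `[- B, B]%classic : set (R * R)).
  by apply: compact_setX; exact: segment_compact.
have := @continuous_compact _ _ (fun p : R * R => p.1 +i* p.2) _ _ cS.
move=> /(_ _) cI.
apply: (subclosed_compact cK (cI _)).
  by apply: continuous_subspaceT; exact: continuous_toC.
move=> z Kz; exists (complex.Re z, complex.Im z); last by case: z {Kz}.
by split => /=; rewrite in_itv /= -ler_norml (le_trans _ (hB _ Kz))//
  ?ler_Re_cabs ?ler_Im_cabs.
Qed.

Lemma compact_cball z (r : R) : compact [set y | cabs (y - z) <= r].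
Proof.
apply: (@compact_cabs_bounded _ (r + cabs z)) => [|y /= h].
  rewrite (_ : [set y | _] = (fun y => cabs (y - z)) @^-1` [set t | t <= r])//.
  apply: closed_comp; last exact: closed_le.
  by move=> y _; exact: continuous_cabsB.
by rewrite -{1}(subrK z y) (le_trans (ler_cabsD _ _))// lerD2r.
Qed.

End ComplexBasics.

(** * Goursat's theorem for rectangles *)

Section Goursat.
Variable R : realType.

(** Pigeonhole: the values on the four quarters add up to the value on the rectangle, so one of them
    carries at least a quarter of its modulus. *)
Lemma quarter_rectangle (W : R -> R -> R -> R -> R) (X0 X1 Y0 Y1 x y s t q : R) :
  (forall a b c d e, X0 <= a -> a <= b -> b <= c -> c <= X1 ->
     Y0 <= d -> d <= e -> e <= Y1 -> W a c d e = W a b d e + W b c d e) ->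
  (forall a b c d e, X0 <= a -> a <= b -> b <= X1 ->
     Y0 <= c -> c <= d -> d <= e -> e <= Y1 -> W a b c e = W a b c d + W a b d e) ->
  X0 <= x -> x + (s + s) <= X1 -> Y0 <= y -> y + (t + t) <= Y1 -> 0 <= s -> 0 <= t ->
  4 * q <= `|W x (x + (s + s)) y (y + (t + t))| ->
  exists p : R * R,
    [/\ X0 <= p.1, p.1 + s <= X1, Y0 <= p.2, p.2 + t <= Y1 &
        q <= `|W p.1 (p.1 + s) p.2 (p.2 + t)|] /\
    [/\ x <= p.1, p.1 + s <= x + (s + s), y <= p.2 & p.2 + t <= y + (t + t)].
Proof.
move=> addx addy h1 h2 h3 h4 s0 t0 h5.
have xs : x + s <= x + (s + s) by rewrite addrA lerDl.
have yt : y + t <= y + (t + t) by rewrite addrA lerDl.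
have x1 : x <= x + s by rewrite lerDl.
have y1 : y <= y + t by rewrite lerDl.
have X1s := le_trans xs h2; have Y1t := le_trans yt h4.
have X0s := le_trans h1 x1; have Y0t := le_trans h3 y1.
have E : W x (x + (s + s)) y (y + (t + t)) =
  W x (x + s) y (y + t) + W (x + s) (x + s + s) y (y + t) +
  (W x (x + s) (y + t) (y + t + t) + W (x + s) (x + s + s) (y + t) (y + t + t)).
  rewrite (addy _ _ _ (y + t)) ?(le_trans x1 xs)//.
  by rewrite (addx x (x + s) _ y)// (addx x (x + s) _ (y + t))// !addrA.
rewrite E in h5; have E2 := addrA x s s; have E3 := addrA y t t.
have [k1|k1] := leP q `|W x (x + s) y (y + t)|; first by exists (x, y).
have [k2|k2] := leP q `|W (x + s) (x + s + s) y (y + t)|.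
  by exists (x + s, y); split; split; rewrite //= -E2.
have [k3|k3] := leP q `|W x (x + s) (y + t) (y + t + t)|.
  by exists (x, y + t); split; split; rewrite //= -E3.
have [k4|k4] := leP q `|W (x + s) (x + s + s) (y + t) (y + t + t)|.
  by exists (x + s, y + t); split; split; rewrite //= -?E2 -?E3.
exfalso; move: h5; apply/negP; rewrite -ltNge.
apply: (le_lt_trans (ler_normD _ _)).
have := ler_normD (W x (x + s) y (y + t)) (W (x + s) (x + s + s) y (y + t)).
have := ler_normD (W x (x + s) (y + t) (y + t + t))
  (W (x + s) (x + s + s) (y + t) (y + t + t)).
move: k1 k2 k3 k4; clear=> *; lra.
Qed.

(* Goursat's bisection argument. *)
Lemma additive_rectangle_eq0 (W : R -> R -> R -> R -> R) (X0 X1 Y0 Y1 : R) :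
  X0 <= X1 -> Y0 <= Y1 ->
  (forall a b c d e, X0 <= a -> a <= b -> b <= c -> c <= X1 ->
     Y0 <= d -> d <= e -> e <= Y1 -> W a c d e = W a b d e + W b c d e) ->
  (forall a b c d e, X0 <= a -> a <= b -> b <= X1 ->
     Y0 <= c -> c <= d -> d <= e -> e <= Y1 -> W a b c e = W a b c d + W a b d e) ->
  (forall x y (e : R), X0 <= x -> x <= X1 -> Y0 <= y -> y <= Y1 -> 0 < e ->
     exists2 d : R, 0 < d &
     forall a b a' b', X0 <= a -> a <= x -> x <= a' -> a' <= X1 ->
       Y0 <= b -> b <= y -> y <= b' -> b' <= Y1 ->
       a' - a < d -> b' - b < d ->
       `|W a a' b b'| <= e * (a' - a + (b' - b)) ^+ 2) ->
  W X0 X1 Y0 Y1 = 0.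
Proof.
move=> X01 Y01 addx addy loc; apply/eqP; rewrite -normr_eq0 eq_sym eq_le normr_ge0 /=.
rewrite leNgt; apply/negP => c0.
set c := `|W X0 X1 Y0 Y1| in c0.
pose dx n := (X1 - X0) / 2 ^+ n; pose dy n := (Y1 - Y0) / 2 ^+ n.
have dx2 n : dx n = dx n.+1 + dx n.+1 by rewrite /dx exprSr; field; rewrite expf_neq0.
have dy2 n : dy n = dy n.+1 + dy n.+1 by rewrite /dy exprSr; field; rewrite expf_neq0.
have dx0 n : 0 <= dx n by rewrite /dx divr_ge0 ?subr_ge0// exprn_ge0.
have dy0 n : 0 <= dy n by rewrite /dy divr_ge0 ?subr_ge0// exprn_ge0.
pose P n (p : R * R) := [/\ X0 <= p.1, p.1 + dx n <= X1, Y0 <= p.2,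
   p.2 + dy n <= Y1 & c / 4 ^+ n <= `|W p.1 (p.1 + dx n) p.2 (p.2 + dy n)|].
(* The invariant stays under the existential so that [choice] applies to all pairs; pairs violating
   it receive a dummy value. *)
have step (np : nat * (R * R)) : exists p' : R * R, P np.1 np.2 ->
    P np.1.+1 p' /\ [/\ np.2.1 <= p'.1, p'.1 + dx np.1.+1 <= np.2.1 + dx np.1,
      np.2.2 <= p'.2 & p'.2 + dy np.1.+1 <= np.2.2 + dy np.1].
  case: np => n [x y] /=.
  have [Pn|nP] := pselect (P n (x, y)); last by exists (0, 0).
  have [/= h1 h2 h3 h4 h5] := Pn.
  have c4 : c / 4 ^+ n = 4 * (c / 4 ^+ n.+1) by rewrite exprSr; field; rewrite expf_neq0.
  rewrite dx2 in h2 h5 *; rewrite dy2 in h4 h5 *; rewrite c4 in h5.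
  have [p' Hp] := quarter_rectangle addx addy h1 h2 h3 h4 (dx0 _) (dy0 _) h5.
  by exists p' => _.
have [g hg] := choice step.
pose p := fix p n : R * R := if n is k.+1 then g (k, p k) else (X0, Y0).
have dx_0 : dx 0 = X1 - X0 by rewrite /dx expr0 divr1.
have dy_0 : dy 0 = Y1 - Y0 by rewrite /dy expr0 divr1.
have Pp n : P n (p n).
  elim: n => [|n IH] /=; last by have [] := hg (n, p n) IH.
  by rewrite /P /= dx_0 dy_0 !subrKC expr0 divr1; split; rewrite ?lexx//.
have mono k n : [/\ (p n).1 <= (p (k + n)%N).1,
    (p (k + n)%N).1 + dx (k + n)%N <= (p n).1 + dx n,
    (p n).2 <= (p (k + n)%N).2 & (p (k + n)%N).2 + dy (k + n)%N <= (p n).2 + dy n].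
  elim: k => [|k [i1 i2 i3 i4]] //=.
  have [_ [j1 j2 j3 j4]] := hg ((k + n)%N, p (k + n)%N) (Pp _).
  by split; [exact: le_trans j1|exact: le_trans i2|exact: le_trans j3|exact: le_trans i4].
have lex n m : (p n).1 <= (p m).1 + dx m.
  have [nm|mn] := leqP n m.
    have [] := mono (m - n)%N n; rewrite subnK// => h _ _ _.
    by rewrite (le_trans h)// lerDl.
  have [] := mono (n - m)%N m; rewrite subnK ?(ltnW mn)// => _ h _ _.
  by rewrite (le_trans _ h)// lerDl.
have ley n m : (p n).2 <= (p m).2 + dy m.
  have [nm|mn] := leqP n m.
    have [] := mono (m - n)%N n; rewrite subnK// => _ _ h _.
    by rewrite (le_trans h)// lerDl.
  have [] := mono (n - m)%N m; rewrite subnK ?(ltnW mn)// => _ _ _ h.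
  by rewrite (le_trans _ h)// lerDl.
(* Every left end lies below every right end, so the suprema of the left ends give a point common to
   all the nested rectangles. *)
pose x := sup (range (fun n => (p n).1)); pose y := sup (range (fun n => (p n).2)).
have hx n : (p n).1 <= x <= (p n).1 + dx n.
  apply/andP; split.
    apply: ub_le_sup; last by exists n.
    by exists ((p 0).1 + dx 0%N) => _ [k _ <-]; exact: lex.
  by apply: ge_sup; [exists (p 0).1; exists 0%N|move=> _ [k _ <-]; exact: lex].
have hy n : (p n).2 <= y <= (p n).2 + dy n.
  apply/andP; split.
    apply: ub_le_sup; last by exists n.
    by exists ((p 0).2 + dy 0%N) => _ [k _ <-]; exact: ley.
  by apply: ge_sup; [exists (p 0).2; exists 0%N|move=> _ [k _ <-]; exact: ley].
pose L := X1 - X0 + (Y1 - Y0).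
have L0 : 0 <= L by rewrite addr_ge0 ?subr_ge0.
have L1 : 0 < L ^+ 2 + 1 by rewrite ltr_wpDl// sqr_ge0.
have [/andP[hx1 hx2] /andP[hy1 hy2]] := (hx 0%N, hy 0%N).
rewrite /= dx_0 dy_0 !subrKC in hx1 hx2 hy1 hy2.
(* [L] is the half-perimeter. The [n]-th rectangle has half-perimeter [L / 2 ^+ n], so with this
   constant the local bound falls below [c / 4 ^+ n], against the bisection. The [+ 1] covers
   [L = 0]. *)
have [] := loc x y (c / 2 / (L ^+ 2 + 1)) hx1 hx2 hy1 hy2; first by rewrite !divr_gt0.
move=> d d0 hd.
have [n hn] : exists n, L / 2 ^+ n < d.
  have := @cvg_geometric R L 2^-1; rewrite ger0_norm ?invr_ge0// invf_lt1// ltr1n => /(_ isT).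
  move=> /cvgrPdist_lt/(_ _ d0)[n _ /(_ n (leqnn _))].
  rewrite sub0r normrN => hn; exists n; apply: le_lt_trans hn.
  by rewrite /geometric /= exprVn ler_norm.
have [/= q1 q2 q3 q4 q5] := Pp n.
have [/andP[r1 r2] /andP[r3 r4]] := (hx n, hy n).
have Ld : dx n + dy n = L / 2 ^+ n by rewrite /dx /dy /L -mulrDl.
have Ex : (p n).1 + dx n - (p n).1 = dx n by rewrite addrC addKr.
have Ey : (p n).2 + dy n - (p n).2 = dy n by rewrite addrC addKr.
have hW : `|W (p n).1 ((p n).1 + dx n) (p n).2 ((p n).2 + dy n)| <=
    c / 2 / (L ^+ 2 + 1) * (L / 2 ^+ n) ^+ 2.
  rewrite -Ld -{2}Ex -{2}Ey; apply: hd => //.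
    by rewrite Ex (le_lt_trans _ hn)// -Ld lerDl.
  by rewrite Ey (le_lt_trans _ hn)// -Ld lerDr.
have := le_trans q5 hW.
rewrite expr_div_n -exprM mulnC exprM (_ : 2 ^+ 2 = 4 :> R); last by rewrite -natrX.
have h4 : 0 < (4 ^+ n : R)^-1 by rewrite invr_gt0 exprn_gt0.
rewrite mulrA ler_pM2r//; apply/negP; rewrite -ltNge mulrAC ltr_pdivrMr//.
have := sqr_ge0 L; move: c0 L1; rewrite /c; move: (L ^+ 2) `|W X0 X1 Y0 Y1| => l k.
nra.
Qed.
End Goursat.

(** * Cauchy-Riemann equations and boundary integrals of rectangles *)

Section CauchyRiemann.
Variable R : realType.
Local Notation mu := (@lebesgue_measure R).
Local Notation I a b f := (\int[mu]_(t in `[a, b]) f t).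

Lemma integrable_cont (a b : R) (f : R -> R) :
  {within `[a, b], continuous f} -> mu.-integrable `[a, b] (EFin \o f).
Proof.
move=> cf; apply: continuous_compact_integrable => //; exact: segment_compact.
Qed.

Lemma Rintegral_split (a c b : R) (f : R -> R) : a <= c -> c <= b ->
  {within `[a, b], continuous f} -> I a b f = I a c f + I c b f.
Proof.
move=> ac cb /integrable_cont fi.
have := @Rintegral_itvB _ f (BLeft a) (BRight b) c fi.
rewrite !bnd_simp => /(_ ac cb); rewrite Rintegral_itv_obnd_cbnd => [<-|].
  by rewrite subrKC.
apply: integrableS fi => //; apply: subset_itvr; by rewrite bnd_simp.
Qed.

(** Meant for two opposite sides of a small rectangle, along which the integrands differ by nearly a
    constant [k]. *)
Lemma Rintegral_diff_bound (a b k e : R) (f g : R -> R) : a <= b ->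
  {within `[a, b], continuous f} -> {within `[a, b], continuous g} ->
  (forall t, a <= t -> t <= b -> `|f t - g t - k| <= e) ->
  `|I a b f - I a b g - k * (b - a)| <= e * (b - a).
Proof.
move=> ab cf cg h.
have mab : fine (mu `[a, b]%classic) = b - a.
  rewrite lebesgue_measure_itv /= lte_fin; case: ltP => [|ba] //=.
  by apply/esym/eqP; rewrite subr_eq0 eq_le ba.
have ck l : {within `[a, b], continuous (fun=> l : R)}.
  by apply: continuous_subspaceT => x; exact: cst_continuous.
have il l := integrable_cont (ck l).
have fi := integrable_cont cf; have gi := integrable_cont cg.
have gf : {within `[a, b], continuous (fun t => f t - g t)}.
  by move=> x; apply: cvgB; [exact: cf|exact: cg].
have fgi := integrable_cont gf.
have gfk : {within `[a, b], continuous (fun t => f t - g t - k)}.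
  by move=> x; apply: cvgB; [exact: gf|exact: ck].
have fgki := integrable_cont gfk.
rewrite -{1}mab -Rintegral_cst// -RintegralB// -RintegralB//.
apply: (le_trans (le_normr_Rintegral _ _)) => //.
rewrite -mab -Rintegral_cst//; apply: le_Rintegral => //.
- apply: (@integrable_cont a b (fun t => `|f t - g t - k|)).
  by move=> x; apply: cvg_norm; exact: gfk.
- by move=> t /=; rewrite in_itv/= => /andP[]; exact: h.
Qed.

(** [S] is the value at [(x, y)], while [P] and [Q] are the values at the facing points [(c, t)] and
    [(a, t)] of two sides. Subtracting the two expansions cancels the [l] terms, and
    [|c - x| + |a - x|] is exactly the width [c - a]. *)
Lemma CR_edge_bound (a c x b f y t k l e P Q S : R) : 0 < e ->
  a <= x -> x <= c -> b <= y -> y <= f -> b <= t -> t <= f ->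
  `|P - S - (k * (c - x) - l * (t - y))| <= e / 2 * (`|c - x| + `|t - y|) ->
  `|Q - S - (k * (a - x) - l * (t - y))| <= e / 2 * (`|a - x| + `|t - y|) ->
  `|P - Q - k * (c - a)| <= e * (c - a + (f - b)).
Proof.
move=> e0 ax xc byy yf bt tf.
have -> : `|c - x| = c - x by rewrite ger0_norm; lra.
have -> : `|a - x| = x - a by rewrite ler0_norm; lra.
have e3 : `|t - y| <= f - b by rewrite ler_norml; lra.
have n1 := ler_wpM2l (ltW e0) e3.
have n2 : 0 <= e * (c - a) by rewrite mulr_ge0 ?(ltW e0)//; lra.
rewrite !ler_norml => /andP[m1 m1b] /andP[m2 m2b]; apply/andP; split; lra.
Qed.

Lemma CR_combine (p q k u v e : R) :
  `|p - k * u * v| <= e * (u + v) * v -> `|q - k * v * u| <= e * (u + v) * u ->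
  `|p - q| <= e * (u + v) ^+ 2.
Proof.
rewrite !ler_norml expr2 => /andP[m1 m1b] /andP[m2 m2b].
by apply/andP; split; lra.
Qed.

(* [V dx + U dy] is a closed form as soon as [U] and [V] satisfy, pointwise,
   the Cauchy-Riemann equations. *)
Lemma cauchy_riemann_rectangle (U V : R -> R -> R) (X0 X1 Y0 Y1 : R) :
  X0 <= X1 -> Y0 <= Y1 ->
  (forall x, X0 <= x -> x <= X1 -> {within `[Y0, Y1], continuous (U x)}) ->
  (forall y, Y0 <= y -> y <= Y1 -> {within `[X0, X1], continuous (V^~ y)}) ->
  (forall x y, X0 <= x -> x <= X1 -> Y0 <= y -> y <= Y1 ->
    exists k l : R, forall e, 0 < e -> exists2 d : R, 0 < d &
    forall s t, X0 <= s -> s <= X1 -> `|s - x| < d -> `|t - y| < d ->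
      `|U s t - U x y - (k * (s - x) - l * (t - y))| <= e * (`|s - x| + `|t - y|) /\
      `|V s t - V x y - (l * (s - x) + k * (t - y))| <= e * (`|s - x| + `|t - y|)) ->
  I Y0 Y1 (U X1) - I Y0 Y1 (U X0) = I X0 X1 (V^~ Y1) - I X0 X1 (V^~ Y0).
Proof.
move=> X01 Y01 cU cV CR.
have sub (p q c d : R) (f : R -> R) : p <= c -> d <= q ->
    {within `[p, q], continuous f} -> {within `[c, d], continuous f}.
  move=> pc dq; apply: continuous_subspaceW => t /=; rewrite !in_itv /= => /andP[h1 h2].
  by rewrite (le_trans pc)//= (le_trans h2).
(* [W] is the integral of [V dx + U dy] along the boundary, counterclockwise. *)
pose W a b c d := (I c d (U b) - I c d (U a)) - (I a b (V^~ d) - I a b (V^~ c)).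
apply/eqP; rewrite -subr_eq0; apply/eqP; rewrite -/(W X0 X1 Y0 Y1).
apply: additive_rectangle_eq0 => //.
- move=> a b c d e h1 h2 h3 h4 h5 h6 h7; rewrite /W.
  have s y : Y0 <= y -> y <= Y1 -> I a c (V^~ y) = I a b (V^~ y) + I b c (V^~ y).
    by move=> y1 y2; apply: Rintegral_split => //; apply: sub (cV y y1 y2).
  by rewrite !s ?(le_trans h6)// ?(le_trans h5)//; ring.
- move=> a b c d e h1 h2 h3 h4 h5 h6 h7; rewrite /W.
  have s x : X0 <= x -> x <= X1 -> I c e (U x) = I c d (U x) + I d e (U x).
    by move=> y1 y2; apply: Rintegral_split => //; apply: sub (cU x y1 y2).
  by rewrite !s ?(le_trans h2)// ?(le_trans h1)//; ring.
move=> x y e hx0 hx1 hy0 hy1 e0.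
have [k [l /(_ (e / 2))[|d d0 hd]]] := CR x y hx0 hx1 hy0 hy1; first by rewrite divr_gt0.
exists d => // a b c f h1 h2 h3 h4 h5 h6 h7 h8 h9 h10; rewrite /W.
have ac := le_trans h2 h3; have bf := le_trans h6 h7.
have Xc := le_trans h1 ac; have aX := le_trans ac h4.
have Yf := le_trans h5 bf; have bY := le_trans bf h8.
set D := c - a + (f - b).
have dist s t : X0 <= s -> a <= s -> s <= c -> b <= t -> t <= f -> s <= X1 ->
    `|U s t - U x y - (k * (s - x) - l * (t - y))| <= e / 2 * (`|s - x| + `|t - y|) /\
    `|V s t - V x y - (l * (s - x) + k * (t - y))| <= e / 2 * (`|s - x| + `|t - y|).
  move=> s0 s1 s2 t1 t2 s3; apply: hd => //.
    by move: h2 h3 h9 s1 s2; clear => *; rewrite ltr_norml; apply/andP; split; lra.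
  by move: h6 h7 h10 t1 t2; clear => *; rewrite ltr_norml; apply/andP; split; lra.
have iU : `|I b f (U c) - I b f (U a) - k * (c - a) * (f - b)| <= e * D * (f - b).
  apply: Rintegral_diff_bound => //; [exact: sub (cU c Xc h4)|exact: sub (cU a h1 aX)|].
  move=> t t1 t2.
  have [m1 _] := dist c t Xc ac (lexx _) t1 t2 h4.
  have [m2 _] := dist a t h1 (lexx _) ac t1 t2 aX.
  by move: e0 h2 h3 h6 h7 t1 t2 m1 m2; rewrite /D; clear; exact: CR_edge_bound.
have iV : `|I a c (V^~ f) - I a c (V^~ b) - k * (f - b) * (c - a)| <= e * D * (c - a).
  apply: Rintegral_diff_bound => //; [exact: sub (cV f Yf h8)|exact: sub (cV b h5 bY)|].
  move=> t t1 t2.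
  have Xt := le_trans h1 t1; have tX := le_trans t2 h4.
  have [_ m1] := dist t f Xt t1 t2 bf (lexx _) tX.
  have [_ m2] := dist t b Xt t1 t2 (lexx _) bf tX.
  rewrite (_ : D = f - b + (c - a)); last by rewrite addrC.
  (* The same estimate with the coordinates exchanged: in the expansion of [V] the coefficients [k]
     and [l] trade places, up to a sign. *)
  apply: (@CR_edge_bound b f y a c x t k (- l) e _ _ (V x y)) => //.
    by rewrite mulNr opprK [k * _ + _]addrC [`|f - y| + _]addrC.
  by rewrite mulNr opprK [k * _ + _]addrC [`|b - y| + _]addrC.
(* Both differences of opposite sides approximate the same [k] times the area; the main terms cancel
   and only the errors survive. *)
exact: CR_combine iU iV.
Qed.
End CauchyRiemann.

(** * Complex derivatives *)

Section Cderiv.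
Variable R : realType.
Implicit Types (f g : R[i] -> R[i]) (x y z l : R[i]).

(* Caratheodory's form of complex differentiability: it reduces the usual rules
   to algebra on continuous functions. *)
Definition cderiv f z l := exists2 q : R[i] -> R[i], {for z, continuous q} &
  q z = l /\ forall y, f y = f z + q y * (y - z).

Lemma cont_cst l z : {for z, continuous (fun=> l : R[i])}.
Proof. exact: cst_continuous. Qed.
Arguments cont_cst l z : clear implicits.

Lemma cont_eqfun f g z : f =1 g -> {for z, continuous f} -> {for z, continuous g}.
Proof. by move=> /funext ->. Qed.
Arguments cont_eqfun {f g z} _ _.

Lemma contD f g z : {for z, continuous f} -> {for z, continuous g} ->
  {for z, continuous (fun y => f y + g y)}.
Proof.
move=> /cont_cabsP cf /cont_cabsP cg; apply/cont_cabsP => e e0.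
have e2 : 0 < e / 2 by rewrite divr_gt0.
have [d d0 hd] := cf _ e2; have [d' d'0 hd'] := cg _ e2.
exists (Num.min d d'); first by rewrite lt_min d0.
move=> y; rewrite lt_min => /andP[/hd h /hd' h'].
rewrite opprD addrACA (le_lt_trans (ler_cabsD _ _))// (splitr e) ltrD//.
Qed.
Arguments contD {f g z} _ _.

Lemma contB f g z : {for z, continuous f} -> {for z, continuous g} ->
  {for z, continuous (fun y => f y - g y)}.
Proof.
move=> cf /cont_cabsP cg; apply: (contD cf); apply/cont_cabsP => e e0.
have [d d0 hd] := cg e e0; exists d => // y /hd h.
rewrite opprK addrC. by rewrite cabsC.
Qed.
Arguments contB {f g z} _ _.

Lemma contM f g z : {for z, continuous f} -> {for z, continuous g} ->
  {for z, continuous (fun y => f y * g y)}.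
Proof.
move=> /cont_cabsP cf /cont_cabsP cg; apply/cont_cabsP => e e0.
have A0 : 0 < cabs (f z) + 1 by rewrite ltr_wpDl ?cabs_ge0.
have B0 : 0 < cabs (g z) + 1 by rewrite ltr_wpDl ?cabs_ge0.
have [|d1 d10 h1] := cf (e / 2 / (cabs (g z) + 1)); first by rewrite !divr_gt0.
have [|d2 d20 h2] := cg (e / 2 / (cabs (f z) + 1)); first by rewrite !divr_gt0.
have [d3 d30 h3] := cg 1 ltr01.
exists (Num.min d1 (Num.min d2 d3)); first by rewrite !lt_min d10 d20.
move=> y; rewrite !lt_min => /and3P[/h1 k1 /h2 k2 /h3 k3].
rewrite (_ : _ - _ = (f y - f z) * g y + f z * (g y - g z)); last by ring.
rewrite (le_lt_trans (ler_cabsD _ _))// !cabsM (splitr e) ltr_leD//.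
  have gy : cabs (g y) < cabs (g z) + 1.
    by rewrite -{1}(subrK (g z) (g y)) (le_lt_trans (ler_cabsD _ _))// addrC ltrD2l.
  rewrite ltr_pdivlMr// in k1; apply: le_lt_trans k1.
  by rewrite ler_wpM2l ?cabs_ge0// ltW.
rewrite ltr_pdivlMr// in k2.
apply: le_trans (ltW k2); rewrite mulrC ler_wpM2l ?cabs_ge0// lerDl.
exact: ler01.
Qed.
Arguments contM {f g z} _ _.

Lemma contV f z : f z != 0 -> {for z, continuous f} ->
  {for z, continuous (fun y => (f y)^-1)}.
Proof.
move=> fz /cont_cabsP cf; apply/cont_cabsP => e e0.
have c0 : 0 < cabs (f z) by rewrite cabs_gt0.
have [|d1 d10 h1] := cf (cabs (f z) / 2); first by rewrite divr_gt0.
have [|d2 d20 h2] := cf (e * cabs (f z) ^+ 2 / 2).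
  by rewrite divr_gt0// mulr_gt0// exprn_gt0.
exists (Num.min d1 d2); first by rewrite lt_min d10.
move=> y; rewrite lt_min => /andP[/h1 k1 /h2 k2].
have c1 : cabs (f z) / 2 < cabs (f y).
  by have := ler_cabsB (f z) (f y); rewrite (cabsC (f z)); lra.
have fy : f y != 0 by rewrite -cabs_gt0 (lt_trans _ c1)// divr_gt0.
rewrite (_ : _ - _ = (f z - f y) / (f y * f z)); last by field; rewrite fz fy.
rewrite cabsM cabsV cabsM cabsC ltr_pdivrMr ?mulr_gt0 ?cabs_gt0//.
apply: (lt_le_trans k2).
have := ler_wpM2l (ltW e0) (ler_wpM2r (ltW c0) (ltW c1)); rewrite expr2; lra.
Qed.
Arguments contV {f z} _ _.

Lemma contX f n z : {for z, continuous f} -> {for z, continuous (fun y => f y ^+ n)}.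
Proof.
move=> cf; elim: n => [|n IH]; first exact: cont_cst.
by apply: cont_eqfun (contM cf IH) => y /=; rewrite exprS.
Qed.
Arguments contX {f} n {z} _.

Lemma cont_comp f g z : {for z, continuous f} -> {for f z, continuous g} ->
  {for z, continuous (fun y => g (f y))}.
Proof.
move=> /cont_cabsP cf /cont_cabsP cg; apply/cont_cabsP => e /cg[d /cf[d' d'0 h'] h].
by exists d' => // y /h'/h.
Qed.
Arguments cont_comp {f g z} _ _.

Lemma cont_id z : {for z, continuous (fun y => y)}.
Proof. by apply/cont_cabsP => e e0; exists e. Qed.
Arguments cont_id z : clear implicits.

Lemma cderiv_cont f z l : cderiv f z l -> {for z, continuous f}.
Proof.
move=> [q cq [_ E]].
have K := contD (cont_cst (f z) z) (contM cq (contB (cont_id z) (cont_cst z z))).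
by apply: cont_eqfun K => y; rewrite -E.
Qed.
Arguments cderiv_cont {f z l} _.

Lemma cderiv_cst l z : cderiv (fun=> l) z 0.
Proof. by exists (fun=> 0); [exact: cont_cst|split=> // y; rewrite mul0r addr0]. Qed.

Lemma cderiv_id z : cderiv id z 1.
Proof. by exists (fun=> 1); [exact: cont_cst|split=> // y; rewrite mul1r subrKC]. Qed.

Lemma cderivD f g z a b : cderiv f z a -> cderiv g z b ->
  cderiv (fun y => f y + g y) z (a + b).
Proof.
move=> [q cq [qa E]] [p cp [pb H]]; exists (fun y => q y + p y); first exact: contD.
by rewrite qa pb; split => // y; rewrite E H; ring.
Qed.

Lemma cderivM f g z a b : cderiv f z a -> cderiv g z b ->
  cderiv (fun y => f y * g y) z (a * g z + f z * b).
Proof.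
move=> cf; have [q cq [qa E]] := cf; move=> [p cp [pb H]].
exists (fun y => q y * g z + f y * p y).
  by exact: contD (contM cq (cont_cst (g z) z)) (contM (cderiv_cont cf) cp).
by rewrite qa pb; split => // y; rewrite H mulrDr {1}(E y); ring.
Qed.

Lemma cderivV f z a : f z != 0 -> cderiv f z a ->
  cderiv (fun y => (f y)^-1) z (- a / f z ^+ 2).
Proof.
move=> fz cf; have [q cq [qa E]] := cf.
(* The factorization has to hold at every [y], including zeros of [f], where the inverse takes its
   default value 0. There the bare difference quotient is used; near [z] only the other branch is
   seen. *)
pose q1 y := if f y == 0 then ((f y)^-1 - (f z)^-1) / (y - z)
             else - q y * (f y)^-1 * (f z)^-1.
exists q1; last first.
  rewrite /q1 (negbTE fz) qa; split; first by field.
  move=> y; case: (eqVneq (f y) 0) => [fy|fy].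
    have yz : y - z != 0.
      by rewrite subr_eq0; apply: contraNneq fz => <-; rewrite fy.
    by rewrite divfK// subrKC.
  rewrite (_ : - _ * _ * _ * _ = - (f y - f z) / f y / f z); last first.
    by rewrite {2}(E y); field; rewrite fz fy.
  by field; rewrite fz fy.
have c2 : {for z, continuous (fun y => - q y * (f y)^-1 * (f z)^-1)}.
  have K := contM (contM (contB (cont_cst 0 z) cq) (contV fz (cderiv_cont cf)))
    (cont_cst (f z)^-1 z).
  by apply: cont_eqfun K => y; rewrite sub0r.
apply/cont_cabsP => e e0; have /cont_cabsP/(_ _ e0)[d d0 hd] := c2.
have fz0 : 0 < cabs (f z) by rewrite cabs_gt0.
have /cont_cabsP/(_ _ fz0)[d' d'0 hd'] := cderiv_cont cf.
exists (Num.min d d'); first by rewrite lt_min d0.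
move=> y; rewrite lt_min => /andP[/hd h /hd' h'].
rewrite /q1 (negbTE fz); case: eqVneq h' => [->|//].
by rewrite sub0r cabsN ltxx.
Qed.

Lemma cderiv_comp f g z a b : cderiv f z a -> cderiv g (f z) b ->
  cderiv (fun y => g (f y)) z (b * a).
Proof.
move=> cf; have [q cq [qa E]] := cf; move=> [p cp [pb H]].
exists (fun y => p (f y) * q y).
  exact: contM (cont_comp (cderiv_cont cf) cp) cq.
by rewrite qa pb; split => // y; rewrite H (E y) addrAC subrr add0r mulrA.
Qed.

Lemma cderivX f z a n : cderiv f z a ->
  cderiv (fun y => f y ^+ n) z (n%:R * a * f z ^+ n.-1).
Proof.
move=> cf; elim: n => [|n IH].
  by rewrite mul0r mul0r; exact: cderiv_cst.
have := cderivM cf IH.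
rewrite (_ : (fun y => _) = (fun y => f y ^+ n.+1)); last by apply/funext => y; rewrite exprS.
rewrite (_ : a * _ + _ = n.+1%:R * a * f z ^+ n.+1.-1)//=.
case: n {IH} => [|n]; first by rewrite expr0 !mul0r mulr0 addr0 mul1r.
rewrite /= -(natr1 n.+1) exprS; ring.
Qed.

Lemma cderiv_near f g z l : (\forall y \near z, f y = g y) ->
  cderiv f z l -> cderiv g z l.
Proof.
move=> /nbhs_cabsP[d d0 hd] cf; have [q cq [qa E]] := cf.
have fg : f z = g z by apply: hd; rewrite subrr cabs0.
exists (fun y => if cabs (y - z) < d then q y else (g y - g z) / (y - z)).
  apply/cont_cabsP => e e0; have /cont_cabsP/(_ _ e0)[d' d'0 hd'] := cq.
  exists (Num.min d d'); first by rewrite lt_min d0.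
  move=> y; rewrite lt_min => /andP[h /hd' h']; rewrite h.
  by rewrite subrr cabs0 d0.
rewrite subrr cabs0 d0; split => // y; case: ifPn => h.
  by rewrite -(hd y h) -fg E.
have yz : y - z != 0 by apply: contraNneq h => ->; rewrite cabs0.
by rewrite divfK// subrKC.
Qed.

Lemma cderiv_epsP f z l : cderiv f z l -> forall e : R, 0 < e ->
  exists2 d : R, 0 < d & forall y, cabs (y - z) < d ->
  cabs (f y - f z - l * (y - z)) <= e * cabs (y - z).
Proof.
move=> [q /cont_cabsP cq [qa E]] e e0.
have [d d0 hd] := cq e e0; exists d => // y /hd; rewrite qa => /ltW h.
rewrite {1}E (_ : _ - _ - _ = (q y - l) * (y - z)); last by ring.
by rewrite cabsM ler_wpM2r// cabs_ge0.
Qed.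

Lemma cderiv_of_quot f z l (q : R[i] -> R[i]) :
  {for z, continuous q} -> q z = l ->
  (forall y, y != z -> q y = (f y - f z) / (y - z)) -> cderiv f z l.
Proof.
move=> cq qz E; exists q => //; split => // y.
have [->|yz] := eqVneq y z; first by rewrite subrr mulr0 addr0.
by rewrite E// divfK ?subr_eq0// subrKC.
Qed.

Lemma derivable_cderiv f z : derivable f z 1 -> cderiv f z ('D_1 f z).
Proof.
move=> df.
apply: (@cderiv_of_quot _ _ _ (fun y => if y == z then 'D_1 f z else (f y - f z) / (y - z))).
- apply/cont_cabsP => e e0; rewrite eqxx.
  have := df; rewrite /derivable => /cvg_ex[l hl].
  have Dl : 'D_1 f z = l by rewrite /derive; exact: cvg_lim.
  have := hl [set w | cabs (w - l) < e] => /(_ _)[].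
    by apply/nbhs_cabsP; exists e.
  move=> d0 /= d00 hd.
  have [d d1 hd2] : exists2 d : R, 0 < d & forall y : R[i], cabs (y - 0) < d -> y != 0 ->
     cabs (y^-1 *: (f (y *: 1 + z) - f z) - l) < e.
    have /nbhs_cabsP[d d1 h] : nbhs (0 : R[i]) (ball_ [eta Num.Def.normr] 0 d0).
      by apply/nbhs_ballP; exists d0 => // w; rewrite -ball_normE.
    by exists d => // y /h /hd H /H.
  exists d => // y h; case: eqVneq => [|yz]; first by rewrite subrr cabs0.
  have := hd2 (y - z); rewrite subr0 subr_eq0 => /(_ h yz).
  by rewrite Dl scaler1 subrK mulrC.
- by rewrite eqxx.
- by move=> y /negbTE ->.
Qed.

Lemma cderiv_derivable f z l : cderiv f z l -> derivable f z 1 /\ 'D_1 f z = l.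
Proof.
move=> [q /cont_cabsP cq [qa E]].
suff H : h^-1 *: ((f \o shift z) (h *: 1) - f z) @[h --> (0 : R[i])^'] --> l.
  by split; [apply/cvg_ex; exists l|exact: cvg_lim H].
move=> A /nbhs_cabsP[e e0 he].
have [d d0 hd] := cq e e0.
apply/nbhs_ballP; exists d%:C; first by rewrite /= ltcR.
move=> h; rewrite -ball_normE /= sub0r normrN normC_cabs ltcR => hd' h0.
apply: he; rewrite scaler1 E.
rewrite (_ : _ *: _ = q (h + z)).
  by rewrite -qa; apply: hd; rewrite addrK.
rewrite (addrC (f z)) addrK addrK /GRing.scale /= mulrC mulfK//.
Qed.
End Cderiv.

Arguments cont_cst {R} l z t _ : rename.
Arguments cont_eqfun {R f g z} _ _.
Arguments contD {R f g z} _ _.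
Arguments contB {R f g z} _ _.
Arguments contM {R f g z} _ _.
Arguments cont_comp {R f g z} _ _.
Arguments contV {R f z} _ _.
Arguments contX {R f} n {z} _.
Arguments cont_id {R} z t _ : rename.
Arguments cderiv_cont {R f z l} _.

(** * The maximum modulus principle *)

Section Polar.
Variable R : realType.
Local Notation mu := (@lebesgue_measure R).
Local Notation I a b f := (\int[mu]_(t in `[a, b]) f t).

Lemma is_derive_eps (f : R -> R) (x d : R) : is_derive x 1 f d ->
  forall e, 0 < e -> exists2 a : R, 0 < a & forall h, `|h| < a ->
  `|f (h + x) - f x - d * h| <= e * `|h|.
Proof.
move=> [df Ef] e e0.
have hl : h^-1 *: ((f \o shift x) (h *: 1) - f x) @[h --> 0^'] --> d.
  by rewrite -Ef; exact: df.
have /cvgrPdist_le/(_ _ e0)/nbhs_ballP[a /= a0 ha] := hl.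
exists a => // h ha'; have [->|h0] := eqVneq h 0.
  by rewrite add0r mulr0 subrr subr0 normr0 mulr0.
have := ha h; rewrite -ball_normE /= sub0r normrN => /(_ ha' h0).
rewrite /GRing.scale /= mulr1 => k.
rewrite -ler_pdivrMr ?normr_gt0// -normfV -normrM distrC in k *.
by congr (`|_| <= _) : k; field.
Qed.

(** The complex exponential of [x + i t]: [a + cis_exp x t] is the system of log-polar coordinates
    around [a]. *)
Definition cis_exp (x t : R) : R[i] := (expR x * cos t) +i* (expR x * sin t).

Lemma cis_expD x y s t : cis_exp (x + y) (s + t) = cis_exp x s * cis_exp y t.
Proof.
rewrite /cis_exp expRD cosD sinD.
apply/eqP; rewrite eq_complex /=; apply/andP; split; apply/eqP; ring.
Qed.

Lemma cabs_cis_exp x t : cabs (cis_exp x t) = expR x.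
Proof.
rewrite /cis_exp /cabs /= !exprMn -mulrDr cos2Dsin2 mulr1 sqrtr_sqr.
by rewrite ger0_norm// expR_ge0.
Qed.

(** Complex differentiability of the exponential at 0; the functional equation [cis_expD] carries it
    to every other point. *)
Lemma cis_exp_eps e : 0 < e -> exists2 d : R, 0 < d & forall u v, `|u| < d -> `|v| < d ->
  cabs (cis_exp u v - 1 - (u +i* v)) <= e * (`|u| + `|v|).
Proof.
move=> e0; have e4 : 0 < e / 8 by rewrite divr_gt0.
have [d1 d10 h1] := is_derive_eps (is_derive_expR 0) e4.
have [d2 d20 h2] := is_derive_eps (is_derive_sin 0) e4.
have [d3 d30 h3] := is_derive_eps (is_derive_cos 0) e4.
exists (Num.min d1 (Num.min d2 (Num.min d3 (Num.min (1 / 2) (e / 8))))).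
  by rewrite !lt_min d10 d20 d30 e4 andbT; lra.
move=> u v; rewrite !lt_min => /and5P[ku1 ku2 ku3 ku4 ku5] /and5P[kv1 kv2 kv3 kv4 kv5].
have := h1 u ku1; have := h2 v kv2; have := h3 v kv3.
rewrite !addr0 expR0 cos0 sin0 mul1r subr0 oppr0 mul0r subr0 mul1r.
set k := e / 8 in e4 ku5 *.
have eu2 : expR u <= 2.
  have := expR_ge1Dx (- u); rewrite expRN.
  have u2 : 1 / 2 <= 1 - u by move: ku4; rewrite ltr_norml => /andP[_]; lra.
  move=> h; have := le_trans u2 h; rewrite div1r lef_pV2 ?posrE ?expR_gt0//.
move=> c1 c2 c3.
have eu0 := expR_ge0 u.
have d : `|expR u - 1| <= 2 * k.
  rewrite (_ : expR u - 1 = (expR u - 1 - u) + u); last by rewrite subrK.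
  rewrite (le_trans (ler_normD _ _))//.
  have := ler_wpM2l (ltW e4) (ltW ku4); lra.
apply: (le_trans (ler_cabs_ReIm _)); rewrite !ReB !ImB /=.
rewrite (_ : expR u * cos v - 1 - u = (expR u - 1 - u) + expR u * (cos v - 1)); last by ring.
rewrite (_ : expR u * sin v - 0 - v = expR u * (sin v - v) + (expR u - 1) * v); last by ring.
have b1 : `|expR u * (cos v - 1)| <= 2 * (k * `|v|).
  by rewrite normrM (ger0_norm eu0) ler_pM.
have b2 : `|expR u * (sin v - v)| <= 2 * (k * `|v|).
  by rewrite normrM (ger0_norm eu0) ler_pM.
have b3 : `|(expR u - 1) * v| <= 2 * k * `|v| by rewrite normrM ler_wpM2r.
have n1 := ler_normD (expR u - 1 - u) (expR u * (cos v - 1)).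
have n2 := ler_normD (expR u * (sin v - v)) ((expR u - 1) * v).
have eE : e = 8 * k by rewrite /k; lra.
have := mulr_ge0 (ltW e4) (normr_ge0 u); have := mulr_ge0 (ltW e4) (normr_ge0 v).
rewrite eE; lra.
Qed.

Lemma cis_exp_cont x t (e : R) : 0 < e -> exists2 d : R, 0 < d & forall y s,
  `|y - x| < d -> `|s - t| < d -> cabs (cis_exp y s - cis_exp x t) < e.
Proof.
move=> e0; have ex0 : 0 < expR x by exact: expR_gt0.
have [d d0 hd] := cis_exp_eps (ltr01 : 0 < 1 :> R).
have q0 : 0 < e / (4 * expR x) by rewrite divr_gt0// mulr_gt0.
exists (Num.min d (e / (4 * expR x))); first by rewrite lt_min d0.
move=> y s; rewrite !lt_min => /andP[y1 y2] /andP[s1 s2].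
rewrite (_ : cis_exp y s = cis_exp x t * cis_exp (y - x) (s - t)); last first.
  by rewrite -cis_expD !subrKC.
rewrite (_ : _ - _ = cis_exp x t * (cis_exp (y - x) (s - t) - 1)); last by ring.
rewrite cabsM cabs_cis_exp mulrC -ltr_pdivlMr//.
have := hd _ _ y1 s1; rewrite mul1r => h.
rewrite (_ : _ - 1 = (cis_exp (y - x) (s - t) - 1 - ((y - x) +i* (s - t)))
  + ((y - x) +i* (s - t))); last by rewrite subrK.
apply: (le_lt_trans (ler_cabsD _ _)).
have h2 : cabs ((y - x) +i* (s - t)) <= `|y - x| + `|s - t| := ler_cabs_ReIm _.
rewrite (_ : e / expR x = 4 * (e / (4 * expR x))); last by field; rewrite gt_eqF.
move: h h2 y2 s2; move: (e / (4 * _)) => q; clear=> *; lra.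
Qed.

Lemma Rintegral_le_cst (a b k : R) (f : R -> R) : a <= b ->
  {within `[a, b], continuous f} -> (forall t, a <= t -> t <= b -> f t <= k) ->
  I a b f <= k * (b - a).
Proof.
move=> ab cf h.
have mab : fine (mu `[a, b]%classic) = b - a.
  rewrite lebesgue_measure_itv /= lte_fin; case: ltP => [|ba] //=.
  by apply/esym/eqP; rewrite subr_eq0 eq_le ba.
rewrite -mab -Rintegral_cst//; apply: le_Rintegral => //.
- exact: integrable_cont.
- by apply: integrable_cont; apply: continuous_subspaceT => x; exact: cst_continuous.
- by move=> t /=; rewrite in_itv/= => /andP[]; exact: h.
Qed.

Lemma Rintegral_ge_cst (a b k : R) (f : R -> R) : a <= b ->
  {within `[a, b], continuous f} -> (forall t, a <= t -> t <= b -> k <= f t) ->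
  k * (b - a) <= I a b f.
Proof.
move=> ab cf h.
have mab : fine (mu `[a, b]%classic) = b - a.
  rewrite lebesgue_measure_itv /= lte_fin; case: ltP => [|ba] //=.
  by apply/esym/eqP; rewrite subr_eq0 eq_le ba.
rewrite -mab -Rintegral_cst//; apply: le_Rintegral => //.
- by apply: integrable_cont; apply: continuous_subspaceT => x; exact: cst_continuous.
- exact: integrable_cont.
- by move=> t /=; rewrite in_itv/= => /andP[]; exact: h.
Qed.

Lemma contR_epsP (f : R -> R) x : {for x, continuous f} <->
  forall e : R, 0 < e -> exists2 d : R, 0 < d &
    forall y, `|y - x| < d -> `|f y - f x| < e.
Proof.
split=> [cf e e0|H].
  have /cvgrPdist_lt/(_ _ e0)/nbhs_ballP[d /= d0 hd] := cf.
  by exists d => // y h; rewrite distrC; apply: hd; rewrite -ball_normE /= distrC.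
apply/cvgrPdist_lt => e e0; have [d d0 hd] := H e e0.
apply/nbhs_ballP; exists d => // y; rewrite /= => h.
have {}h : `|x - y| < d by exact: h.
by rewrite distrC; apply: hd; rewrite distrC.
Qed.

Section MeanValue.
Variables (g : R[i] -> R[i]) (a : R[i]) (r : R).
Hypotheses (r0 : 0 < r)
  (cg : forall z, cabs (z - a) <= r -> {for z, continuous g})
  (dg : forall z, 0 < cabs (z - a) -> cabs (z - a) <= r -> exists l, cderiv g z l).

Let pt x t := a + cis_exp x t.
Let X := ln r.

Let pt_dist x t : cabs (pt x t - a) = expR x.
Proof. by rewrite /pt addrC addKr cabs_cis_exp. Qed.

Let pt_le x t : x <= X -> cabs (pt x t - a) <= r.
Proof. by move=> xX; rewrite pt_dist -(@lnK _ r) ?posrE// ler_expR. Qed.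

Let pt_gt0 x t : 0 < cabs (pt x t - a).
Proof. by rewrite pt_dist expR_gt0. Qed.

Lemma polar_cont x t (e : R) : x <= X -> 0 < e -> exists2 d : R, 0 < d & forall y s,
  `|y - x| < d -> `|s - t| < d -> cabs (g (pt y s) - g (pt x t)) < e.
Proof.
move=> xX e0; have /cont_cabsP/(_ _ e0)[d d0 hd] := cg (pt_le t xX).
have [d' d'0 hd'] := cis_exp_cont x t d0.
exists d' => // y s h1 h2; apply: hd.
by rewrite /pt opprD addrACA subrr add0r; exact: hd'.
Qed.

Lemma polar_cauchy_riemann x t : x <= X -> exists k l : R, forall e, 0 < e ->
  exists2 d : R, 0 < d & forall y s, `|y - x| < d -> `|s - t| < d ->
  cabs (g (pt y s) - g (pt x t) - (k +i* l) * ((y - x) +i* (s - t))) <=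
    e * (`|y - x| + `|s - t|).
Proof.
move=> xX; have [l Hl] := dg (pt_gt0 x t) (pt_le t xX).
pose K := l * cis_exp x t.
exists (complex.Re K), (complex.Im K) => e e0.
have -> : complex.Re K +i* complex.Im K = K by case: K.
pose E := expR x; have E0 : 0 < E by exact: expR_gt0.
pose L := cabs l + 1; have L0 : 0 < L by rewrite ltr_wpDl ?cabs_ge0.
have e1 : 0 < e / (4 * E) by rewrite divr_gt0// mulr_gt0.
have [d1 d10 h1] := cderiv_epsP Hl e1.
have e2 : 0 < Num.min 1 (e / (2 * L * E)).
  by rewrite lt_min ltr01 /= divr_gt0// !mulr_gt0.
have [d2 d20 h2] := cis_exp_eps e2.
have [d3 d30 h3] := cis_exp_cont x t d10.
exists (Num.min d2 d3); first by rewrite lt_min d20.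
move=> y s; rewrite !lt_min => /andP[y2 y3] /andP[s2 s3].
set u := y - x in y2 *; set v := s - t in s2 *.
have Ept : pt y s - pt x t = cis_exp x t * (cis_exp u v - 1).
  rewrite /pt opprD addrACA subrr add0r -{1}(subrKC x y) -{1}(subrKC t s) cis_expD.
  by rewrite -/u -/v; ring.
have hp : cabs (pt y s - pt x t) < d1.
  by rewrite /pt opprD addrACA subrr add0r; exact: h3.
have := h1 _ hp.
rewrite Ept cabsM cabs_cis_exp -/E => k1.
have := h2 u v y2 s2.
set w := u +i* v => k2.
have w1 : cabs w <= `|u| + `|v| by exact: ler_cabs_ReIm.
set T := `|u| + `|v| in k2 w1 *.
have T0 : 0 <= T by rewrite addr_ge0.
have k3 : cabs (cis_exp u v - 1 - w) <= T.
  by apply: le_trans k2 _; rewrite ler_piMl// ge_min lexx.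
have k4 : cabs (cis_exp u v - 1 - w) <= e / (2 * L * E) * T.
  by apply: le_trans k2 _; rewrite ler_wpM2r// ge_min lexx orbT.
have k5 : cabs (cis_exp u v - 1) <= 2 * T.
  by rewrite -(subrK w (cis_exp u v - 1)) (le_trans (ler_cabsD _ _))//; lra.
have -> : g (pt y s) - g (pt x t) - K * w =
    (g (pt y s) - g (pt x t) - l * (cis_exp x t * (cis_exp u v - 1))) +
    K * (cis_exp u v - 1 - w) by rewrite /K; ring.
apply: (le_trans (ler_cabsD _ _)); rewrite (splitr e) mulrDl; apply: lerD.
  apply: (le_trans k1).
  rewrite (_ : e / 2 * T = e / (4 * E) * (E * (2 * T))); last by field; rewrite gt_eqF.
  by rewrite !ler_wpM2l// ltW.
rewrite !cabsM cabs_cis_exp -/E.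
rewrite (_ : e / 2 * T = L * E * (e / (2 * L * E) * T)); last first.
  by field; rewrite !gt_eqF.
by rewrite ler_pM ?mulr_ge0 ?cabs_ge0 ?(ltW E0)// ler_wpM2r ?(ltW E0)// lerDl.
Qed.

Let J x := I 0 (pi *+ 2) (fun t => complex.Re (g (pt x t))).

Lemma polar_cont_angle x : x <= X -> continuous (fun t => complex.Re (g (pt x t))).
Proof.
move=> xX t; apply/contR_epsP => e e0; have [d d0 hd] := polar_cont t xX e0.
exists d => // s h; rewrite -ReB (le_lt_trans (ler_Re_cabs _))//.
by apply: hd => //; rewrite subrr normr0.
Qed.

Let pi2_ge0 : 0 <= pi *+ 2 :> R. Proof. by rewrite mulrn_wge0// pi_ge0. Qed.

(** The rectangle [[x, X] x [0, 2 pi]] covers an annulus around [a]. Its two horizontal sides land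
    on the same segment by periodicity, so their contributions cancel and the two circles have equal
    integrals. The centre [a] sits at [x = -oo], outside every such rectangle. *)
Lemma polar_integral_const x : x <= X -> J x = J X.
Proof.
move=> xX; apply/esym/eqP; rewrite -subr_eq0; apply/eqP.
have := @cauchy_riemann_rectangle R (fun x t => complex.Re (g (pt x t)))
  (fun x t => complex.Im (g (pt x t))) x X 0 (pi *+ 2) xX pi2_ge0.
rewrite /J => ->.
- rewrite (_ : (fun x0 : R => complex.Im (g (pt x0 (pi *+ 2)))) =
    (fun x0 : R => complex.Im (g (pt x0 0)))) ?subrr//.
  by apply/funext => y; rewrite /pt /cis_exp cos2pi sin2pi cos0 sin0.
- by move=> y xy yX; apply: continuous_subspaceT; exact: polar_cont_angle.
- move=> t _ _; apply/subspace_continuousP => y /=; rewrite in_itv /= => /andP[xy yX].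
  apply: (@cvg_within_filter _ _ _ (nbhs y)).
  apply/contR_epsP => e e0; have [d d0 hd] := polar_cont t yX e0.
  exists d => // s h; rewrite -ImB (le_lt_trans (ler_Im_cabs _))//.
  by apply: hd => //; rewrite subrr normr0.
- move=> y t xy yX _ _; have [k [l H]] := polar_cauchy_riemann t yX.
  exists k, l => e e0; have [d d0 hd] := H e e0; exists d => // s u xs sX hs hu.
  have k1 := hd s u hs hu.
  split; apply: le_trans k1.
    by apply: le_trans (ler_Re_cabs _); rewrite !ReB ReM.
  by apply: le_trans (ler_Im_cabs _); rewrite !ImB ImM /= [k * _ + _]addrC.
Qed.

(** A deficit at the point [a + r] persists, by continuity, on an arc of length [b], so the integral
    over the circle falls short of [2 pi M] by at least [c b]. By continuity at [a], small circles
    fall short by less, yet all circles have the same integral. *)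
Lemma mean_value_max : (forall z, cabs (z - a) = r -> complex.Re (g z) <= complex.Re (g a)) ->
  complex.Re (g (a + r%:C)) = complex.Re (g a).
Proof.
move=> hM; set M := complex.Re (g a) in hM *.
have pt0 : pt X 0 = a + r%:C by rewrite /pt /cis_exp cos0 sin0 mulr1 mulr0 lnK.
have hX t : complex.Re (g (pt X t)) <= M.
  by apply: hM; rewrite pt_dist lnK.
have twopi_gt0 : 0 < pi *+ 2 :> R by rewrite pmulrn_lgt0// pi_gt0.
apply/eqP; rewrite eq_le; apply/andP; split; first by rewrite -pt0; exact: hX.
rewrite leNgt; apply/negP => hlt.
pose c := (M - complex.Re (g (a + r%:C))) / 2.
have c0 : 0 < c by rewrite divr_gt0// subr_gt0.
have /contR_epsP/(_ _ c0)[d d0 hd] := @polar_cont_angle X (lexx _) 0.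
pose b := Num.min (d / 2) (pi *+ 2).
have b0 : 0 < b by rewrite lt_min divr_gt0.
have bd : b < d by rewrite gt_min ltr_pdivrMr// ltr_pMr// ltr1n.
have b2 : b <= pi *+ 2 by rewrite ge_min lexx orbT.
have cU u v : {within `[u, v], continuous (fun t => complex.Re (g (pt X t)))}.
  by apply: continuous_subspaceT; exact: polar_cont_angle.
have J1 : J X <= M * (pi *+ 2) - c * b.
  rewrite /J (@Rintegral_split _ 0 b) ?(ltW b0)//.
  rewrite (_ : _ - _ = (M - c) * (b - 0) + M * (pi *+ 2 - b)); last by ring.
  apply: lerD; apply: Rintegral_le_cst => //; first exact: ltW.
  move=> t t0 tb; have := hd t; rewrite subr0 ger0_norm// pt0 => /(_ (le_lt_trans tb bd)).
  by rewrite ltr_norml => /andP[_]; rewrite /c -/M; lra.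
have [e [e0 he]] : exists e, 0 < e /\ e * (pi *+ 2) < c * b.
  move: (c * b) (mulr_gt0 c0 b0) (pi *+ 2) twopi_gt0 => q q0 P P0.
  exists (q / (2 * P)); split; first by rewrite divr_gt0 ?mulr_gt0.
  rewrite (_ : q / (2 * P) * P = q / 2); last by field; rewrite gt_eqF.
  by rewrite ltr_pdivrMr// ltr_pMr ?mulr_gt0// ltr1n.
have ca : {for a, continuous g} by apply: cg; rewrite subrr cabs0 ltW.
have /cont_cabsP/(_ _ e0)[d' d'0 hd'] := ca.
pose x := Num.min X (ln (d' / 2)).
have xX : x <= X by rewrite ge_min lexx.
have xd : expR x < d'.
  have : expR x <= d' / 2.
    by rewrite -[leRHS]lnK ?posrE ?divr_gt0// ler_expR ge_min lexx orbT.
  by move/le_lt_trans; apply; rewrite ltr_pdivrMr// ltr_pMr// ltr1n.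
have J2 : (M - e) * (pi *+ 2) <= J x.
  rewrite -[pi *+ 2 in leLHS]subr0; apply: Rintegral_ge_cst => //.
    by apply: continuous_subspaceT; exact: polar_cont_angle.
  move=> t _ _; have := hd' (pt x t); rewrite pt_dist => /(_ xd).
  move/(le_lt_trans (ler_Re_cabs _)); rewrite ReB -/M ltr_norml => /andP[+ _].
  by rewrite ltrBrDr addrC => /ltW.
move: J1; rewrite -(polar_integral_const xX) => J1.
move: (le_trans J2 J1) he; rewrite mulrBl; lra.
Qed.
End MeanValue.

(** Multiplying by the conjugate of [h a] makes the value at the centre real and nonnegative, so the
    bound on the modulus becomes a bound on the real part. *)
Lemma local_max_modulus (h : R[i] -> R[i]) (a : R[i]) (r : R) : 0 < r ->
  (forall z, cabs (z - a) <= r -> {for z, continuous h}) ->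
  (forall z, 0 < cabs (z - a) -> cabs (z - a) <= r -> exists l, cderiv h z l) ->
  (forall z, cabs (z - a) = r -> cabs (h z) <= cabs (h a)) ->
  cabs (h (a + r%:C)) = cabs (h a).
Proof.
move=> r0 ch dh hM; have [ha|ha] := eqVneq (h a) 0.
  apply/eqP; rewrite eq_le hM; last by rewrite addrC addKr cabs_real gtr0_norm.
  by rewrite ha cabs0 cabs_ge0.
have h0 : 0 < cabs (h a) by rewrite cabs_gt0.
pose c : R[i] := conjc (h a); have cc : cabs c = cabs (h a).
  by rewrite /c; case: (h a) => u v; rewrite /cabs /= sqrrN.
have Rec : complex.Re (h a * c) = cabs (h a) ^+ 2.
  by rewrite sqr_cabs ReM /c; case: (h a) => u v /=; ring.
have bnd z : cabs (z - a) = r -> complex.Re (h z * c) <= complex.Re (h a * c).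
  move=> za; rewrite Rec (le_trans (ler_norm _))// (le_trans (ler_Re_cabs _))//.
  by rewrite cabsM cc expr2 ler_wpM2r ?cabs_ge0// hM.
have cg z : cabs (z - a) <= r -> {for z, continuous (fun y => h y * c)}.
  by move=> hz; apply: contM (ch z hz) (cont_cst c z).
have dg z : 0 < cabs (z - a) -> cabs (z - a) <= r ->
    exists l, cderiv (fun y => h y * c) z l.
  by move=> z0 /(dh z z0)[l Hl]; eexists; exact: cderivM Hl (cderiv_cst c z).
have H := mean_value_max r0 cg dg bnd.
apply/eqP; rewrite eq_le hM ?andbT; last first.
  by rewrite addrC addKr cabs_real gtr0_norm.
rewrite -(ler_pM2r h0) -expr2 -Rec -H.
by rewrite (le_trans (ler_norm _))// (le_trans (ler_Re_cabs _))// cabsM cc.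
Qed.

(* [p] is a point where [h] is only assumed continuous. *)
Theorem maximum_modulus (O K : set R[i]) (p : R[i]) (h : R[i] -> R[i]) (B : R) :
  open O -> compact K -> K `<=` O ->
  (forall z, O z -> {for z, continuous h}) ->
  (forall z, O z -> z <> p -> exists l, cderiv h z l) ->
  (forall z, O z -> ~ K z -> cabs (h z) <= B) ->
  forall z, O z -> cabs (h z) <= B.
Proof.
move=> oO cK KO ch dh hB z0 Oz0; rewrite leNgt; apply/negP => hlt.
have Kz0 : K z0 by apply: contrapT => /(hB _ Oz0); rewrite leNgt hlt.
have chabs z : O z -> {for z, continuous (fun y => cabs (h y))}.
  move=> /ch /cont_cabsP cz; apply/contR_cabsP => e /cz[d d0 hd].
  by exists d => // y /hd; exact/le_lt_trans/cabs_lip.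
have wK (f : R[i] -> R) : (forall z, O z -> {for z, continuous f}) ->
    {within K, continuous f}.
  move=> cf; apply: continuous_in_subspaceT => y; rewrite inE => /KO; exact: cf.
have [c] := @compact_EVT_max _ _ (fun y => cabs (h y)) K (ex_intro _ z0 Kz0) cK (wK _ chabs).
rewrite inE => Kc hc; set M := cabs (h c) in hc.
have BM : B < M by apply: (lt_le_trans hlt); apply: hc; rewrite inE.
pose E := K `&` [set y | cabs (h y) = M].
have cE : compact E.
  apply: (@subclosed_compact _ _ K) => //; last by move=> y [].
  have clK : closed K by apply: compact_closed cK; exact: norm_hausdorff.
  move=> y Ey; have Ky : K y.
    by apply: clK => U /Ey[w [[Kw _] Uw]]; exists w.
  split => //=; apply/eqP; rewrite -subr_eq0 -normr_eq0 eq_le normr_ge0 andbT.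
  apply/ler_addgt0Pr => e e0; rewrite add0r.
  have /contR_cabsP/(_ _ e0)[d d0 hd] := chabs _ (KO _ Ky).
  have /Ey[w [[_ /= Ew] /= hw]] : nbhs y [set w | cabs (w - y) < d].
    by apply/nbhs_cabsP; exists d.
  by have := hd _ hw; rewrite Ew distrC => /ltW.
have cRe : {within E, continuous (@complex.Re R)}.
  by apply: continuous_subspaceT; exact: continuous_Re.
(* Among the maximum points, [a] is one furthest to the right. The local principle makes [a + r] a
   maximum point as well, which is a contradiction; connectedness of [O] never enters. *)
have [a] := compact_EVT_max (ex_intro _ c (conj Kc erefl)) cE cRe.
rewrite inE => -[Ka /= ha] amax.
have Oa := KO _ Ka.
have [r1 r10 hr1] := (open_cabsP O).1 oO a Oa.
(* The bound [r2] keeps [p] out of the punctured disk around [a], and [p = a] is harmless there. *)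
have [r2 r20 hr2] : exists2 r2, 0 < r2 & forall z, 0 < cabs (z - a) -> cabs (z - a) < r2 -> z <> p.
  have [->|ap] := eqVneq p a.
    by exists 1 => // z zpos _ za; rewrite za subrr cabs0 ltxx in zpos.
  exists (cabs (p - a)); first by rewrite cabs_gt0 subr_eq0.
  by move=> z _ hz zp; rewrite zp ltxx in hz.
pose r := Num.min r1 r2 / 2.
have r0 : 0 < r by rewrite divr_gt0// lt_min r10.
have rm : r < Num.min r1 r2 by rewrite ltr_pdivrMr// ltr_pMr ?ltr1n// lt_min r10.
have [rr1 rr2] : r < r1 /\ r < r2 by apply/andP; rewrite -lt_min.
have Oz z : cabs (z - a) <= r -> O z by move=> /le_lt_trans/(_ rr1)/hr1.
have hle z : O z -> cabs (h z) <= cabs (h a).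
  rewrite ha => Oz'; have [Kz|/(hB _ Oz')/le_trans->//] := pselect (K z); last exact: ltW.
  by apply: hc; rewrite inE.
have Or : cabs (a + r%:C - a) = r by rewrite addrC addKr cabs_real gtr0_norm.
have H : cabs (h (a + r%:C)) = cabs (h a).
  apply: local_max_modulus => //.
  - by move=> z /Oz/ch.
  - by move=> z zpos hz; apply: dh; [exact: Oz|apply: hr2 => //; exact: le_lt_trans rr2].
  - by move=> z hz; apply: hle; apply: Oz; rewrite hz.
have Oar : O (a + r%:C) by apply: Oz; rewrite Or.
have Kar : K (a + r%:C).
  by apply: contrapT => /(hB _ Oar); rewrite H ha leNgt BM.
have Ear : E (a + r%:C) by split => //=; rewrite H.
by have := amax (a + r%:C); rewrite inE => /(_ Ear); rewrite ReD /= gerDl leNgt r0.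
Qed.
End Polar.

(** * Univalent functions *)

Section Univalent.
Variable R : realType.
Implicit Types (f h : R[i] -> R[i]) (a z w : R[i]).

Lemma open_cball a (r : R) : open [set z | cabs (z - a) < r].
Proof.
apply/open_cabsP => z /= hz; exists (r - cabs (z - a)); first by rewrite subr_gt0.
by move=> y; rewrite ltrBrDr; apply: le_lt_trans; exact: ler_cabs_distD.
Qed.

Lemma cderiv_subr f c z l : cderiv f z l -> cderiv (fun y => f y - c) z l.
Proof. by move=> df; have := cderivD df (cderiv_cst (- c) z); rewrite addr0. Qed.

Lemma cderiv_inv_subr f c z l : cderiv f z l -> f z != c ->
  exists k, cderiv (fun y => (f y - c)^-1) z k.
Proof.
move=> df fc; eexists; apply: (@cderivV _ (fun y => f y - c)); last exact: cderiv_subr df.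
by rewrite subr_eq0.
Qed.

Lemma cderiv_quotient f a z l : cderiv f z l -> z != a ->
  exists k, cderiv (fun y => (f y - f a) / (y - a)) z k.
Proof.
move=> df za; have [k hk] := cderiv_inv_subr (cderiv_id z) za.
by eexists; exact: cderivM (cderiv_subr (f a) df) hk.
Qed.

Lemma near_neq a z : z != a -> \forall y \near z, y != a.
Proof.
move=> za; apply/nbhs_cabsP; exists (cabs (a - z)).
  by rewrite cabs_gt0 subr_eq0 eq_sym.
by move=> y; apply: contraTneq => ->; rewrite ltxx.
Qed.

Lemma cderiv_quotient_ext f a z l (q : R[i] -> R[i]) :
  (forall y, f y = f a + q y * (y - a)) -> cderiv f z l -> z != a ->
  exists k, cderiv q z k.
Proof.
move=> E df za; have [k hk] := cderiv_quotient df za; exists k.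
apply: cderiv_near hk; near=> y.
have ya : y - a != 0 by rewrite subr_eq0; near: y; exact: near_neq.
by rewrite (E y) [f a + _]addrC addrK mulfK.
Unshelve. all: by end_near. Qed.

(** The maximum principle for the difference quotient [q], whose value at [a] is the derivative.
    Outside the compact disk of radius [r / 2] one has [|q| <= M / (r / 2)], whence the factor 2. *)
Lemma cauchy_estimate f a l (r M : R) : 0 < r ->
  (forall z, cabs (z - a) < r -> exists k, cderiv f z k) ->
  (forall z, cabs (z - a) < r -> cabs (f z - f a) <= M) ->
  cderiv f a l -> cabs l <= 2 * M / r.
Proof.
move=> r0 df fM [q cq [qa E]].
pose O := [set z | cabs (z - a) < r]; pose K := [set z | cabs (z - a) <= r / 2].
have r2 : r / 2 < r by rewrite ltr_pdivrMr// ltr_pMr// ltr1n.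
have r20 : 0 < r / 2 by rewrite divr_gt0.
have aO : O a by rewrite /O /= subrr cabs0.
have dq z : O z -> z <> a -> exists k, cderiv q z k.
  by move=> /df[k hk] /eqP za; exact: cderiv_quotient_ext E hk za.
have KO : K `<=` O by move=> z /= /le_lt_trans; exact.
have cO z : O z -> {for z, continuous q}.
  move=> Oz; have [->|/eqP za] := eqVneq z a; first exact: cq.
  by have [k /cderiv_cont] := dq z Oz za.
have bO z : O z -> ~ K z -> cabs (q z) <= 2 * M / r.
  move=> Oz /negP; rewrite -ltNge => hz.
  have z0 : 0 < cabs (z - a) by exact: lt_trans hz.
  rewrite -(ler_pM2r z0) -cabsM.
  have -> : q z * (z - a) = f z - f a by rewrite (E z) [f a + _]addrC addrK.
  apply: (le_trans (fM z Oz)).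
  have M0 : 0 <= M by apply: le_trans (fM z Oz); exact: cabs_ge0.
  rewrite mulrAC ler_pdivlMr// -mulrA mulrCA ler_wpM2l//; move: hz; lra.
by rewrite -qa; exact: maximum_modulus (@open_cball a r) (@compact_cball _ a (r / 2)) KO cO dq bO a aO.
Qed.

Section Injective.
Variables (f : R[i] -> R[i]) (a : R[i]) (r : R).
Hypotheses (r0 : 0 < r)
  (df : forall z, cabs (z - a) <= r -> exists k, cderiv f z k)
  (fi : forall y z, cabs (y - a) <= r -> cabs (z - a) <= r -> f y = f z -> y = z).

Let r20 : 0 < r / 2. Proof. by rewrite divr_gt0. Qed.
Let r2 : r / 2 < r. Proof. by rewrite ltr_pdivrMr// ltr_pMr// ltr1n. Qed.

(** Compactness gives a minimum and injectivity makes it positive. This gap takes the place of a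
    winding number in the two results that use it. *)
Lemma annulus_gap : exists2 mu : R, 0 < mu &
  forall z, r / 2 <= cabs (z - a) -> cabs (z - a) <= r -> mu <= cabs (f z - f a).
Proof.
pose N := [set z | r / 2 <= cabs (z - a) /\ cabs (z - a) <= r].
have N0 : N !=set0.
  by exists (a + r%:C); rewrite /N /= addrC addKr cabs_real gtr0_norm// lexx ltW.
have cN : compact N.
  apply: (@subclosed_compact _ _ _ _ (@compact_cball _ a r)); last by move=> z [].
  rewrite (_ : N = (fun z => cabs (z - a)) @^-1` [set t | r / 2 <= t] `&`
    (fun z => cabs (z - a)) @^-1` [set t | t <= r])//.
  by apply: closedI; apply: closed_comp; do ?[exact: closed_ge|exact: closed_le|
    move=> z _; exact: continuous_cabsB].
have cf : {within N, continuous (fun z => cabs (f z - f a))}.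
  apply: continuous_in_subspaceT => z; rewrite inE => -[_ /df[k /cderiv_cont cz]].
  apply/contR_cabsP => e e0; have /cont_cabsP/(_ _ e0)[d d0 hd] := cz.
  exists d => // y /hd; apply: le_lt_trans; apply: (le_trans (cabs_lip _ _)).
  by rewrite opprB addrA subrK.
have [c] := compact_EVT_min N0 cN cf; rewrite inE => -[c1 c2] hc.
exists (cabs (f c - f a)); last by move=> z z1 z2; apply: hc; rewrite inE.
rewrite cabs_gt0 subr_eq0; apply: contraTneq c1 => /fi -> //.
  by rewrite subrr cabs0 -ltNge.
by rewrite subrr cabs0 ltW.
Qed.

(** If [w] were omitted, [1 / (f - w)] would be holomorphic on the disk and at most [2 / mu] on its
    outer half, hence also at [a], contradicting [|w - f a| < mu / 2]. *)
Lemma open_mapping : exists2 mu : R, 0 < mu & forall w, cabs (w - f a) < mu ->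
  exists2 z, cabs (z - a) < r & f z = w.
Proof.
have [mu mu0 hmu] := annulus_gap.
exists (mu / 2); first by rewrite divr_gt0.
move=> w hw; apply: contrapT => nz.
pose h z := (f z - w)^-1.
have nw z : cabs (z - a) < r -> f z - w != 0.
  by move=> hz; rewrite subr_eq0; apply/eqP => fz; apply: nz; exists z.
have dh z : cabs (z - a) < r -> exists k, cderiv h z k.
  move=> hz; have [k hk] := df (ltW hz).
  by apply: cderiv_inv_subr hk _; rewrite -subr_eq0 nw.
pose O := [set z | cabs (z - a) < r]; pose K := [set z | cabs (z - a) <= r / 2].
have aO : O a by rewrite /O /= subrr cabs0.
have KO : K `<=` O by move=> z /= /le_lt_trans; exact.
have cO z : O z -> {for z, continuous h} by move=> /dh[k /cderiv_cont].
have dO z : O z -> z <> a -> exists k, cderiv h z k by move=> /dh.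
have bO z : O z -> ~ K z -> cabs (h z) <= (mu / 2)^-1.
  move=> z1 /negP; rewrite -ltNge => z2.
  have := hmu z (ltW z2) (ltW z1) => hz.
  rewrite /h cabsV lef_pV2 ?posrE ?cabs_gt0 ?nw ?divr_gt0//.
  have := ler_cabs_distD w (f z) (f a); lra.
have := maximum_modulus (@open_cball a r) (@compact_cball _ a (r / 2)) KO cO dO bO aO.
rewrite /h cabsV lef_pV2 ?posrE ?cabs_gt0 ?nw ?divr_gt0//.
by rewrite cabsC leNgt hw.
Qed.
End Injective.
End Univalent.

(** * Derivatives of injective maps and bijections onto the disk *)

Section DiskBijections.
Variable R : realType.
Implicit Types (f h : R[i] -> R[i]) (a z w : R[i]).

Lemma is_derive_of_eps (u : R -> R) (x d : R) :
  (forall e, 0 < e -> exists2 r : R, 0 < r & forall y, `|y - x| < r ->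
     `|u y - u x - d * (y - x)| <= e * `|y - x|) -> is_derive x 1 u d.
Proof.
move=> H.
suff L : h^-1 *: ((u \o shift x) (h *: 1) - u x) @[h --> (0 : R)^'] --> d.
  by split; [apply/cvg_ex; exists d|exact: cvg_lim L].
apply/cvgrPdist_le => e e0; have [r r0 hr] := H e e0.
apply/nbhs_ballP; exists r => // h; rewrite /= => hb h0.
have {}hb : `|0 - h| < r by exact: hb.
rewrite sub0r normrN in hb.
have := hr (h + x); rewrite addrK => /(_ hb) k.
rewrite /GRing.scale /= mulr1 distrC.
rewrite -(ler_pM2r (_ : 0 < `|h|)) ?normr_gt0// -normrM.
by congr (`|_| <= _) : k; field.
Qed.

(** The real mean value theorem along a horizontal segment, for real and imaginary parts separately.
    Equal values at two distinct points are already at odds with injectivity. *)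
Lemma cderiv0_const f a (r t : R) : 0 < t -> t < r ->
  (forall z, cabs (z - a) < r -> cderiv f z 0) -> f (a + t%:C) = f a.
Proof.
move=> t0 tr df.
have ptE (s x : R) : a + s%:C - (a + x%:C) = (s - x)%:C.
  by rewrite opprD addrACA subrr add0r -rmorphB.
have loc x : 0 <= x -> x <= t -> forall e, 0 < e -> exists2 d : R, 0 < d &
    forall y, `|y - x| < d -> cabs (f (a + y%:C) - f (a + x%:C)) <= e * `|y - x|.
  move=> x0 xt e e0; have [|d d0 hd] := @cderiv_epsP _ f (a + x%:C) 0 _ e e0.
    by apply: df; rewrite addrC addKr cabs_real ger0_norm//; exact: le_lt_trans tr.
  exists d => // y hy; have := hd (a + y%:C); rewrite ptE cabs_real mul0r subr0.
  exact.
have comp (P : R[i] -> R) : (forall z w, `|P z - P w| <= cabs (z - w)) ->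
    P (f (a + t%:C)) = P (f a).
  move=> lip; pose u (s : R) := P (f (a + s%:C)).
  have du x : 0 <= x -> x <= t -> is_derive x 1 u 0.
    move=> x0 xt; apply: is_derive_of_eps => e e0.
    have [d d0 hd] := loc x x0 xt e e0; exists d => // y /hd.
    by rewrite mul0r subr0; apply: le_trans; exact: lip.
  have cu : {within `[0, t], continuous u}.
    apply: continuous_in_subspaceT => x; rewrite inE /= in_itv /= => /andP[x0 xt].
    have [dx _] := du x x0 xt.
    by apply: differentiable_continuous; apply/derivable1_diffP.
  have [|c _] := @MVT _ u (fun=> 0) 0 t t0 _ cu.
    by move=> x; rewrite in_itv /= => /andP[x0 xt]; exact: du (ltW x0) (ltW xt).
  by rewrite mul0r /u rmorph0 addr0 => /eqP; rewrite subr_eq0 => /eqP.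
have eR : complex.Re (f (a + t%:C)) = complex.Re (f a).
  by apply: comp => z w; rewrite -ReB ler_Re_cabs.
have eI : complex.Im (f (a + t%:C)) = complex.Im (f a).
  by apply: comp => z w; rewrite -ImB ler_Im_cabs.
by move: eR eI; case: (f (a + _)) => ? ?; case: (f a) => ? ? /= -> ->.
Qed.

(* The quotient [(f z - f u) / (z - u)] is bounded below near [a], uniformly in
   the points [u] close to [a] where the derivative does not vanish. *)
Lemma injective_deriv_neq0 f a (r : R) l : 0 < r ->
  (forall z, cabs (z - a) <= r -> exists k, cderiv f z k) ->
  (forall y z, cabs (y - a) <= r -> cabs (z - a) <= r -> f y = f z -> y = z) ->
  cderiv f a l -> l != 0.
Proof.
move=> r0 df fi fa; apply/eqP => l0; rewrite l0 in fa => {l0}.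
have [mu mu0 hmu] := annulus_gap r0 df fi.
have mu20 : 0 < mu / 2 by rewrite divr_gt0.
have /cont_cabsP/(_ _ mu20)[d1 d10 h1] := cderiv_cont fa.
pose C := 2 * r / (mu / 2); have C0 : 0 < C by rewrite !divr_gt0 ?mulr_gt0.
(* Since [f] is injective and its derivative [k] at [u] is nonzero, the quotient [q] based at [u]
   has no zero, so [1 / q] obeys the maximum principle. On the outer half of the disk,
   [|z - u| <= 2 r] and [|f z - f u| >= mu / 2], which gives [C]. *)
have key u k : cabs (u - a) < d1 -> cabs (u - a) < r -> u != a ->
    cderiv f u k -> k != 0 -> cabs (a - u) <= C * cabs (f a - f u).
  move=> u1 ur ua [q cq [qu E]] k0.
  pose O := [set z | cabs (z - a) < r]; pose K := [set z | cabs (z - a) <= r / 2].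
  have r2 : r / 2 < r by rewrite ltr_pdivrMr// ltr_pMr// ltr1n.
  have aO : O a by rewrite /O /= subrr cabs0.
  have KO : K `<=` O by move=> z /= /le_lt_trans; exact.
  have q0 z : O z -> q z != 0.
    move=> Oz; have [->|zu] := eqVneq z u; first by rewrite qu.
    apply/eqP => qz; move/eqP: zu; apply; apply: fi; [exact: ltW|exact: ltW|].
    by rewrite (E z) qz mul0r addr0.
  have dq z : O z -> z <> u -> exists k, cderiv q z k.
    by move=> /ltW/df[k' hk'] /eqP zu; exact: cderiv_quotient_ext E hk' zu.
  have cqO z : O z -> {for z, continuous q}.
    move=> Oz; have [->|/eqP zu] := eqVneq z u; first exact: cq.
    by have [k' /cderiv_cont] := dq z Oz zu.
  have cO z : O z -> {for z, continuous (fun y => (q y)^-1)}.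
    by move=> Oz; exact: contV (q0 z Oz) (cqO z Oz).
  have dO z : O z -> z <> u -> exists k, cderiv (fun y => (q y)^-1) z k.
    move=> Oz zu; have [k' hk'] := dq z Oz zu.
    by eexists; exact: cderivV (q0 z Oz) hk'.
  have Eq z : O z -> cabs (q z)^-1 * cabs (f z - f u) = cabs (z - u).
    move=> Oz; rewrite -cabsM (E z) [f u + _]addrC addrK mulrA mulVf ?mul1r//.
    exact: q0.
  have bO z : O z -> ~ K z -> cabs (q z)^-1 <= C.
    move=> Oz /negP; rewrite -ltNge => z2.
    have g1 := hmu z (ltW z2) (ltW Oz).
    have g2 : mu / 2 <= cabs (f z - f u).
      have := ler_cabs_distD (f u) (f z) (f a); have := h1 _ u1; lra.
    have g3 : cabs (z - u) <= 2 * r.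
      by have := ler_cabs_distD a z u; rewrite (cabsC a u) /O /= in Oz *; lra.
    have := Eq z Oz; have := cabs_ge0 (q z)^-1 => n1 n2.
    rewrite /C ler_pdivlMr//; apply: le_trans g3; rewrite -n2.
    exact: ler_wpM2l.
  have := maximum_modulus (@open_cball _ a r) (@compact_cball _ a (r / 2)) KO cO dO bO aO.
  by move=> h; rewrite -(Eq a aO) ler_wpM2r// cabs_ge0.
(* The vanishing derivative at [a] gives [|f u - f a| <= |u - a| / (2 C)] for [u] close to [a],
   against [key]. So the derivative is zero on a whole disk, and [f] takes one value twice. *)
have e0 : 0 < (2 * C)^-1 by rewrite invr_gt0 mulr_gt0.
have [d2 d20 h2] := cderiv_epsP fa e0.
pose eta := Num.min r (Num.min d1 d2).
have eta0 : 0 < eta by rewrite !lt_min r0 d10.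
have all0 u : cabs (u - a) < eta -> cderiv f u 0.
  rewrite !lt_min => /and3P[ur u1 u2].
  have [->//|ua] := eqVneq u a; have [k hk] := df u (ltW ur).
  have [<-//|k0] := eqVneq k 0; exfalso.
  have := key u k u1 ur ua hk k0; have := h2 u u2; rewrite mul0r subr0 cabsC => e1 e2.
  have {e1}e3 := le_trans e2 (ler_wpM2l (ltW C0) e1).
  have : cabs (a - u) <= cabs (a - u) / 2.
    apply: (le_trans e3); rewrite cabsC (_ : C * _ = cabs (a - u) / 2)//.
    by rewrite cabsC; field; rewrite gt_eqF.
  by rewrite leNgt ltr_pdivrMr// ltr_pMr ?ltr1n// cabs_gt0 subr_eq0 eq_sym.
have t0 : 0 < eta / 2 by rewrite divr_gt0.
have te : eta / 2 < eta by rewrite ltr_pdivrMr// ltr_pMr// ltr1n.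
have tr : eta / 2 <= r by rewrite (le_trans (ltW te))// ge_min lexx.
have dt : cabs (a + (eta / 2)%:C - a) = eta / 2.
  by rewrite addrC addKr cabs_real gtr0_norm.
have /fi := cderiv0_const t0 te all0.
rewrite dt subrr cabs0 => /(_ tr (ltW r0)) E.
by move: t0; rewrite -dt E subrr cabs0 ltxx.
Qed.

(** [K] is the image of the closed disk of radius [rho] under the inverse map, which is continuous
    by the open mapping property. *)
Lemma bij_disk_proper (O : set R[i]) f (rho : R) : open O ->
  (forall z, O z -> exists k, cderiv f z k) -> set_bij O [set w | cabs w < 1] f ->
  rho < 1 -> exists K, [/\ compact K, K `<=` O &
    forall z, O z -> ~ K z -> rho < cabs (f z)].
Proof.
move=> oO df [fD fi fs] rho1.
have /choice[g hg] : forall w, exists z, cabs w < 1 -> O z /\ f z = w.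
  move=> w; have [w1|w1] := pselect (cabs w < 1); last by exists 0.
  by have [z Oz <-] := fs w w1; exists z.
pose D := [set w : R[i] | cabs w <= rho].
have D1 w : D w -> cabs w < 1 by move=> /le_lt_trans; exact.
exists (g @` D); split.
- apply: continuous_compact; last first.
    have := @compact_cball R 0 rho; congr compact.
    by apply/funext => w /=; rewrite subr0.
  apply: continuous_in_subspaceT => w; rewrite inE => /D1 w1.
  apply/cont_cabsP => e e0.
  have [Ogw fgw] := hg w w1.
  have [r0 r00 hr0] := (open_cabsP O).1 oO _ Ogw.
  pose r := Num.min r0 e / 2.
  have r_gt0 : 0 < r by rewrite divr_gt0// lt_min r00.
  have rlt : r < Num.min r0 e by rewrite ltr_pdivrMr// ltr_pMr ?ltr1n// lt_min r00.
  have [rr re] : r < r0 /\ r < e by apply/andP; rewrite -lt_min.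
  have inO z : cabs (z - g w) <= r -> O z by move=> /le_lt_trans/(_ rr)/hr0.
  have [||mu mu0 hmu] := @open_mapping R f (g w) r r_gt0.
  - by move=> z /inO/df.
  - by move=> y z /inO Oy /inO Oz; apply: fi; rewrite inE.
  pose d := Num.min mu (1 - cabs w).
  exists d; first by rewrite lt_min mu0 subr_gt0.
  move=> y; rewrite lt_min => /andP[y1 y2].
  have [|z z1 fz] := hmu y; first by rewrite fgw.
  have yl : cabs y < 1.
    by have := ler_cabsB y w; move: y2; lra.
  have [Ogy fgy] := hg y yl.
  have -> : g y = z by apply: fi; rewrite ?inE//; [exact: inO (ltW z1)|rewrite fz].
  exact: lt_trans re.
- by move=> _ [w /D1 w1 <-]; have [] := hg w w1.
- move=> z Oz nK; rewrite ltNge; apply/negP => hz; apply: nK; exists (f z) => //.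
  have [Og fg] := hg _ (D1 _ hz).
  by apply: fi; rewrite ?inE.
Qed.
End DiskBijections.

(** * Semiconjugacies of a proper map *)

Section Functional.
Variable R : realType.

Lemma bernoulli_sub (s : R) m : 0 <= s -> s <= 1 -> 1 - m%:R * s <= (1 - s) ^+ m.
Proof.
move=> s0 s1; elim: m => [|m IH]; first by rewrite mul0r subr0 expr0.
have s2 : 0 <= 1 - s by rewrite subr_ge0.
rewrite exprS; apply: le_trans (ler_wpM2l s2 IH); rewrite -natr1.
have : 0 <= m%:R * (s * s) by rewrite !mulr_ge0.
lra.
Qed.

(** The limit [rho -> 1] made quantitative by Bernoulli's inequality: with [rho = 1 - s], the defect
    [m s x] is at most [e]. *)
Lemma le1_of_powers (x : R) m :
  (forall rho, 0 < rho -> rho < 1 -> x * rho ^+ m <= 1) -> x <= 1.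
Proof.
move=> H; apply/ler_addgt0Pr => e e0; have [x0|x0] := leP x 0.
  by rewrite (le_trans x0)// addr_ge0 ?ltW.
have M0 : 0 < m%:R + 1 :> R by rewrite ltr_wpDl.
pose s := Num.min (1 / 2) (e / (x * (m%:R + 1))).
have s0 : 0 < s by rewrite lt_min !divr_gt0// mulr_gt0.
have s1 : s <= 1 / 2 by rewrite ge_min lexx.
have s2 : s * (x * (m%:R + 1)) <= e.
  by rewrite -ler_pdivlMr ?mulr_gt0// ge_min lexx orbT.
have s3 : s <= 1 by lra.
have h : x * (1 - s) ^+ m <= 1 by apply: H; lra.
have := ler_wpM2l (ltW x0) (bernoulli_sub m (ltW s0) s3).
have := mulr_gt0 s0 x0; lra.
Qed.

(** The quotient of [Phi o fh] by [Phi^m] has a removable singularity at 0 and no zero. Close to the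
    boundary of [O] both [Phi] and [Phi o fh] have modulus above [rho], by properness, so the
    quotient and its reciprocal are nearly bounded by 1 there. The maximum principle carries this
    inside, and [rho] tends to 1. *)
Theorem semiconjugacy_modulus (O : set R[i]) (Phi fh nu : R[i] -> R[i]) (m : nat) :
  (0 < m)%N -> open O -> O 0 ->
  (forall z, O z -> exists k, cderiv Phi z k) ->
  (forall y z, O y -> O z -> Phi y = Phi z -> y = z) ->
  (forall z, O z -> cabs (Phi z) < 1) -> Phi 0 = 0 ->
  (forall rho, rho < 1 -> exists K, [/\ compact K, K `<=` O &
    forall z, O z -> ~ K z -> rho < cabs (Phi z)]) ->
  (forall z, O z -> exists k, cderiv fh z k) ->
  (forall z, O z -> O (fh z)) ->
  (forall z, O z -> fh z = z ^+ m * nu z) ->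
  (forall z, O z -> z != 0 -> fh z != 0) ->
  {for 0, continuous nu} -> nu 0 = 1 ->
  (forall K, compact K -> K `<=` O -> exists K', [/\ compact K', K' `<=` O &
    forall z, O z -> ~ K' z -> ~ K (fh z)]) ->
  forall z, O z -> cabs (Phi (fh z)) = cabs (Phi z) ^+ m.
Proof.
move=> m0 oO O0 dP iP P1 P0 pP df fO fE f0 cnu nu0 pf.
have f00 : fh 0 = 0 by rewrite fE// expr0n gtn_eqF// mul0r.
have [l dPl] := dP 0 O0; have [q cq [ql E]] := dPl.
have Pq z : Phi z = q z * z by rewrite (E z) P0 add0r subr0.
have l0 : l != 0.
  have [r r0 hr] := (open_cabsP O).1 oO 0 O0.
  have inO z : cabs (z - 0) <= r / 2 -> O z.
    by move=> hz; apply: hr; rewrite (le_lt_trans hz)// ltr_pdivrMr// ltr_pMr// ltr1n.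
  apply: (@injective_deriv_neq0 R Phi 0 (r / 2) l) => //.
  - by rewrite divr_gt0.
  - by move=> z /inO/dP.
  - by move=> y z /inO Oy /inO Oz; exact: iP.
have Pn0 z : O z -> z != 0 -> Phi z != 0.
  by move=> Oz; apply: contra => /eqP Pz; apply/eqP/iP => //; rewrite Pz.
have q0 z : O z -> q z != 0.
  move=> Oz; have [->|z0] := eqVneq z 0; first by rewrite ql.
  by have := Pn0 z Oz z0; rewrite Pq mulf_eq0 negb_or => /andP[].
(* The zeros of order [m] of numerator and denominator are divided out beforehand, which gives [Q] a
   nonzero value at 0. At that point [Q] is only known to be continuous, and the maximum principle
   tolerates one such point. *)
pose Q z := q (fh z) * nu z * (q z ^+ m)^-1.
have QE z : O z -> z != 0 -> Q z = Phi (fh z) * (Phi z ^+ m)^-1.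
  move=> Oz z0; rewrite /Q !Pq exprMn fE//; field.
  by rewrite ?expf_neq0 ?q0 ?z0.
have dQ z : O z -> z <> 0 -> exists k, cderiv Q z k.
  move=> Oz /eqP z0; have [k1 h1] := df z Oz; have [k2 h2] := dP _ (fO _ Oz).
  have [k3 h3] := dP z Oz.
  have Pm : Phi z ^+ m != 0 by rewrite expf_neq0// Pn0.
  have h := cderivM (cderiv_comp h1 h2)
    (@cderivV _ (fun y => Phi y ^+ m) z _ Pm (cderivX m h3)).
  eexists; apply: cderiv_near h.
  have [r r0 hr] := (open_cabsP O).1 oO z Oz.
  have nO : \forall y \near z, O y by apply/nbhs_cabsP; exists r.
  near=> y; rewrite QE//; first by near: y.
  by near: y; exact: near_neq.
have cQ0 : {for 0, continuous Q}.
  have [k1 h1] := df 0 O0.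
  have c1 : {for 0, continuous (fun y => q (fh y))}.
    by apply: (cont_comp (cderiv_cont h1)); rewrite f00.
  have qm0 : q 0 ^+ m != 0 by rewrite expf_neq0// q0.
  exact: contM (contM c1 cnu) (@contV _ (fun y => q y ^+ m) 0 qm0 (contX m cq)).
have cQ z : O z -> {for z, continuous Q}.
  move=> Oz; have [->|/eqP z0] := eqVneq z 0; first exact: cQ0.
  by have [k /cderiv_cont] := dQ z Oz z0.
have Q0 z : O z -> Q z != 0.
  move=> Oz; rewrite /Q mulf_neq0 ?invr_neq0 ?expf_neq0 ?q0// mulf_neq0 ?q0//.
    exact: fO.
  have [->|z0] := eqVneq z 0; first by rewrite nu0 oner_neq0.
  by have := f0 z Oz z0; rewrite fE// mulf_eq0 negb_or => /andP[].
have cQV z : O z -> {for z, continuous (fun y => (Q y)^-1)}.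
  by move=> Oz; exact: contV (Q0 z Oz) (cQ z Oz).
have dQV z : O z -> z <> 0 -> exists k, cderiv (fun y => (Q y)^-1) z k.
  move=> Oz z0; have [k hk] := dQ z Oz z0.
  by eexists; exact: cderivV (Q0 z Oz) hk.
(* The exponents differ because [|Phi|^m] may be as small as [rho^m] when it is the denominator, but
   is at most 1 when it is the numerator. Writing [rho ^+ 1] lets [le1_of_powers] treat both
   cases. *)
have bnd rho z : 0 < rho -> rho < 1 -> O z ->
    cabs (Q z) * rho ^+ m <= 1 /\ cabs (Q z)^-1 * rho ^+ 1 <= 1.
  move=> r0 r1 Oz; have [K [cK KO hK]] := pP rho r1; have [K' [cK' K'O hK']] := pf K cK KO.
  have cU : compact (K `|` K' `|` [set 0]).
    apply: compactU; first exact: compactU.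
    exact: compact_set1.
  have UO : K `|` K' `|` [set 0] `<=` O by move=> y [[/KO|/K'O]|->].
  have rm : 0 < rho ^+ m by rewrite exprn_gt0.
  have ev y : O y -> ~ (K `|` K' `|` [set 0]) y ->
      cabs (Q y) <= (rho ^+ m)^-1 /\ cabs (Q y)^-1 <= rho^-1.
    move=> Oy /not_orP[/not_orP[nK nK'] /eqP y0].
    have a1 := hK y Oy nK; have a2 := hK _ (fO _ Oy) (hK' y Oy nK').
    have b1 := P1 y Oy; have b2 := P1 _ (fO _ Oy).
    have c0 : 0 < cabs (Phi y) by exact: lt_trans a1.
    have c1 : 0 < cabs (Phi (fh y)) by exact: lt_trans a2.
    rewrite QE// cabsM cabsV cabsX; split.
      rewrite -[leRHS]mul1r; apply: ler_pM; rewrite ?cabs_ge0 ?invr_ge0 ?exprn_ge0 ?cabs_ge0 ?(ltW b2)//.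
      by rewrite lef_pV2 ?posrE ?exprn_gt0// lerXn2r ?nnegrE ?ltW.
    rewrite cabsV cabsM cabsV cabsX invfM invrK -[leRHS]mulr1; apply: ler_pM;
      rewrite ?invr_ge0 ?exprn_ge0 ?cabs_ge0//.
      by rewrite lef_pV2 ?posrE// ltW.
    by rewrite exprn_ile1 ?cabs_ge0// ltW.
  split.
    rewrite -ler_pdivlMr// div1r.
    exact: (maximum_modulus oO cU UO cQ dQ (fun y Oy nU => (ev y Oy nU).1)).
  rewrite expr1 -ler_pdivlMr// div1r.
  exact: (maximum_modulus oO cU UO cQV dQV (fun y Oy nU => (ev y Oy nU).2)).
move=> z Oz; have [->|z0] := eqVneq z 0.
  by rewrite f00 P0 cabs0 expr0n gtn_eqF.
have Qz1 : cabs (Q z) = 1.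
  have Qp : 0 < cabs (Q z) by rewrite cabs_gt0 Q0.
  apply/eqP; rewrite eq_le; apply/andP; split.
    by apply: le1_of_powers => rho r0 r1; have [h _] := bnd rho z r0 r1 Oz; exact: h.
  have h : cabs (Q z)^-1 <= 1.
    by apply: le1_of_powers => rho r0 r1; have [_ h] := bnd rho z r0 r1 Oz; exact: h.
  by move: h; rewrite cabsV invf_le1.
move: Qz1; rewrite QE// cabsM cabsV cabsX => /(canRL (mulfVK _)) -> //.
  by rewrite mul1r.
by rewrite expf_neq0// cabs_eq0 Pn0.
Unshelve. all: by end_near. Qed.
End Functional.

(** * Integration over the plane *)

Section LebesgueAffine.
Variable R : realType.
Local Notation mu := (@lebesgue_measure R).
Local Open Scope ereal_scope.

Let aff (a b : R) : R -> measurableTypeR R := fun x => (a * x + b)%R.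

Lemma measurable_affine (a b : R) : measurable_fun setT (fun x : R => (a * x + b)%R).
Proof. by apply: measurable_funD => //; exact: measurable_funM. Qed.

Let preimage_affine (a b c d : R) : (0 < a)%R ->
  (fun x => a * x + b)%R @^-1` `]c, d]%classic = `]((c - b) / a)%R, ((d - b) / a)%R]%classic.
Proof.
move=> a0; apply/seteqP; split => x /=; rewrite !in_itv /= => /andP[].
  by rewrite ltr_pdivrMr// ler_pdivlMr// ltrBlDr lerBrDr mulrC => -> ->.
by rewrite ltr_pdivrMr// ler_pdivlMr// ltrBlDr lerBrDr mulrC => -> ->.
Qed.

(** By uniqueness of Lebesgue measure: [a] times its image under the affine map gives half-open
    intervals their length. *)
Lemma integral_affine_pos (a b : R) (f : R -> \bar R) : (0 < a)%R ->
  measurable_fun setT f -> (forall x, 0 <= f x) ->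
  \int[mu]_x f (a * x + b)%R = (a^-1)%:E * \int[mu]_x f x.
Proof.
move=> a0 mf f0.
have maff : measurable_fun setT (aff a b) by exact: measurable_affine.
pose m := mscale (NngNum (ltW a0)) (pushforward mu (aff a b)).
have mE (A : set (measurableTypeR R)) : measurable A -> mu A = m maff A.
  move=> mA; apply: lebesgue_measure_unique => //= _ [[c d]] _ <-.
  rewrite /m /mscale /= /pushforward /aff preimage_affine// !lebesgue_measure_itv/= !lte_fin.
  rewrite ltr_pM2r ?invr_gt0// ltrD2r; case: ifP => _; last by rewrite mule0.
  by rewrite -!EFinD -EFinM -mulrBl opprB addrA subrK mulrC divfK// gt_eqF.
have -> : \int[mu]_x f x = \int[m maff]_x f x.
  by apply: eq_measure_integral => A mA _; exact: mE.
rewrite ge0_integral_mscale// /= muleA -EFinM mulVf ?gt_eqF// mul1e.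
by rewrite ge0_integral_pushforward.
Qed.

Lemma integral_opp (f : R -> \bar R) :
  measurable_fun setT f -> (forall x, 0 <= f x) ->
  \int[mu]_x f (- x)%R = \int[mu]_x f x.
Proof.
move=> mf f0.
transitivity (\int[pushforward mu (-%R : _ -> measurableTypeR R)]_x f x).
  by rewrite ge0_integral_pushforward.
by apply: eq_measure_integral => A mA _; exact: lebesgue_measureN.
Qed.

Lemma integral_affine (a b : R) (f : R -> \bar R) : a != 0%R ->
  measurable_fun setT f -> (forall x, 0 <= f x) ->
  \int[mu]_x f (a * x + b)%R = (`|a|^-1)%:E * \int[mu]_x f x.
Proof.
move=> a0 mf f0; have [ap|an] := ltP 0%R a; first by rewrite integral_affine_pos// gtr0_norm.
have a_lt0 : (a < 0)%R by rewrite lt_neqAle a0.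
rewrite -(@integral_affine_pos `|a| b) ?normr_gt0//.
rewrite -[in RHS]integral_opp//.
  by apply: eq_integral => x _; rewrite ltr0_norm// mulrNN.
exact: measurableT_comp mf (measurable_affine _ _).
Qed.
End LebesgueAffine.

(** * Area integrals over the complex plane *)

Section ComplexIntegral.
Variable R : realType.
Local Notation mu := (@lebesgue_measure R).
Local Open Scope ereal_scope.
Implicit Types (g h : R[i] -> \bar R) (c : R[i]).

Definition cint g := \int[@area R]_xy g (xy.1 +i* xy.2)%C.
Definition mC g := measurable_fun setT (fun xy : R * R => g (xy.1 +i* xy.2)%C).
Definition mR (u : R[i] -> R) := measurable_fun setT (fun xy : R * R => u (xy.1 +i* xy.2)%C).
Lemma cint_xy g : mC g -> (forall z, 0 <= g z) ->
  cint g = \int[mu]_y \int[mu]_x g (x +i* y)%C.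
Proof.
move=> mg g0; rewrite /cint /area.
exact: (@fubini_tonelli2 _ _ _ _ _ mu mu _ mg (fun xy => g0 _)).
Qed.

Lemma cint_yx g : mC g -> (forall z, 0 <= g z) ->
  cint g = \int[mu]_x \int[mu]_y g (x +i* y)%C.
Proof.
move=> mg g0; rewrite /cint /area.
exact: (@fubini_tonelli1 _ _ _ _ _ mu mu _ mg (fun xy => g0 _)).
Qed.

Lemma mR_Re : mR (@complex.Re R).
Proof. exact: measurable_fst. Qed.
Lemma mR_Im : mR (@complex.Im R).
Proof. exact: measurable_snd. Qed.
Lemma mR_cst (a : R) : mR (fun=> a).
Proof. exact: measurable_cst. Qed.
Lemma mRD u v : mR u -> mR v -> mR (fun z => u z + v z)%R.
Proof. exact: measurable_funD. Qed.
Lemma mRM u v : mR u -> mR v -> mR (fun z => u z * v z)%R.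
Proof. exact: measurable_funM. Qed.
Lemma mRX u n : mR u -> mR (fun z => u z ^+ n)%R.
Proof. exact: measurable_funX. Qed.

Section MeasurableComplex.
Context d (T : measurableType d).
Implicit Types f : T -> R[i].

Definition measurable_cfun f := measurable_fun setT (fun t => complex.Re (f t)) /\
  measurable_fun setT (fun t => complex.Im (f t)).

Lemma mC_comp g f : mC g -> measurable_cfun f -> measurable_fun setT (fun t => g (f t)).
Proof.
move=> mg [m1 m2]; have := measurableT_comp mg (measurable_fun_pair m1 m2).
by congr measurable_fun; apply/funext => t /=; case: (f t).
Qed.
Lemma mR_comp u f : mR u -> measurable_cfun f -> measurable_fun setT (fun t => u (f t)).
Proof.
move=> mu' [m1 m2]; have := measurableT_comp mu' (measurable_fun_pair m1 m2).
by congr measurable_fun; apply/funext => t /=; case: (f t).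
Qed.
Lemma measurable_cfun_cst c : measurable_cfun (fun=> c).
Proof. by split; exact: measurable_cst. Qed.
Lemma measurable_cfunD f1 f2 : measurable_cfun f1 -> measurable_cfun f2 ->
  measurable_cfun (fun t => f1 t + f2 t)%R.
Proof.
move=> [r1 i1] [r2 i2]; split.
  by have := measurable_funD r1 r2; congr measurable_fun; apply/funext => t /=; rewrite -ReD.
by have := measurable_funD i1 i2; congr measurable_fun; apply/funext => t /=; rewrite -ImD.
Qed.
Lemma measurable_cfunM f1 f2 : measurable_cfun f1 -> measurable_cfun f2 ->
  measurable_cfun (fun t => f1 t * f2 t)%R.
Proof.
move=> [r1 i1] [r2 i2]; split.
  have := measurable_funB (measurable_funM r1 r2) (measurable_funM i1 i2).
  by congr measurable_fun; apply/funext => t /=; rewrite -ReM.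
have := measurable_funD (measurable_funM r1 i2) (measurable_funM i1 r2).
by congr measurable_fun; apply/funext => t /=; rewrite -ImM.
Qed.
Lemma measurable_cfunX f n : measurable_cfun f -> measurable_cfun (fun t => f t ^+ n)%R.
Proof.
move=> mf; elim: n => [|n IH]; first exact: measurable_cfun_cst.
by have := measurable_cfunM mf IH; congr measurable_cfun; apply/funext => t; rewrite -exprS.
Qed.
End MeasurableComplex.

Lemma measurable_cfun_toC : measurable_cfun (fun xy : R * R => (xy.1 +i* xy.2)%C).
Proof. by split; [exact: mR_Re|exact: mR_Im]. Qed.
Lemma mC_EFin u : mR u -> mC (fun z => (u z)%:E).
Proof. by move=> mu'; apply/measurable_EFinP. Qed.
Lemma mCM g h : mC g -> mC h -> mC (fun z => g z * h z).
Proof. exact: emeasurable_funM. Qed.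
Lemma mR_cabs : mR (@cabs R).
Proof.
apply: measurableT_comp.
  by apply: continuous_measurable_fun; exact: sqrt_continuous.
by apply: measurable_funD; apply: measurable_funX; [exact: measurable_fst|exact: measurable_snd].
Qed.
Lemma mC_slice1 g (y : R) : mC g -> measurable_fun setT (fun x : R => g (x +i* y)%C).
Proof. by move=> mg; exact: (@measurable_fun_pair1 _ _ _ _ _ _ _ y mg). Qed.
Lemma mC_slice2 g (x : R) : mC g -> measurable_fun setT (fun y : R => g (x +i* y)%C).
Proof. by move=> mg; exact: (@measurable_fun_pair2 _ _ _ _ _ _ _ x mg). Qed.

Lemma measurable_int_x g : mC g -> (forall z, 0 <= g z) ->
  measurable_fun setT (fun y : R => \int[mu]_x g (x +i* y)%C).
Proof.
move=> mg g0.
exact: (@measurable_fun_fubini_tonelli_G _ _ _ _ _ mu _ mg (fun xy => g0 _)).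
Qed.
Lemma measurable_int_y g : mC g -> (forall z, 0 <= g z) ->
  measurable_fun setT (fun x : R => \int[mu]_y g (x +i* y)%C).
Proof.
move=> mg g0.
exact: (@measurable_fun_fubini_tonelli_F _ _ _ _ _ mu _ mg (fun xy => g0 _)).
Qed.

(** Multiplication by [c = a + i b] is a composition of two one-variable affine changes:
    [X = a x - b y] at fixed [y], then [(b / a) X + (|c|^2 / a) y] at fixed [X]. The factors [a] and
    [|c|^2 / a] multiply to [|c|^2], and the division requires [a != 0]. *)
Lemma cint_mulc_Re g c : complex.Re c != 0%R -> mC g -> (forall z, 0 <= g z) ->
  cint (fun z => g (c * z)%R) = (cabs c ^- 2)%R%:E * cint g.
Proof.
case: c => a b /= a0 mg g0.
have mcg : mC (fun z => g ((a +i* b)%C * z)%R).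
  exact: (mC_comp mg (measurable_cfunM (measurable_cfun_cst _ _) measurable_cfun_toC)).
pose c2 := (a ^+ 2 + b ^+ 2)%R.
have c20 : (0 < c2)%R by rewrite ltr_wpDr ?sqr_ge0// lt_def sqrf_eq0 a0 sqr_ge0.
rewrite cint_xy//.
pose sh (z : R[i]) : R[i] :=
  Complex (complex.Re z) (b / a * complex.Re z + c2 / a * complex.Im z)%R.
pose G z := g (sh z).
have mG : mC G.
  apply: (@mC_comp _ _ g (fun xy : R * R => sh (xy.1 +i* xy.2)%C)) => //.
  split => /=; first exact: mR_Re.
  exact: (mRD (mRM (mR_cst (b / a)%R) mR_Re) (mRM (mR_cst (c2 / a)%R) mR_Im)).
have G0 z : 0 <= G z by exact: g0.
transitivity (\int[mu]_y ((`|a|^-1)%R%:E * \int[mu]_x G (x +i* y)%C)).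
  apply: eq_integral => y _.
  rewrite -(@integral_affine R a (- b * y)%R (fun x => G (x +i* y)%C))//.
  - apply: eq_integral => x _; congr g; apply/eqP; rewrite eq_complex /=.
    by apply/andP; split; apply/eqP; [ring|rewrite /c2; field].
  - exact: mC_slice1.
rewrite ge0_integralZl//; last 2 first.
  - exact: measurable_int_x.
  - by move=> y _; exact: integral_ge0.
rewrite -(cint_xy mG)// (cint_yx mG)//.
have -> : \int[mu]_x \int[mu]_y G (x +i* y)%C = (`|c2 / a|^-1)%R%:E * cint g.
  rewrite (cint_yx mg)// -ge0_integralZl//; last 2 first.
  - exact: measurable_int_y.
  - by move=> y _; exact: integral_ge0.
  apply: eq_integral => x _.
  rewrite -(@integral_affine R (c2 / a)%R (b / a * x)%R (fun y => g (x +i* y)%C))//.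
  - by apply: eq_integral => y _; rewrite /G /= addrC.
  - by rewrite mulf_neq0 ?invr_eq0// gt_eqF.
  - exact: mC_slice2.
rewrite muleA -EFinM; congr (_%:E * _).
rewrite -/c2 sqr_sqrtr ?(ltW c20)// normrM normfV (gtr0_norm c20).
by field; rewrite gt_eqF// normr_eq0.
Qed.

Lemma cint_mulc g c : c != 0%R -> mC g -> (forall z, 0 <= g z) ->
  cint (fun z => g (c * z)%R) = (cabs c ^- 2)%R%:E * cint g.
Proof.
move=> c0 mg g0; have [Rc|] := eqVneq (complex.Re c) 0%R; last by move=> ?; exact: cint_mulc_Re.
(* A purely imaginary [c] is written as [(c / e) e] with [e = 1 + i], both factors having nonzero
   real part. *)
pose e : R[i] := Complex 1%R 1%R; pose d := (c / e)%R.
have e0 : e != 0%R by rewrite eq_complex /= oner_eq0.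
have Ie : complex.Im c != 0%R.
  by apply: contraNneq c0 => Ic; rewrite eq_complex Rc Ic /= eqxx.
have Rd : complex.Re d != 0%R.
  rewrite /d ReM Rc mul0r sub0r oppr_eq0 mulf_neq0// /e /=.
  by rewrite expr1n oppr_eq0 mulf_neq0 ?oner_eq0// invr_eq0 gt_eqF.
have mge : mC (fun z => g (e * z)%R).
  exact: (mC_comp mg (measurable_cfunM (measurable_cfun_cst _ _) measurable_cfun_toC)).
transitivity (cint (fun z => g (e * (d * z))%R)).
  by congr cint; apply/funext => z; rewrite mulrA /d mulrCA mulfV// mulr1.
rewrite (cint_mulc_Re Rd mge)// (@cint_mulc_Re g e)// ?oner_eq0//.
rewrite muleA -EFinM; congr (_%:E * _).
by rewrite /d cabsM cabsV exprMn exprVn; field; rewrite !cabs_eq0 c0 e0.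
Qed.

Lemma cint_translate g c : mC g -> (forall z, 0 <= g z) ->
  cint (fun z => g (z + c)%R) = cint g.
Proof.
case: c => a b mg g0.
have mcg : mC (fun z => g (z + (a +i* b)%C)%R).
  exact: (mC_comp mg (measurable_cfunD measurable_cfun_toC (measurable_cfun_cst _ _))).
pose sh (z : R[i]) : R[i] := Complex (complex.Re z) (complex.Im z + b)%R.
pose G z := g (sh z).
have mG : mC G.
  apply: (@mC_comp _ _ g (fun xy : R * R => sh (xy.1 +i* xy.2)%C)) => //.
  by split => /=; [exact: mR_Re|exact: (mRD mR_Im (mR_cst b))].
rewrite cint_xy//.
transitivity (cint G).
  rewrite (cint_xy mG (fun z => g0 _)).
  apply: eq_integral => y _.
  rewrite -[RHS]mul1e -[X in X%:E]invr1 -[in RHS](normr1 R).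
  rewrite -(@integral_affine R 1 a (fun x => G (x +i* y)%C))// ?oner_eq0//.
  - by apply: eq_integral => x _; rewrite mul1r.
  - exact: mC_slice1.
  - by move=> x; exact: g0.
rewrite (cint_yx mG (fun z => g0 _)).
rewrite (cint_yx mg g0); apply: eq_integral => x _.
rewrite -[RHS]mul1e -[X in X%:E]invr1 -[in RHS](normr1 R).
rewrite -(@integral_affine R 1 b (fun y => g (x +i* y)%C))// ?oner_eq0//.
- by apply: eq_integral => y _; rewrite mul1r.
- exact: mC_slice2.
Qed.
End ComplexIntegral.

(** * The substitution w = z^m *)

Section PlaneMeasure.
Variable R : realType.
Local Open Scope ereal_scope.
Local Notation mu := (@lebesgue_measure R).

(* The canonical sigma-finite structure of the library on a product [m1 \x m2]
   only covers sub-probabilities, so Fubini on C * C needs this alias. *)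
Definition plane_measure : set (measurableTypeR R * measurableTypeR R) -> \bar R :=
  mu \x mu.

HB.instance Definition _ := Measure.copy plane_measure (mu \x mu).

Lemma plane_measure_rect (a b c d : R) : (a <= b)%R -> (c <= d)%R ->
  plane_measure (`[a, b]%classic `*` `[c, d]%classic) = ((b - a) * (d - c))%:E.
Proof.
move=> ab cd.
have len (u v : R) : (u <= v)%R -> mu `[u, v]%classic = (v - u)%:E.
  move=> uv; rewrite lebesgue_measure_itv /= lte_fin -EFinD; case: ltP => // vu.
  by rewrite (_ : v = u) ?subrr//; apply/le_anti/andP.
rewrite /plane_measure product_measure1E// EFinM.
by congr (_ * _); exact: len.
Qed.

Lemma plane_measure_sigma_finite : sigma_finite setT plane_measure.
Proof.
pose S n : set R := `[(- n%:R)%R, n%:R%R]%classic.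
exists (fun n => S n `*` S n); last first.
  move=> n; split; first by apply: measurableX; exact: measurable_itv.
  have nle : (- n%:R <= n%:R :> R)%R by rewrite ge0_cp// ler0n.
  by rewrite plane_measure_rect// ltry.
apply/seteqP; split=> // -[x y] _.
pose n := maxn (Num.bound `|x|) (Num.bound `|y|).
have bnd (t : R) : (`|t| < n%:R)%R -> S n t.
  by move=> /ltW; rewrite /S /= in_itv /= ler_norml.
exists n => //; split => /=; apply: bnd; apply: (lt_le_trans (archi_boundP (normr_ge0 _)));
  by rewrite ler_nat ?leq_maxl ?leq_maxr.
Qed.

HB.instance Definition _ := @Measure_isSigmaFinite.Build _ _ _ plane_measure
  plane_measure_sigma_finite.

Lemma fubini_tonelli_plane (f : (R * R) * (R * R) -> \bar R) :
  measurable_fun setT f -> (forall p, 0 <= f p) ->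
  \int[@area R]_x \int[@area R]_y f (x, y) = \int[@area R]_y \int[@area R]_x f (x, y).
Proof.
by move=> mf f0; exact: (@fubini_tonelli _ _ _ _ _ plane_measure plane_measure f mf f0).
Qed.
End PlaneMeasure.

Section PowerSubstitution.
Variable R : realType.
Local Notation mu := (@lebesgue_measure R).
Local Notation toC p := (p.1 +i* p.2)%C.
Local Open Scope ereal_scope.
Implicit Types (g h : R[i] -> \bar R) (c : R[i]).

Lemma cint_ge0 g : (forall z, 0 <= g z) -> 0 <= cint g.
Proof. by move=> g0; apply: integral_ge0 => z _; exact: g0. Qed.

Lemma le_cint g h : mC g -> mC h -> (forall z, 0 <= g z) -> (forall z, g z <= h z) ->
  cint g <= cint h.
Proof.
by move=> mg mh g0 gh; apply: ge0_le_integral => // z _; exact: gh.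
Qed.

Lemma cintZl g k : mC g -> (forall z, 0 <= g z) -> 0 <= k ->
  cint (fun z => k * g z) = k * cint g.
Proof. by move=> mg g0 k0; rewrite /cint /area; apply: ge0_integralZl. Qed.

Lemma cintD g h : mC g -> mC h -> (forall z, 0 <= g z) -> (forall z, 0 <= h z) ->
  cint (fun z => g z + h z) = cint g + cint h.
Proof.
by move=> mg mh g0 h0; rewrite /cint /area; apply: ge0_integralD.
Qed.

Lemma cint_swap (H : R[i] -> R[i] -> \bar R) :
  measurable_fun setT (fun p : (R * R) * (R * R) => H (toC p.1) (toC p.2)) ->
  (forall x y, 0 <= H x y) ->
  cint (fun x => cint (H x)) = cint (fun y => cint (H^~ y)).
Proof.
move=> mH H0.
exact: (fubini_tonelli_plane mH (fun p => H0 _ _)).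
Qed.

Lemma measurable_fun_inv d (T : measurableType d) (u : T -> R) : (forall t, 0 <= u t)%R ->
  measurable_fun setT u -> measurable_fun setT (fun t => (u t)^-1)%R.
Proof.
move=> u0 mu'; have := measurableT_comp (measurable_powR (-1)) mu'.
by congr measurable_fun; apply/funext => t /=; rewrite powR_inv1.
Qed.

Lemma exists_croot m c : (0 < m)%N -> exists d : R[i], (d ^+ m)%R = c.
Proof.
move=> m0.
have [x xE] := @solve_monicpoly (R[i] : closedFieldType) m (fun i => if i == 0%N then c else 0%R) m0.
exists x; rewrite xE; case: m m0 {xE} => // n _.
rewrite big_ord_recl /= expr0 mulr1 big1 ?addr0// => i _.
by rewrite mul0r.
Qed.

(** Density, with respect to area, of the Haar measure of the multiplicative group. At the origin
    the default inverse gives 0, so identities between integrands extend to that point. *)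
Definition haar_weight (z : R[i]) : \bar R := (cabs z ^- 2)%R%:E.
Local Notation wt := haar_weight.

Lemma wt_ge0 z : 0 <= wt z.
Proof. by rewrite lee_fin invr_ge0 exprn_ge0// cabs_ge0. Qed.

Lemma wt0 : wt (0%R : R[i]) = 0.
Proof. by rewrite /haar_weight cabs0 expr0n invr0. Qed.

Lemma mC_wt : mC wt.
Proof.
apply: mC_EFin; apply: measurable_fun_inv => [p|].
  by rewrite exprn_ge0// cabs_ge0.
by apply: measurable_funX; exact: mR_cabs.
Qed.

Section Functionals.
Variable m : nat.
Hypothesis m0 : (0 < m)%N.

Definition haar_int g := cint (fun z => g z * wt z).
Definition haar_expn_int g := cint (fun z => g (z ^+ m)%R * wt z).

Lemma mC_mulc g c : mC g -> mC (fun z => g (c * z)%R).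
Proof.
move=> mg.
exact: (mC_comp mg (measurable_cfunM (measurable_cfun_cst _ c) (measurable_cfun_toC R))).
Qed.

Lemma mC_expn g n : mC g -> mC (fun z => g (z ^+ n)%R).
Proof. by move=> mg; exact: (mC_comp mg (measurable_cfunX n (measurable_cfun_toC R))). Qed.

Lemma haar_int_mulc g c : c != 0%R -> mC g -> (forall z, 0 <= g z) ->
  haar_int (fun z => g (c * z)%R) = haar_int g.
Proof.
move=> c0 mg g0; have cc0 : cabs c != 0%R by rewrite cabs_eq0.
rewrite /haar_int.
have mG : mC (fun z => g z * wt z) by apply: mCM mg mC_wt.
have G0 z : 0 <= g z * wt z by rewrite mule_ge0// wt_ge0.
have k0 : 0 <= (cabs c ^+ 2)%R%:E by rewrite lee_fin exprn_ge0// cabs_ge0.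
have := cint_mulc c0 mG G0; rewrite -cintZl//; last by rewrite lee_fin invr_ge0 exprn_ge0// cabs_ge0.
move=> E; rewrite -[RHS]mul1e -(_ : (cabs c ^+ 2)%R%:E * (cabs c ^- 2)%R%:E = 1); last first.
  by rewrite -EFinM mulfV// expf_neq0.
rewrite -muleA -[X in _ = _ * X]cintZl// ?lee_fin ?invr_ge0 ?exprn_ge0 ?cabs_ge0//.
rewrite -E -cintZl//; last exact: mC_mulc mG.
congr cint; apply/funext => z; rewrite muleCA; congr (_ * _).
by rewrite /haar_weight -EFinM cabsM exprMn [in RHS]invfM mulVKf// expf_neq0.
Qed.

(** With an [m]-th root [d] of [c], multiplying [z^m] by [c] amounts to multiplying [z] by [d]. *)
Lemma haar_expn_int_mulc g c : c != 0%R -> mC g -> (forall z, 0 <= g z) ->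
  haar_expn_int (fun z => g (c * z)%R) = haar_expn_int g.
Proof.
move=> c0 mg g0.
have [d dE] := exists_croot c m0.
have d0 : d != 0%R by apply: contraNneq c0 => d0; rewrite -dE d0 expr0n gtn_eqF.
rewrite /haar_expn_int -[RHS](@haar_int_mulc (fun z => g (z ^+ m)%R) d)//; last exact: mC_expn.
by congr cint; apply/funext => z; rewrite exprMn dE.
Qed.

(* Uniqueness of the Haar measure of C^*: both functionals are invariant under
   [z |-> c z], so Fubini applied to [g (x y^m) kappa |y^m|] compares them. *)
Lemma haar_int_proportional (kappa : R -> \bar R) g :
  measurable_fun setT kappa -> (forall t, 0 <= kappa t) ->
  mC g -> (forall z, 0 <= g z) ->
  haar_int g * haar_expn_int (fun z => kappa (cabs z)) = haar_expn_int g * haar_int (fun z => kappa (cabs z)^-1%R).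
Proof.
move=> mk k0 mg g0.
have mkc : mC (fun z => kappa (cabs z)).
  exact: (measurableT_comp mk (@mR_cabs R)).
have mtoC1 : measurable_cfun (fun p : (R * R) * (R * R) => toC p.1).
  by split; [exact: (measurableT_comp measurable_fst measurable_fst)
            |exact: (measurableT_comp measurable_snd measurable_fst)].
have mtoC2 : measurable_cfun (fun p : (R * R) * (R * R) => toC p.2).
  by split; [exact: (measurableT_comp measurable_fst measurable_snd)
            |exact: (measurableT_comp measurable_snd measurable_snd)].
have mw1 := mC_comp mC_wt mtoC1; have mw2 := mC_comp mC_wt mtoC2.
have mk1 := mC_comp mkc (measurable_cfunX m mtoC1).
have ms : measurable_fun setT (fun p : (R * R) * (R * R) => g (toC p.2 * toC p.1 ^+ m)%R).
  exact: (mC_comp mg (measurable_cfunM mtoC2 (measurable_cfunX m mtoC1))).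
have mkw : mC (fun y => kappa (cabs (y ^+ m)%R) * wt y).
  by apply: mCM mC_wt; exact: (@mC_expn (fun z => kappa (cabs z))).
have ell0 : 0 <= haar_int g by apply: cint_ge0 => z; rewrite mule_ge0 ?wt_ge0.
transitivity (cint (fun y => cint (fun x =>
    g (x * y ^+ m)%R * kappa (cabs (y ^+ m)%R) * wt x * wt y))).
  rewrite /haar_expn_int -cintZl//; last by move=> y; rewrite mule_ge0 ?wt_ge0.
  congr cint; apply/funext => y; have [->|y0] := eqVneq y 0%R.
    rewrite wt0 !mule0 /cint integral0_eq// => p _; rewrite mule0//.
  rewrite -(@haar_int_mulc g (y ^+ m)%R)//; last by rewrite expf_neq0.
  rewrite muleC /haar_int -cintZl//.
  - congr cint; apply/funext => x; rewrite [(_ * x)%R]mulrC muleACA.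
    by rewrite [kappa _ * _]muleC [wt y * _]muleC muleA.
  - by apply: mCM mC_wt; exact: mC_mulc.
  - by move=> x; rewrite mule_ge0 ?wt_ge0.
  - by rewrite mule_ge0 ?wt_ge0.
rewrite cint_swap//; last 2 first.
- exact: (emeasurable_funM (emeasurable_funM (emeasurable_funM ms mk1) mw2) mw1).
- by move=> y x; rewrite !mule_ge0 ?wt_ge0.
(* With [w = x y^m] one has [|y^m| = |w| / |x|]. For fixed [x] the integrand is thus a function of
   [x y^m], and invariance of the inner functional replaces it by the same function of [y^m]. *)
pose gk (x : R[i]) w := g w * kappa (cabs w / cabs x)%R.
have mgk x : mC (gk x).
  apply: mCM mg _; apply: measurableT_comp mk _.
  by apply: measurable_funM; [exact: mR_cabs|exact: measurable_cst].
transitivity (cint (fun x => cint (fun y =>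
    g (y ^+ m)%R * kappa (cabs (y ^+ m)%R / cabs x)%R * wt y * wt x))).
  congr cint; apply/funext => x; have [->|x0] := eqVneq x 0%R.
    by rewrite wt0; congr cint; apply/funext => y; rewrite !mule0 mul0e.
  transitivity (wt x * haar_expn_int (fun w => gk x (x * w)%R)).
    rewrite /haar_expn_int -cintZl; last 3 first.
    - by apply: mCM mC_wt; apply: (@mC_expn (fun w => gk x (x * w)%R)); exact: mC_mulc.
    - by move=> y; rewrite /gk !mule_ge0 ?wt_ge0.
    - exact: wt_ge0.
    congr cint; apply/funext => y.
    rewrite /gk cabsM [(cabs x * _)%R]mulrC mulfK ?cabs_eq0//.
    by rewrite [_ * wt x]muleC -!muleA.
  rewrite haar_expn_int_mulc//; last by move=> w; rewrite /gk mule_ge0.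
  rewrite /haar_expn_int -cintZl; last 3 first.
  - by apply: mCM mC_wt; apply: (@mC_expn (gk x)).
  - by move=> y; rewrite /gk !mule_ge0 ?wt_ge0.
  - exact: wt_ge0.
  by congr cint; apply/funext => y; rewrite muleC.
have mkq : measurable_fun setT (fun p : (R * R) * (R * R) =>
    kappa (cabs (toC p.2 ^+ m)%R / cabs (toC p.1))%R).
  apply: measurableT_comp mk _; apply: measurable_funM.
    exact: (mR_comp (@mR_cabs R) (measurable_cfunX m mtoC2)).
  apply: measurable_fun_inv => [p|]; first exact: cabs_ge0.
  exact: (mR_comp (@mR_cabs R) mtoC1).
rewrite cint_swap//; last 2 first.
- have mg2 := mC_comp mg (measurable_cfunX m mtoC2).
  exact: (emeasurable_funM (emeasurable_funM (emeasurable_funM mg2 mkq) mw2) mw1).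
- by move=> y x; rewrite !mule_ge0 ?wt_ge0.
pose kk (z : R[i]) := kappa (cabs z)^-1%R.
have mkk : mC kk.
  by apply: measurableT_comp mk _; apply: measurable_fun_inv => [p|];
    [exact: cabs_ge0|exact: mR_cabs].
have kk0 z : 0 <= kk z by exact: k0.
rewrite muleC /haar_expn_int -cintZl//; last 3 first.
- by apply: mCM mC_wt; exact: mC_expn.
- by move=> z; rewrite mule_ge0 ?wt_ge0.
- by apply: cint_ge0 => z; rewrite mule_ge0 ?wt_ge0.
congr cint; apply/funext => y; have [->|y0] := eqVneq y 0%R.
  by rewrite wt0 !mule0 /cint integral0_eq// => p _; rewrite mule0 mul0e.
(* For fixed [y], [kappa (|y^m| / |x|)] is [kk] at [y^-m x]; invariance in [x] separates the two
   variables. *)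
rewrite -(@haar_int_mulc kk (y ^+ m)^-1%R)//; last by rewrite invr_eq0 expf_neq0.
rewrite muleC /haar_int -cintZl//.
- congr cint; apply/funext => x.
  by rewrite /kk cabsM cabsV invfM invrK !muleA [_ * _ * wt y]muleAC.
- by apply: mCM mC_wt; exact: mC_mulc.
- by move=> x; rewrite mule_ge0 ?wt_ge0.
- by rewrite mule_ge0 ?wt_ge0.
Qed.
End Functionals.
End PowerSubstitution.

(** * The constant relating the Haar integral to its pullback by a power *)

Section HaarConstant.
Variable R : realType.
Local Notation mu := (@lebesgue_measure R).
Local Notation toC p := (p.1 +i* p.2)%C.
Local Open Scope ereal_scope.
Implicit Types (g : R[i] -> \bar R) (a b c d : R).

Definition itv_indic a b (t : R) : \bar R := ((a <= t < b)%R%:R)%:E.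

Lemma measurable_itv_indic a b : measurable_fun setT (itv_indic a b).
Proof.
have m1 : measurable_fun setT (\1_(`[a, b[%classic : set R) : R -> R).
  by apply: measurable_indic; exact: measurable_itv.
have := measurableT_comp (@EFin_measurable R setT) m1.
by congr measurable_fun; apply/funext => t /=; rewrite indicE mem_setE in_itv.
Qed.

Lemma itv_indic_ge0 a b t : 0 <= itv_indic a b t.
Proof. by rewrite lee_fin ler0n. Qed.

Lemma mC_itv_indic a b : mC (fun z => itv_indic a b (cabs z)).
Proof. exact: measurableT_comp (measurable_itv_indic a b) (@mR_cabs R). Qed.

Definition box a b c d : set (R * R) := `[a, b]%classic `*` `[c, d]%classic.

Lemma measurable_box a b c d : measurable (box a b c d).
Proof. by apply: measurableX; exact: measurable_itv. Qed.

Lemma boxP a b c d (p : R * R) : box a b c d p <->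
  ((a <= p.1 <= b) /\ (c <= p.2 <= d))%R.
Proof. by rewrite /box /=; split; rewrite !in_itv. Qed.

Lemma integral_box a b c d : (a <= b)%R -> (c <= d)%R ->
  \int[@area R]_p (\1_(box a b c d) p)%:E = ((b - a) * (d - c))%:E.
Proof.
move=> ab cd; rewrite /area integral_indic//; last exact: measurable_box.
by rewrite setIT; exact: plane_measure_rect.
Qed.

Definition annulus_mass a b := haar_int (fun z => itv_indic a b (cabs z)).

Lemma annulus_mass_lty : annulus_mass 1 2 < +oo.
Proof.
apply: (@le_lt_trans _ _ (\int[@area R]_p (\1_(box (-2) 2 (-2) 2) p)%:E)).
  apply: ge0_le_integral => //.
  - by move=> p _; rewrite mule_ge0 ?itv_indic_ge0 ?wt_ge0.
  - exact: (mCM (mC_itv_indic 1 2) (@mC_wt R)).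
  - by apply/measurable_EFinP; apply: measurable_indic; exact: measurable_box.
  move=> p _; rewrite /itv_indic.
  have [/andP[z1 z2]|_] := boolP (1 <= cabs (toC p) < 2)%R; last first.
    by rewrite mul0e lee_fin indicE ler0n.
  rewrite mul1e indicE mem_set ?lee_fin.
    by rewrite invf_le1 ?exprn_ege1// exprn_gt0// (lt_le_trans ltr01).
  apply/boxP; rewrite -!ler_norml; split; apply: (le_trans _ (ltW z2)).
    exact: (ler_Re_cabs (toC p)).
  exact: (ler_Im_cabs (toC p)).
by rewrite integral_box ?ltry//; lra.
Qed.

Lemma annulus_mass_gt0 : 0 < annulus_mass 1 2.
Proof.
(* On the box, [1 <= |z|^2 <= 13/4 < 4]: it lies in the annulus, where the weight is at least
   [1/4]. *)
apply: (@lt_le_trans _ _ (\int[@area R]_p ((4^-1)%R%:E * (\1_(box 1 (3/2) 0 1) p)%:E))).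
  rewrite ge0_integralZl//.
  - by rewrite integral_box; [rewrite -EFinM lte_fin; lra|lra|lra].
  - by apply/measurable_EFinP; apply: measurable_indic; exact: measurable_box.
apply: ge0_le_integral => //.
- apply: emeasurable_funM; first exact: measurable_cst.
  by apply/measurable_EFinP; apply: measurable_indic; exact: measurable_box.
- exact: (mCM (mC_itv_indic 1 2) (@mC_wt R)).
move=> p _; rewrite indicE; have [/set_mem/boxP[]|_] := boolP (_ \in _); last first.
  by rewrite mule0 mule_ge0 ?itv_indic_ge0 ?wt_ge0.
move=> /andP[x1 x2] /andP[y1 y2]; rewrite mule1.
have z2 := sqr_cabs (toC p); rewrite /= in z2.
have z0 := cabs_ge0 (toC p).
have [z1 z4] : (1 <= cabs (toC p) ^+ 2 /\ cabs (toC p) ^+ 2 < 4)%R.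
  by rewrite z2; split; nra.
have [z1' z2'] : (1 <= cabs (toC p) /\ cabs (toC p) < 2)%R.
  by move: z0 z1 z4; clear=> *; split; nra.
rewrite /itv_indic z1' z2' mul1e lee_fin lef_pV2 ?posrE ?(ltW z4)//.
by rewrite exprn_gt0// (lt_le_trans ltr01).
Qed.

Lemma annulus_mass_dyadic (j : nat) : annulus_mass (2 ^+ j) (2 ^+ j.+1) = annulus_mass 1 2.
Proof.
have dj : ((2 ^+ j)%:C%C != 0 :> R[i])%R.
  by rewrite eq_complex /= eqxx andbT expf_neq0//; lra.
have j1 : (1 <= 2 ^+ j :> R)%R by rewrite exprn_ege1//; lra.
rewrite /annulus_mass -[LHS](@haar_int_mulc _ _ ((2 ^+ j)%:C)%C)//.
- congr haar_int; apply/funext => z; rewrite /itv_indic cabsM cabs_real ger0_norm ?exprn_ge0//.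
  by rewrite exprSr -[X in (X <= _)%R]mulr1 ler_pM2l ?ltr_pM2l ?(lt_le_trans ltr01).
- exact: mC_itv_indic.
- by move=> z; exact: itv_indic_ge0.
Qed.

Lemma annulus_mass_pow (j : nat) : annulus_mass 1 (2 ^+ j) = j%:R%:E * annulus_mass 1 2.
Proof.
elim: j => [|j IH].
  rewrite mul0e /annulus_mass /haar_int /cint integral0_eq// => p _.
  rewrite /itv_indic expr0 (_ : (1 <= _ < 1)%R = false) ?mul0e//.
  by case: leP => //= z1; rewrite ltNge z1.
have j1 : (1 <= 2 ^+ j :> R)%R by rewrite exprn_ege1//; lra.
have jj : (2 ^+ j <= 2 ^+ j.+1 :> R)%R by rewrite exprS; lra.
rewrite (_ : j.+1%:R%:E = j%:R%:E + 1); last by rewrite -EFinD natr1.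
rewrite ge0_muleDl ?lee_fin ?ler0n// mul1e -{}IH -(annulus_mass_dyadic j) /annulus_mass /haar_int -cintD.
- congr cint; apply/funext => z; rewrite -ge0_muleDl ?itv_indic_ge0//.
  congr (_ * _); rewrite /itv_indic -EFinD -natrD; congr (_%:R%:E).
  have [z1|z1] := leP 1%R (cabs z); have [zj|zj] := ltP (cabs z) (2 ^+ j)%R => //=.
  + by rewrite (lt_le_trans zj jj).
  + by move: (le_lt_trans zj z1); rewrite ltNge j1.
- by apply: mCM (@mC_wt R); exact: mC_itv_indic.
- by apply: mCM (@mC_wt R); exact: mC_itv_indic.
- by move=> z; rewrite mule_ge0 ?itv_indic_ge0 ?wt_ge0.
- by move=> z; rewrite mule_ge0 ?itv_indic_ge0 ?wt_ge0.
Qed.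

(** The constant is read off the annulus [1 <= |z| < 2^m]: it splits into [m] dyadic annuli of equal
    mass, whereas its preimage under [z^m] is a single one. *)
Lemma haar_int_expn m g : (0 < m)%N -> mC g -> (forall z, 0 <= g z) ->
  haar_int g = m%:R%:E * haar_expn_int m g.
Proof.
move=> m0 mg g0; set T := annulus_mass 1 2.
have Tfin : T \is a fin_num by rewrite ge0_fin_numE ?ltW ?annulus_mass_gt0 ?annulus_mass_lty.
have T0 : 0 < T := annulus_mass_gt0.
pose k := itv_indic 1 (2 ^+ m).
have nnk : haar_expn_int m (fun z => k (cabs z)) = T.
  congr cint; apply/funext => z; congr (_ * _).
  rewrite /k /itv_indic cabsX; congr (_%:R%:E).
  by rewrite ltr_pXn2r ?nnegrE ?cabs_ge0 ?ler0n// expr_ge1 ?cabs_ge0.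
have ellk : haar_int (fun z => k (cabs z)) = m%:R%:E * T by exact: annulus_mass_pow.
have mk : measurable_fun setT k by exact: measurable_itv_indic.
have k0 t : 0 <= k t by exact: itv_indic_ge0.
(* The mass of the inverted annulus comes from the proportionality identity with [g] equal to the
   indicator itself; cancelling [T] requires it to be finite and positive. *)
have ellV : haar_int (fun z : R[i] => k (cabs z)^-1%R) = m%:R%:E * T.
  have := haar_int_proportional m0 mk k0 (mC_itv_indic 1 (2 ^+ m)) (fun z => k0 _).
  rewrite nnk ellk muleC => /(congr1 (fun x => T^-1 * x)).
  by rewrite !muleA mulVe ?gt_eqF// !mul1e.
have := haar_int_proportional m0 mk k0 mg g0.
rewrite nnk ellV muleA => /(congr1 (fun x => x * T^-1)).
by rewrite -!muleA divee ?gt_eqF// !mule1 muleC.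
Qed.

(** The Jacobian [m^2 |z|^(2(m-1))] together with [m] preimages explains [1/m]. The sign is [<=]
    because [|w|^2] times the Haar weight is 1 except at the origin, where it is 0. *)
Lemma power_substitution m g : (1 < m)%N -> mC g -> (forall z, 0 <= g z) ->
  cint (fun z => g (z ^+ m)%R * ((cabs z ^+ m.-1) ^+ 2)%R%:E) <= (m%:R^-1)%R%:E * cint g.
Proof.
move=> m1 mg g0; have m0 : (0 < m)%N by exact: ltnW.
pose h w := g w * (cabs w ^+ 2)%R%:E.
have h0 w : 0 <= h w by rewrite mule_ge0// lee_fin exprn_ge0// cabs_ge0.
have mh : mC h by apply: mCM mg (mC_EFin (mRX 2 (@mR_cabs R))).
have -> : cint (fun z => g (z ^+ m)%R * ((cabs z ^+ m.-1) ^+ 2)%R%:E) = haar_expn_int m h.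
  congr cint; apply/funext => z; rewrite /h -muleA; congr (_ * _).
  rewrite /haar_weight -EFinM cabsX; congr (_%:E).
  have [->|z0] := eqVneq (cabs z) 0%R.
    by rewrite -(subnKC m1) /= !expr0n /= mul0r.
  have -> : (cabs z ^+ m = cabs z * cabs z ^+ m.-1)%R by rewrite -exprS prednK.
  by rewrite exprMn mulrAC mulfV ?mul1r// expf_neq0.
have mE : m%:R != 0%R :> R by rewrite pnatr_eq0 -lt0n.
have E : haar_expn_int m h = (m%:R^-1)%R%:E * haar_int h.
  by rewrite (haar_int_expn m0 mh h0) muleA -EFinM mulVf// mul1e.
rewrite {}E lee_pmul2l//; last by rewrite lte_fin invr_gt0 ltr0n.
apply: le_cint => //.
- exact: mCM mh (@mC_wt R).
- by move=> z; rewrite mule_ge0 ?wt_ge0.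
move=> z; rewrite /h -muleA -[leRHS]mule1 lee_wpmul2l// /haar_weight -EFinM lee_fin.
by have [->|z0] := eqVneq (cabs z) 0%R; [rewrite expr0n mul0r|rewrite mulfV// expf_neq0].
Qed.
End HaarConstant.

(** * Dynamics of unicritical polynomials *)

Section Dynamics.
Variables (R : realType) (m : nat) (a0 : R[i]).
Hypothesis m2 : (2 < m)%N.
Definition unicritical (z : R[i]) := z ^+ m + a0.
Local Notation f := unicritical.
Implicit Types z : R[i].

Lemma cderiv_unicritical z : cderiv f z (m%:R * z ^+ m.-1).
Proof.
rewrite -[_ * _]addr0; apply: (@cderivD _ (fun y => y ^+ m) (fun=> a0)); last exact: cderiv_cst.
by have := cderivX m (cderiv_id z); rewrite mulr1.
Qed.

Lemma cont_iter_unicritical n z : {for z, continuous (iter n f)}.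
Proof.
elim: n => [|n IH]; first exact: cont_id.
exact: (cont_comp IH (cderiv_cont (cderiv_unicritical _))).
Qed.

(** Here [m >= 3] enters through [|z|^m >= |z|^3], from which [|a0| <= |z|] is subtracted. *)
Lemma cabs_unicritical_ge z : 1 <= cabs z -> cabs a0 <= cabs z ->
  cabs z * (cabs z ^+ 2 - 1) <= cabs (f z).
Proof.
move=> z1 za; apply: (@le_trans _ _ (cabs (z ^+ m) - cabs a0)); last first.
  by rewrite -(cabsN a0) (le_trans (ler_cabsB _ _))// opprK.
rewrite cabsX mulrBr mulr1 -exprS; apply: lerB => //.
exact: ler_weXn2l.
Qed.

(** [2 < r^2] makes the growth factor [r^2 - 1] exceed 1. The bound serves twice, for a large escape
    radius and for [r = |a0|]. *)
Lemma iter_unicritical_ge (r : R) z n : 1 < r -> cabs a0 <= r -> 2 < r ^+ 2 -> r <= cabs z ->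
  r * (r ^+ 2 - 1) ^+ n <= cabs (iter n f z).
Proof.
move=> r1 ar r2 rz.
suff : r <= cabs (iter n f z) /\ r * (r ^+ 2 - 1) ^+ n <= cabs (iter n f z) by case.
elim: n => [|n [IH1 IH2]]; first by rewrite expr0 mulr1.
set y := iter n f z in IH1 IH2.
have yge := cabs_unicritical_ge (le_trans (ltW r1) IH1) (le_trans ar IH1).
have s1 : r ^+ 2 - 1 <= cabs y ^+ 2 - 1.
  by rewrite lerD2r lerXn2r// nnegrE ?cabs_ge0// (le_trans _ (ltW r1)).
have s0 : 1 <= r ^+ 2 - 1 by rewrite lerBrDr ltW.
have {}yge : cabs y * (r ^+ 2 - 1) <= cabs (f y).
  by apply: le_trans yge; rewrite ler_wpM2l ?cabs_ge0.
have s00 := le_trans ler01 s0.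
rewrite iterS -/y; split; apply: le_trans yge.
  by rewrite (le_trans IH1)// ler_peMr ?cabs_ge0.
by rewrite exprSr mulrA ler_wpM2r.
Qed.

Lemma exists_fixed_point : exists b, f b = b.
Proof.
have m0 : (0 < m)%N by exact: ltn_trans m2.
have [b bE] := @solve_monicpoly (R[i] : closedFieldType) m
  (fun i => if i == 0%N then - a0 else if i == 1%N then 1 else 0) m0.
exists b; rewrite /f bE -(subnKC (ltnW m2)).
rewrite !big_ord_recl /= big1 ?addr0; last by move=> i _; rewrite mul0r.
by rewrite expr0 expr1 mulr1 mul1r addrAC addNr add0r.
Qed.

Section EscapeRadius.
Variable R0 : R.
Hypotheses (aR : cabs a0 <= R0) (R03 : 3 <= R0).

Lemma unicritical_doubles z n : R0 <= cabs z -> R0 * 2 ^+ n <= cabs (iter n f z).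
Proof.
move=> zR; have R3 := R03; have R2 : 3 * 3 <= R0 ^+ 2 by rewrite expr2 ler_pM.
have := @iter_unicritical_ge R0 z n.
have R1 : 1 < R0 by apply: lt_le_trans R03; lra.
have R22 : 2 < R0 ^+ 2 by lra.
move=> /(_ R1 aR R22 zR); apply: le_trans.
rewrite ler_wpM2l//; first by lra.
by rewrite lerXn2r ?nnegrE//; lra.
Qed.

Lemma unicritical_escape_succ z : R0 <= cabs z -> R0 < cabs (f z).
Proof.
move=> /(@unicritical_doubles _ 1); apply: lt_le_trans; rewrite expr1 ltr_pMr ?ltr1n//; rewrite (lt_le_trans _ R03)// ltr0n.
Qed.

Lemma basin_inftyP z : basin_infty f (Some z) <-> exists n, R0 <= cabs (iter n f z).
Proof.
have R3 := R03; split=> /= [/cvgryPge /(_ R0)[n _ H]|[n nR]]; first by exists n; apply: H => /=.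
apply/cvgryPge => B.
have [k kB] : exists k, B <= R0 * 2 ^+ k.
  exists (Num.bound `|B|); apply: (le_trans (ler_norm _)).
  have B1 : `|B| < 2 ^+ Num.bound `|B|.
    by rewrite (lt_trans (archi_boundP _))// -natrX ltr_nat ltn_expl.
  by rewrite (le_trans (ltW B1))// ler_peMl ?exprn_ge0//; lra.
exists (n + k)%N => // j /= nkj.
have := @unicritical_doubles _ (j - n) nR; rewrite -iterD subnK; last first.
  by rewrite (leq_trans _ nkj)// leq_addr.
apply: le_trans; rewrite (le_trans kB)// ler_wpM2l//; first by lra.
by rewrite ler_weXn2l ?ler1n// leq_subRL// (leq_trans _ nkj)// leq_addr.
Qed.

Lemma basin_of_large z : R0 <= cabs z -> basin_infty f (Some z).
Proof. by move=> zR; apply/basin_inftyP; exists 0%N. Qed.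

Lemma basin_unicritical z : basin_infty f (Some (f z)) <-> basin_infty f (Some z).
Proof.
split=> /basin_inftyP[n nR]; apply/basin_inftyP.
  by exists n.+1; rewrite iterSr.
by exists n; rewrite -iterSr iterS ltW// unicritical_escape_succ.
Qed.

Lemma open_basin : open [set z | basin_infty f (Some z)].
Proof.
apply/open_cabsP => z /= /basin_inftyP[n nR].
have nR1 : R0 < cabs (iter n.+1 f z) by rewrite iterS unicritical_escape_succ.
have /cont_cabsP/(_ (cabs (iter n.+1 f z) - R0)) := @cont_iter_unicritical n.+1 z.
rewrite subr_gt0 => /(_ nR1)[d d0 hd]; exists d => // y /hd h.
apply/basin_inftyP; exists n.+1; have := ler_cabsB (iter n.+1 f z) (iter n.+1 f y).
by rewrite cabsC; move: h; clear=> *; lra.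
Qed.

Lemma fixed_notin_basin b : f b = b -> ~ basin_infty f (Some b).
Proof.
move=> fb /basin_inftyP[n]; have -> : iter n f b = b by elim: n => //= n ->.
move=> bR; have b3 : 3 <= cabs b := le_trans R03 bR.
have := cabs_unicritical_ge (le_trans (ler1n _ 3) b3) (le_trans aR bR).
rewrite fb expr2 => h; have : cabs b * 8 <= cabs b * (cabs b * cabs b - 1).
  by rewrite ler_wpM2l ?cabs_ge0//; nra.
by lra.
Qed.

(** The orbit of 0 passes through [a0], to which the growth estimate applies with [r = |a0|];
    Bernoulli's inequality [s^n >= n (s - 1)] then makes it pass [R0]. *)
Lemma critical_escape : 2 < cabs a0 ^+ 2 -> basin_infty f (Some 0).
Proof.
move=> a2; have R3 := R03; apply/basin_unicritical; rewrite /f expr0n gtn_eqF ?add0r; last exact: ltn_trans m2.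
have a1 : 1 < cabs a0.
  by rewrite -(@ltr_pXn2r _ 2)// ?nnegrE ?cabs_ge0// expr1n; lra.
set s := cabs a0 ^+ 2 - 1; have s1 : 0 < s - 1 by rewrite /s; lra.
have s1' : 1 <= s by rewrite /s; lra.
have [n nR] : exists n, R0 <= s ^+ n.
  have [n nR] : exists n : nat, R0 <= n%:R * (s - 1).
    exists (Num.bound (R0 / (s - 1))); rewrite -ler_pdivrMr// ltW// archi_boundP//.
    by rewrite divr_ge0// ?ltW//; lra.
  exists n; apply: (le_trans nR); elim: n {nR} => [|n IH].
    by rewrite mul0r expr0 ler01.
  have sn : 1 <= s ^+ n by rewrite exprn_ege1 ?s1'.
  have := ler_wpM2r (ltW s1) sn; rewrite mul1r exprSr -natr1 => h.
  by lra.
apply/basin_inftyP; exists n; apply: (le_trans nR).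
apply: le_trans (iter_unicritical_ge n a1 (lexx _) a2 (lexx _)).
by rewrite ler_peMl ?ltW// exprn_gt0//; lra.
Qed.

Lemma first_escape z : basin_infty f (Some z) -> cabs z <= R0 ->
  exists n, cabs (iter n f z) <= R0 /\ R0 <= cabs (f (iter n f z)).
Proof.
move=> /basin_inftyP[n nR] zR.
have ex : exists n, (R0 <= cabs (iter n f z)) by exists n.
case: (ex_minnP ex) => -[|k] kR kmin.
  (* A least time 0 means [|z| = R0]. Such a point also fits index 0, because both inequalities in
     the conclusion are non-strict. *)
  by exists 0%N; split => //; rewrite ltW// unicritical_escape_succ.
exists k; split => //; rewrite leNgt; apply/negP => h.
by have := kmin k (ltW h); rewrite ltnn.
Qed.
End EscapeRadius.
End Dynamics.

(** * The uniformization of the basin *)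

Section Moebius.
Variable R : realType.
Implicit Types (c w v : R[i]).

Definition moebius c w := (w - c) / (1 - conjc c * w).

Lemma cabs_conjc c : cabs (conjc c) = cabs c.
Proof. by case: c => x y; rewrite /cabs /= sqrrN. Qed.

Lemma moebius_den c w : cabs c < 1 -> cabs w < 1 -> 1 - conjc c * w != 0.
Proof.
move=> c1 w1; rewrite subr_eq0; apply/eqP => /(congr1 (@cabs R)).
rewrite cabsM cabs_conjc cabs1 => E.
have := ltr_pM (cabs_ge0 c) (cabs_ge0 w) c1 w1.
by rewrite -E mulr1 ltxx.
Qed.

Lemma moebius_lt1 c w : cabs c < 1 -> cabs w < 1 -> cabs (moebius c w) < 1.
Proof.
move=> c1 w1; have d0 := moebius_den c1 w1.
rewrite /moebius cabsM cabsV ltr_pdivrMr ?cabs_gt0// mul1r.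
rewrite -(@ltr_pXn2r _ 2)// ?nnegrE ?cabs_ge0// -subr_gt0.
suff -> : cabs (1 - conjc c * w) ^+ 2 - cabs (w - c) ^+ 2 =
    (1 - cabs c ^+ 2) * (1 - cabs w ^+ 2).
  by rewrite mulr_gt0// subr_gt0 expr_lt1// cabs_ge0.
by rewrite !sqr_cabs; case: c w {c1 w1 d0} => a b [x y] /=; ring.
Qed.

Lemma moebiusN c w : cabs c < 1 -> cabs w < 1 -> moebius c (moebius (- c) w) = w.
Proof.
move=> c1 w1; have nc1 : cabs (- c) < 1 by rewrite cabsN.
have h1 := moebius_den nc1 w1; have h2 := moebius_den c1 c1.
rewrite /moebius; have cN : conjc (- c) = - conjc c by case: (c).
rewrite cN mulNr !opprK in h1 *; move: (conjc c) h1 h2 => k h1 h2.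
have E : 1 + k * w - k * (w + c) = 1 - k * c by ring.
by field; rewrite h1 E.
Qed.

(** The lower bound, from [|1 - conj c w| <= 2], is what allows bounding the derivative of [F] by
    that of its composition with [moebius]. *)
Lemma cderiv_moebius c w : cabs c < 1 -> cabs w < 1 ->
  exists2 k, cderiv (moebius c) w k & (1 - cabs c ^+ 2) / 4 <= cabs k.
Proof.
move=> c1 w1; have d0 := moebius_den c1 w1.
have h1 : cderiv (fun y => y - c) w 1 by exact: cderiv_subr (cderiv_id w).
have h2 : cderiv (fun y => 1 - conjc c * y) w (- conjc c).
  have h := cderivD (cderiv_cst 1 w) (cderivM (cderiv_cst (- conjc c) w) (cderiv_id w)).
  rewrite mul0r !add0r mulr1 in h; apply: cderiv_near h; apply/nbhs_cabsP; exists 1 => // y _.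
  by rewrite mulNr.
have h := cderivM h1 (@cderivV _ (fun y => 1 - conjc c * y) w _ d0 h2).
eexists; first exact: h.
set d := 1 - conjc c * w in d0 *.
have -> : 1 * d^-1 + (w - c) * (- - conjc c / d ^+ 2) = (1 - cabs c ^+ 2)%:C / d ^+ 2.
  have -> : (1 - cabs c ^+ 2)%:C = d + (w - c) * conjc c.
    apply/eqP; rewrite eq_complex sqr_cabs /d; case: (c) (w) => a b [x y] /=.
    by apply/andP; split; apply/eqP; ring.
  by field.
rewrite cabsM cabsV cabsX cabs_real ger0_norm; last first.
  by rewrite subr_ge0 expr_le1// ?cabs_ge0// ltW.
rewrite ler_wpM2l//; first by rewrite subr_ge0 expr_le1// ?cabs_ge0// ltW.
rewrite lef_pV2 ?posrE ?exprn_gt0 ?cabs_gt0//.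
have : cabs d <= 2.
  rewrite (le_trans (ler_cabsD _ _))// cabs1 cabsN cabsM cabs_conjc.
  by rewrite lerD2l -[leRHS]mulr1 ler_pM ?cabs_ge0// ltW.
by have := cabs_ge0 d; nra.
Qed.
End Moebius.

(** * The coordinate 1 / (z - b) on a neighbourhood of infinity *)

Section ChartAtInfinity.
Variables (R : realType) (Om : set R[i]) (b : R[i]) (R0 : R).
Hypotheses (oOm : open Om) (bOm : ~ Om b) (OmR : forall z, R0 <= cabs z -> Om z).
Implicit Types (w z : R[i]) (g : Chat R -> R[i]).

(* In the application [b] is a fixed point of the polynomial, hence outside [Om],
   so [w = 1 / (z - b)] maps all of [Om], with infinity, into the plane. *)
Definition chart_infty w : Chat R := if w == 0 then None else Some (b + w^-1).
Definition chart_dom : set R[i] := [set w | w = 0 \/ Om (b + w^-1)].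

Lemma chart_dom0 : chart_dom 0. Proof. by left. Qed.

Lemma chart_infty_neq0 w : w != 0 -> chart_infty w = Some (b + w^-1).
Proof. by rewrite /chart_infty => /negbTE ->. Qed.

Lemma chart_domP w : w != 0 -> chart_dom w <-> Om (b + w^-1).
Proof. by move=> w0; split=> [[/eqP|//]|]; [rewrite (negbTE w0)|right]. Qed.

Lemma chart_dom_inv z : Om z -> (z - b)^-1 != 0 /\ b + ((z - b)^-1)^-1 = z.
Proof.
move=> Oz; rewrite invr_eq0 invrK subr_eq0 addrC subrK; split=> //.
by apply/eqP => zb; apply: bOm; rewrite -zb.
Qed.

Lemma chart_dom_ball (r : R) : 0 < r -> (R0 + cabs b) * r <= 1 ->
  forall w, cabs w < r -> chart_dom w.
Proof.
move=> r0 hr w wr; have [->|w0] := eqVneq w 0; first by left.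
right; apply: OmR; have cw : 0 < cabs w by rewrite cabs_gt0.
have := ler_cabsB w^-1 (- b); rewrite opprK cabsN [w^-1 + b]addrC cabsV => h.
apply: le_trans h; rewrite lerBrDr -[leRHS]mul1r ler_pdivlMr//.
have [h|h] := leP 0 (R0 + cabs b).
  by apply: le_trans hr; rewrite ler_wpM2l// ltW.
by rewrite (le_trans _ ler01)// mulr_le0_ge0// ltW.
Qed.

Lemma exists_chart_radius : exists2 r : R, 0 < r & (R0 + cabs b) * r <= 1.
Proof.
exists (`|R0 + cabs b| + 1)^-1; first by rewrite invr_gt0 ltr_wpDl.
rewrite ler_pdivrMr ?mul1r ?ltr_wpDl//.
by rewrite (le_trans (ler_norm _))// lerDl.
Qed.

Lemma cont_add_inv w : w != 0 -> {for w, continuous (fun y : R[i] => b + y^-1)}.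
Proof.
move=> w0.
exact: (contD (cont_cst b w) (@contV _ (fun y : R[i] => y) w w0 (cont_id w))).
Qed.

Lemma open_chart_dom : open chart_dom.
Proof.
apply/open_cabsP => w Dw; have [->|w0] := eqVneq w 0.
  have [r r0 hr] := exists_chart_radius; exists r => // y; rewrite subr0.
  exact: chart_dom_ball.
have /open_cabsP/(_ _ ((chart_domP w0).1 Dw))[e e0 he] := oOm.
have /cont_cabsP/(_ e e0)[d d0 hd] := cont_add_inv w0.
by exists d => // y /hd/he; right.
Qed.

Lemma set_bij_chart g D :
  set_bij (fun x => if x is Some z then Om z else True) D g ->
  set_bij chart_dom D (g \o chart_infty).
Proof.
move=> [h1 h2 h3].
have dom w : chart_dom w -> (if chart_infty w is Some z then Om z else True).
  by rewrite /chart_infty; case: eqP => // /eqP w0 /(chart_domP w0).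
split.
- by move=> w /dom; exact: h1.
- move=> y w /set_mem/dom Dy /set_mem/dom Dw /(h2 _ _ (mem_set Dy) (mem_set Dw)).
  rewrite /chart_infty; case: eqP => [->|_]; case: eqP => [->|_]// [].
  by move/addrI/invr_inj.
- move=> v /h3[x Ox xv]; case: x Ox xv => [z|] Ox xv.
    have [z0 zE] := chart_dom_inv Ox; exists (z - b)^-1.
      by apply/chart_domP => //; rewrite zE.
    by rewrite /= chart_infty_neq0// zE.
  by exists 0; [left|rewrite /= /chart_infty eqxx].
Qed.

Lemma cderiv_chart g :
  (forall z, Om z -> derivable (g \o Some) z 1) ->
  derivable (fun w : R[i] => if w == 0 then g None else g (Some w^-1)) 0 1 ->
  forall w, chart_dom w -> exists k, cderiv (g \o chart_infty) w k.
Proof.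
move=> dg dg0 w Dw; have [w0|w0] := eqVneq w 0; last first.
  have h1 : cderiv (fun y => b + y^-1) w (0 + - 1 / w ^+ 2).
    exact: (cderivD (cderiv_cst b w) (@cderivV _ id w _ w0 (cderiv_id w))).
  have h2 := derivable_cderiv (dg _ ((chart_domP w0).1 Dw)).
  eexists; apply: cderiv_near (cderiv_comp h1 h2).
  apply/nbhs_cabsP; exists (cabs w); first by rewrite cabs_gt0.
  move=> y; rewrite cabsC => yw; rewrite /= chart_infty_neq0//.
  by apply: contraTneq yw => ->; rewrite subr0 ltxx.
rewrite {}w0 in Dw *.
pose h (w : R[i]) := if w == 0 then g None else g (Some w^-1).
(* Holomorphy at infinity is given in the coordinate [1 / z]. Since [b + 1 / w = (1 + b w) / w], the
   transition to the chart is [w / (1 + b w)], of derivative 1 at 0. *)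
have d1 : cderiv (fun y => y * (1 + b * y)^-1) 0 1.
  have e1 : cderiv (fun y => 1 + b * y) 0 (0 + (0 * 0 + b * 1)).
    exact: (cderivD (cderiv_cst 1 0) (cderivM (cderiv_cst b 0) (cderiv_id 0))).
  have e0 : 1 + b * 0 != 0 :> R[i] by rewrite mulr0 addr0 oner_eq0.
  have := cderivM (cderiv_id 0) (@cderivV _ (fun y => 1 + b * y) 0 _ e0 e1).
  by rewrite mul0r addr0 mulr0 addr0 invr1 mulr1.
have dh : cderiv h (0 * (1 + b * 0)^-1) ('D_1 h 0).
  by rewrite mul0r; exact: derivable_cderiv.
eexists; apply: cderiv_near (cderiv_comp d1 dh).
have b1 : 0 < cabs b + 1 by rewrite ltr_wpDl ?cabs_ge0.
apply/nbhs_cabsP; exists (cabs b + 1)^-1; first by rewrite invr_gt0.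
move=> y; rewrite subr0 -[X in _ < X]mul1r ltr_pdivlMr// => yb.
have by1 : 1 + b * y != 0.
  apply/eqP => /eqP; rewrite addrC addr_eq0 => /eqP E; have : cabs (b * y) = 1.
    by rewrite E cabsN cabs1.
  by rewrite cabsM => E2; have := cabs_ge0 y; move: yb E2; clear=> *; lra.
rewrite /h /= /chart_infty mulf_eq0 invr_eq0 (negbTE by1) orbF.
case: eqP => // /eqP y0; congr (g (Some _)); field.
by rewrite y0.
Qed.
End ChartAtInfinity.

Section LocallyBounded.
Variable R : realType.

Lemma compact_locally_bounded (K : set R[i]) (u : R[i] -> R) : compact K ->
  (forall x, K x -> exists M, exists2 e : R, 0 < e & forall y, cabs (y - x) < e -> u y <= M) ->
  exists2 M : R, 0 < M & forall y, K y -> u y <= M.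
Proof.
move=> /compact_near_coveringP cK H.
have [|M [_ HM]] := cK R (pinfty_nbhs R) (fun M y => u y <= M) _.
  move=> x /H[M [e e0 he]].
  exists ([set y | cabs (y - x) < e], [set N | M < N]) => /=.
    by split; [apply/nbhs_cabsP; exists e|exists M; rewrite num_real].
  by move=> [y N] /= [/he h /ltW MN]; exact: le_trans MN.
exists (`|M| + 1); first by rewrite ltr_wpDl.
by move=> y Ky; apply: HM => //; rewrite (le_lt_trans (ler_norm M))// ltrDl.
Qed.

Lemma compact_cabs_le (K : set R[i]) : compact K ->
  exists2 M : R, 0 < M & forall y, K y -> cabs y <= M.
Proof.
move=> cK; apply: compact_locally_bounded => // x _; exists (cabs x + 1); exists 1 => // y yx.
by rewrite -(subrK x y) (le_trans (ler_cabsD _ _))// addrC lerD2l ltW.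
Qed.
End LocallyBounded.

Section ConjugateMap.
Variables (R : realType) (m : nat) (a0 b : R[i]) (Om : set R[i]) (R0 : R).
Local Notation f := (unicritical m a0).
Hypotheses (m0 : (0 < m)%N) (oOm : open Om) (bOm : ~ Om b)
  (OmR : forall z, R0 <= cabs z -> Om z) (fOm : forall z, Om (f z) <-> Om z) (fb : f b = b).
Implicit Types (w z : R[i]).
Local Notation Dom := (chart_dom Om b).

(* [chart_map] is the polynomial read in the chart [w = 1 / (z - b)]. *)
Definition chart_den w := (1 + b * w) ^+ m - (b * w) ^+ m.
Local Notation q := chart_den.
Definition chart_map w := w ^+ m * (q w)^-1.
Local Notation fh := chart_map.

Lemma chart_den0 : q 0 = 1.
Proof. by rewrite /q mulr0 addr0 expr1n expr0n gtn_eqF// subr0. Qed.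

Lemma cderiv_chart_den w : exists k, cderiv q w k.
Proof.
have d1 : cderiv (fun y => b * y) w (0 * w + b * 1).
  exact: (cderivM (cderiv_cst b w) (cderiv_id w)).
have d2 := cderivD (cderiv_cst 1 w) d1.
have d3 := cderivM (cderiv_cst (-1) w) (cderivX m d1).
eexists; apply: cderiv_near (cderivD (cderivX m d2) d3).
by apply/nbhs_cabsP; exists 1 => // y _; rewrite /q mulN1r.
Qed.

Lemma cont_chart_den w : {for w, continuous q}.
Proof. by have [k /cderiv_cont] := cderiv_chart_den w. Qed.

Lemma chart_map_inv w : w != 0 -> (fh w)^-1 = f (b + w^-1) - b.
Proof.
move=> w0; have {2}<- := fb; rewrite /f /fh invfM invrK mulrC opprD addrACA subrr addr0.
have -> : b + w^-1 = (1 + b * w) / w by field.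
have {2}-> : b = (b * w) / w by field.
by rewrite !expr_div_n -mulrBl.
Qed.

Lemma chart_map_neq0 w : Dom w -> w != 0 -> fh w != 0.
Proof.
move=> Dw w0; rewrite -invr_eq0 chart_map_inv// subr_eq0; apply/eqP => E.
by apply: bOm; rewrite -E; apply/fOm; exact/(chart_domP Om b w0).
Qed.

Lemma chart_den_neq0 w : Dom w -> q w != 0.
Proof.
move=> Dw; have [->|w0] := eqVneq w 0; first by rewrite chart_den0 oner_eq0.
by have := chart_map_neq0 Dw w0; rewrite mulf_eq0 negb_or invr_eq0 => /andP[].
Qed.

Lemma chart_map_dom w : q w != 0 -> Dom (fh w) <-> Dom w.
Proof.
move=> qw; have [->|w0] := eqVneq w 0.
  by rewrite /fh expr0n gtn_eqF// mul0r.
have fw0 : fh w != 0 by rewrite mulf_neq0 ?expf_neq0// invr_eq0.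
split=> [/(chart_domP Om b fw0)|/(chart_domP Om b w0) h].
  by rewrite chart_map_inv// addrC subrK => /fOm h; apply/(chart_domP Om b w0).
by apply/(chart_domP Om b fw0); rewrite chart_map_inv// addrC subrK; apply/fOm.
Qed.

Lemma cderiv_chart_map w : q w != 0 -> exists k, cderiv fh w k.
Proof.
move=> qw; have [k dk] := cderiv_chart_den w.
by eexists; exact: (cderivM (cderivX m (cderiv_id w)) (cderivV qw dk)).
Qed.

(** [K'] is the preimage of [K] in [Dom], and it has to be shown closed and bounded in the whole
    plane: [chart_map] has no limit problem in [Dom], but its poles and the point [w = oo] must be
    kept away. *)
Lemma chart_map_proper K : compact K -> K `<=` Dom -> exists K', [/\ compact K', K' `<=` Dom &
  forall z, Dom z -> ~ K' z -> ~ K (fh z)].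
Proof.
move=> cK KD; exists [set w | Dom w /\ K (fh w)]; split; last 2 first.
- by move=> w [].
- by move=> w Dw nK Kw; apply: nK.
have [B B0 KB] := compact_cabs_le cK.
have clK : closed K by apply: compact_closed => //; exact: norm_hausdorff.
(* Large [w] corresponds to points near the fixed point [b], whose images are again near [b], so
   that [fh w] exceeds the bound [B] of [K]. *)
have /cont_cabsP/(_ B^-1)[|d d0 hd] := cderiv_cont (cderiv_unicritical m a0 b).
  by rewrite invr_gt0.
apply: (@compact_cabs_bounded _ _ d^-1) => [|w [Dw Kw]]; last first.
  have [->|w0] := eqVneq w 0; first by rewrite cabs0 invr_ge0 ltW.
  rewrite leNgt; apply/negP => dw.
  have := hd (b + w^-1); rewrite [b + _]addrC addrK cabsV.
  rewrite invf_plt ?posrE ?cabs_gt0// => /(_ dw).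
  rewrite fb [_ + b]addrC -chart_map_inv// cabsV ltf_pV2 ?posrE ?cabs_gt0 ?chart_map_neq0//.
  by rewrite ltNge KB.
rewrite -openC; apply/open_cabsP => w /= nw.
have [qw|qw] := eqVneq (q w) 0; last first.
  have nK : (~` K) (fh w).
    by move=> Kw; apply: nw; split => //; apply/(chart_map_dom qw)/KD.
  have /open_cabsP/(_ _ nK)[e e0 he] : open (~` K) by rewrite openC.
  have [k /cderiv_cont/cont_cabsP/(_ e e0)[r r0 hr]] := cderiv_chart_map qw.
  by exists r => // y /hr/he nKy [_ /nKy].
have w0 : w != 0 by apply/eqP => w0; move: qw; rewrite w0 chart_den0; apply/eqP/oner_neq0.
(* At a pole the denominator tends to 0 while the numerator stays above [c], so nearby values leave
   [K]. *)
pose c := (cabs w / 2) ^+ m.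
have c0 : 0 < c by rewrite exprn_gt0// divr_gt0// cabs_gt0.
have /cont_cabsP/(_ (c / B))[|r r0 hr] := @cont_chart_den w; first by rewrite divr_gt0.
exists (Num.min r (cabs w / 2)); first by rewrite lt_min r0 divr_gt0// cabs_gt0.
move=> y; rewrite lt_min => /andP[/hr]; rewrite qw subr0 => h1 h2 [Dy /KB].
have qy := chart_den_neq0 Dy.
rewrite leNgt => /negP; apply.
rewrite /fh cabsM cabsV ltr_pdivlMr ?cabs_gt0// mulrC -ltr_pdivlMr//.
apply: (lt_le_trans h1); rewrite ler_pM2r ?invr_gt0// cabsX.
rewrite lerXn2r ?nnegrE ?cabs_ge0 ?divr_ge0 ?cabs_ge0//.
by have := ler_cabsB w y; rewrite cabsC; lra.
Qed.

Lemma conjugate_modulus (Phi : R[i] -> R[i]) :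
  (forall z, Dom z -> exists k, cderiv Phi z k) ->
  set_bij Dom [set w | cabs w < 1] Phi -> Phi 0 = 0 ->
  forall w, Dom w -> cabs (Phi (fh w)) = cabs (Phi w) ^+ m.
Proof.
move=> dPhi bPhi Phi0; have [P1 Pinj _] := bPhi.
have oD : open Dom := open_chart_dom oOm OmR.
have cnu : {for 0, continuous (fun w => (q w)^-1)}.
  by apply: contV; [rewrite chart_den0 oner_eq0|exact: cont_chart_den].
apply: (semiconjugacy_modulus m0 oD (chart_dom0 Om b) dPhi _ _ Phi0 _ _ _ _ _ cnu _ _).
- by move=> y z Dy Dz; apply: Pinj; exact: mem_set.
- by move=> z Dz; exact: P1.
- by move=> rho; exact: bij_disk_proper oD dPhi bPhi.
- by move=> z Dz; apply: cderiv_chart_map; exact: chart_den_neq0.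
- by move=> z Dz; apply/chart_map_dom => //; exact: chart_den_neq0.
- by [].
- by move=> z; exact: chart_map_neq0.
- by rewrite chart_den0 invr1.
- exact: chart_map_proper.
Qed.
End ConjugateMap.

Section Unimodular.
Variable R : realType.

(** If [l] were nonzero, some small displacement would increase the modulus to first order. *)
Lemma unimodular_deriv0 (Q : R[i] -> R[i]) z l (r : R) : 0 < r ->
  (forall y, cabs (y - z) < r -> cabs (Q y) = 1) -> cderiv Q z l -> l = 0.
Proof.
move=> r0 Q1 [q /cont_cabsP cq [ql E]]; apply/eqP; apply/negP => /negP l0.
have cl : 0 < cabs l by rewrite cabs_gt0.
have [|d d0 hd] := cq (cabs l / 4); first by rewrite divr_gt0.
pose dr := Num.min r d; have dr0 : 0 < dr by rewrite lt_min r0.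
pose t := dr / (2 * cabs l); have t0 : 0 < t by rewrite divr_gt0// mulr_gt0.
(* In this direction [Q y = Q z (1 + t q(y) conj l)], and [q(y) conj l] is close to [|l|^2 > 0], so
   [|Q y|] would exceed 1. *)
pose y := z + t%:C * (Q z * conjc l).
have Qz : cabs (Q z) = 1 by apply: Q1; rewrite subrr cabs0.
have yz : cabs (y - z) < dr.
  rewrite /y [z + _]addrC addrK !cabsM Qz mul1r cabs_conjc cabs_real gtr0_norm//.
  by rewrite /t invfM mulrA mulrVK ?unitfE ?gt_eqF// ltr_pdivrMr// ltr_pMr// ltr1n.
move: (yz); rewrite lt_min => /andP[yr yd].
have := Q1 y yr; rewrite E {2}/y [z + _]addrC addrK.
have -> : Q z + q y * (t%:C * (Q z * conjc l)) = Q z * (1 + t%:C * (q y * conjc l)) by ring.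
rewrite cabsM Qz mul1r => h; have := hd y yd; rewrite ql => hql.
have := ler_norml (complex.Re (1 + t%:C * (q y * conjc l))) 1.
rewrite (le_trans (ler_Re_cabs _)) ?h// => /esym/andP[_].
rewrite ReD -[X in _ <= X]addr0 lerD2l ReM /= mul0r subr0 pmulr_rle0//.
have -> : q y * conjc l = l * conjc l + (q y - l) * conjc l by ring.
rewrite ReD => h2.
have e1 : complex.Re (l * conjc l) = cabs l ^+ 2.
  by rewrite sqr_cabs; case: (l) => a b /=; ring.
have e2 : - (cabs l / 4 * cabs l) <= complex.Re ((q y - l) * conjc l).
  have := ler_Re_cabs ((q y - l) * conjc l); rewrite cabsM cabs_conjc => h3.
  have h4 : cabs (q y - l) * cabs l <= cabs l / 4 * cabs l by rewrite ler_wpM2r ?cabs_ge0// ltW.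
  by have /lerNnormlW := le_trans h3 h4.
by move: cl h2 e2; rewrite e1 expr2; clear=> *; nra.
Qed.

End Unimodular.
Section Uniformization.
Variables (R : realType) (m : nat) (a0 : R[i]) (F : Chat R -> R[i]).
Local Notation f := (unicritical m a0).
Hypothesis m2 : (2 < m)%N.
Local Notation Om := [set z : R[i] | basin_infty f (Some z)].
Hypothesis hF : biholomorphic_onto_disk (basin_infty f) F.

Definition uniformizer z := moebius (F None) (F (Some z)).
Local Notation phi := uniformizer.

Let R0 := cabs a0 + 3.
Let aR : cabs a0 <= R0. Proof. by rewrite lerDl. Qed.
Let R03 : 3 <= R0. Proof. by rewrite lerDr cabs_ge0. Qed.

Lemma F_lt1 x : basin_infty f x -> cabs (F x) < 1.
Proof. by have [[h _ _] _] := hF; exact: h. Qed.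

Lemma F_None_lt1 : cabs (F None) < 1.
Proof. exact: (@F_lt1 None I). Qed.

Lemma F_inj x y : basin_infty f x -> basin_infty f y -> F x = F y -> x = y.
Proof. by have [[_ h _] _] := hF => bx hy; apply: h; exact: mem_set. Qed.

Lemma moebius_inj (c v w : R[i]) : cabs c < 1 -> cabs v < 1 -> cabs w < 1 ->
  moebius c v = moebius c w -> v = w.
Proof.
move=> c1 v1 w1 E; have nc : cabs (- c) < 1 by rewrite cabsN.
by rewrite -(moebiusN nc v1) -(moebiusN nc w1) opprK E.
Qed.

Lemma uniformizer_lt1 z : Om z -> cabs (phi z) < 1.
Proof. by move=> Oz; apply: (moebius_lt1 F_None_lt1); exact: F_lt1. Qed.

Lemma uniformizer_inj y z : Om y -> Om z -> phi y = phi z -> y = z.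
Proof.
move=> Oy Oz E.
by have [] := F_inj Oy Oz (moebius_inj F_None_lt1 (F_lt1 Oy) (F_lt1 Oz) E).
Qed.

Lemma uniformizer_neq0 z : Om z -> phi z != 0.
Proof.
move=> Oz; have d0 := @moebius_den _ (F None) (F (Some z)) F_None_lt1 (F_lt1 Oz).
rewrite mulf_neq0 ?invr_eq0// subr_eq0; apply/eqP => E.
by have := F_inj Oz (I : basin_infty f None) E.
Qed.

Lemma cderiv_uniformizer : exists2 C : R, 0 < C & forall z, Om z ->
  exists2 l, cderiv phi z l & cabs ('D_1 (F \o Some) z) <= C * cabs l.
Proof.
have F0 := F_None_lt1.
have e0 : 0 < 1 - cabs (F None) ^+ 2 by rewrite subr_gt0 expr_lt1// cabs_ge0.
exists ((1 - cabs (F None) ^+ 2) / 4)^-1; first by rewrite invr_gt0 divr_gt0.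
move=> z Oz; have [k dk kge] := cderiv_moebius F0 (F_lt1 Oz).
have [_ [dF _]] := hF; have dz := derivable_cderiv (dF z Oz).
eexists; first exact: (cderiv_comp dz dk).
rewrite cabsM mulrA ler_peMl ?cabs_ge0// mulrC ler_pdivlMr ?mul1r//.
by rewrite divr_gt0.
Qed.

Lemma uniformizer_modulus z : Om z -> cabs (phi (f z)) = cabs (phi z) ^+ m.
Proof.
move=> Oz; have [b fb] := exists_fixed_point a0 m2.
have oOm : open Om := open_basin m2 aR R03.
have bOm : ~ Om b := fixed_notin_basin m2 aR R03 fb.
have OmR z' : R0 <= cabs z' -> Om z' by exact: (basin_of_large m2 aR R03).
have fOm z' : Om (f z') <-> Om z' by exact: (basin_unicritical m2 aR R03).
have [bF [dF dF0]] := hF.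
pose Phi w := moebius (F None) (F (chart_infty b w)).
have F0 := F_None_lt1.
have bch : set_bij (chart_dom Om b) [set w | cabs w < 1] (F \o chart_infty b).
  by apply: (set_bij_chart bOm); move: bF; congr set_bij; apply/funext; case.
have bPhi : set_bij (chart_dom Om b) [set w | cabs w < 1] Phi.
  have [h1 h2 h3] := bch; split.
  - by move=> w Dw; apply: moebius_lt1 => //; exact: h1.
  - move=> v w /set_mem Dv /set_mem Dw /moebius_inj E.
    by apply: h2; [exact: mem_set|exact: mem_set|apply: E => //; exact: h1].
  - move=> v v1; have nF0 : cabs (- F None) < 1 by rewrite cabsN.
    have [w Dw wE] := h3 _ (moebius_lt1 nF0 v1).
    by exists w => //; rewrite -[RHS](moebiusN F0 v1) -wE.
have dPhi w : chart_dom Om b w -> exists k, cderiv Phi w k.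
  move=> Dw; have [k dk] := @cderiv_chart _ Om b F dF (dF0 I) w Dw.
  have w1 : cabs (F (chart_infty b w)) < 1 by have [h1 _ _] := bch; exact: h1.
  have [l dl _] := cderiv_moebius F0 w1.
  by eexists; exact: (cderiv_comp dk dl).
have Phi0 : Phi 0 = 0 by rewrite /Phi /chart_infty eqxx /moebius subrr mul0r.
have m0 : (0 < m)%N by exact: ltn_trans m2.
have [w0 wE] := chart_dom_inv bOm Oz; set w := (z - b)^-1 in w0 wE.
have Dw : chart_dom Om b w by apply/chart_domP => //; rewrite wE.
have := conjugate_modulus m0 oOm bOm OmR fOm fb dPhi bPhi Phi0 Dw.
rewrite /Phi (chart_infty_neq0 b w0) wE chart_infty_neq0; last first.
  exact: (chart_map_neq0 bOm fOm fb Dw w0).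
by rewrite (chart_map_inv fb w0) wE [b + _]addrC subrK.
Qed.
End Uniformization.

(** The hypothesis is the vanishing derivative of [phi o f / phi^m], with [n = m], [b = phi z],
    [a = phi(z)^(m-1)], [c = z^(m-1)], [d = phi (f z)], and [k], [l] the derivatives of [phi] at
    [f z] and [z]. The [m] of [f'] cancels the one from [phi^m]. *)
Lemma log_derivative_algebra (K : fieldType) (n a b c d k l : K) :
  n != 0 -> a != 0 -> b != 0 ->
  k * (n * c) * (b * a)^-1 + d * (- (n * l * a) / (b * a) ^+ 2) = 0 -> k * c * b = d * l.
Proof.
move=> n0 a0 b0 E; apply: (mulfI n0); apply/eqP; rewrite -subr_eq0 -mulrBr.
have -> : n * (k * c * b - d * l) =
    (k * (n * c) * (b * a)^-1 + d * (- (n * l * a) / (b * a) ^+ 2)) * (b ^+ 2 * a).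
  by field; rewrite a0 b0.
by rewrite E mul0r.
Qed.

(** * The logarithmic derivative of the uniformizer *)

Section LogDerivative.
Variables (R : realType) (m : nat) (a0 : R[i]) (F : Chat R -> R[i]).
Local Notation f := (unicritical m a0).
Hypothesis m2 : (2 < m)%N.
Local Notation Om := [set z : R[i] | basin_infty f (Some z)].
Hypothesis hF : biholomorphic_onto_disk (basin_infty f) F.
Local Notation phi := (uniformizer F).

Let R0 := cabs a0 + 3.
Let aR : cabs a0 <= R0. Proof. by rewrite lerDl. Qed.
Let R03 : 3 <= R0. Proof. by rewrite lerDr cabs_ge0. Qed.
Let m0 : (0 < m)%N. Proof. exact: ltn_trans m2. Qed.
Let oOm : open Om. Proof. exact: (open_basin m2 aR R03). Qed.

Lemma cderiv_phi z : Om z -> cderiv phi z ('D_1 phi z).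
Proof.
move=> Oz; have [C _ /(_ z Oz)[l dl _]] := cderiv_uniformizer hF.
by have [_ ->] := cderiv_derivable dl.
Qed.

Lemma deriv_le_uniformizer : exists2 C : R, 0 < C & forall z, Om z ->
  cabs ('D_1 (F \o Some) z) <= C * cabs ('D_1 phi z).
Proof.
have [C C0 H] := cderiv_uniformizer hF; exists C => // z Oz.
by have [l dl le] := H z Oz; have [_ ->] := cderiv_derivable dl.
Qed.

(** The length of the gradient of Green's function [- log |phi|] of the basin with pole at
    infinity. *)
Definition log_deriv z := cabs ('D_1 phi z) / cabs (phi z).
Local Notation u := log_deriv.

Lemma log_deriv_functional z : Om z -> u z = u (f z) * cabs z ^+ m.-1.
Proof.
move=> Oz; have Ofz : Om (f z) by exact/(basin_unicritical m2 aR R03).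
have d1 := cderiv_phi Oz; have d2 := cderiv_phi Ofz.
have p1 := uniformizer_neq0 hF Oz; have p2 := uniformizer_neq0 hF Ofz.
have pm : phi z ^+ m != 0 by rewrite expf_neq0.
set l := 'D_1 phi z in d1; set k := 'D_1 phi (f z) in d2.
have d3 := cderiv_comp (cderiv_unicritical m a0 z) d2.
have d4 := @cderivV _ (fun y => phi y ^+ m) z _ pm (cderivX m d1).
have dQ := cderivM d3 d4.
have [r r0 hr] : exists2 r : R, 0 < r & forall y, cabs (y - z) < r -> Om y.
  by move/open_cabsP: oOm => /(_ z Oz).
have Q1 y : cabs (y - z) < r -> cabs (phi (f y) * (phi y ^+ m)^-1) = 1.
  move=> /hr Oy; rewrite cabsM cabsV cabsX (uniformizer_modulus m2 hF Oy) mulfV//.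
  by rewrite expf_neq0// cabs_eq0 (uniformizer_neq0 hF Oy).
have E := unimodular_deriv0 r0 Q1 dQ.
have mR : m%:R != 0 :> R[i] by rewrite pnatr_eq0 -lt0n.
have {E}E : k * z ^+ m.-1 * phi z = phi (f z) * l.
  have pm1 : phi z ^+ m.-1 != 0 by rewrite expf_neq0.
  by apply: (log_derivative_algebra mR pm1 p1); rewrite -[phi z * _]exprS prednK.
have {}E : cabs k * cabs z ^+ m.-1 * cabs (phi z) = cabs (phi (f z)) * cabs l.
  by rewrite -cabsX -!cabsM E.
rewrite /u -/l -/k; have c1 : cabs (phi z) != 0 by rewrite cabs_eq0.
have c2 : cabs (phi (f z)) != 0 by rewrite cabs_eq0.
apply: (mulfI c1); apply: (mulfI c2).
transitivity (cabs (phi (f z)) * cabs l); first by field.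
by rewrite -E; field.
Qed.

Lemma critical_notin_basin : ~ Om 0.
Proof.
move=> O0; have := log_deriv_functional O0.
rewrite cabs0 expr0n -subn1 subn_eq0 leqNgt (ltn_trans _ m2)// mulr0 => /eqP.
rewrite mulf_eq0 invr_eq0 !cabs_eq0 (negbTE (uniformizer_neq0 hF O0)) orbF.
have [r r0 hr] : exists2 r : R, 0 < r & forall y, cabs (y - 0) < r -> Om y.
  by move/open_cabsP: oOm => /(_ 0 O0).
have hr2 y : cabs (y - 0) <= r / 2 -> Om y.
  by move=> h; apply: hr; apply: le_lt_trans h _; rewrite ltr_pdivrMr// ltr_pMr// ltr1n.
have r2 : 0 < r / 2 by rewrite divr_gt0.
apply/negP; apply: (injective_deriv_neq0 r2 _ _ (cderiv_phi O0)).
- by move=> z /hr2 Oz; exists ('D_1 phi z); exact: cderiv_phi.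
- by move=> y z /hr2 Oy /hr2 Oz; exact: (uniformizer_inj hF).
Qed.

Lemma parameter_bound : cabs a0 ^+ 2 <= 2.
Proof.
rewrite leNgt; apply/negP => /(critical_escape m2 aR R03).
exact: critical_notin_basin.
Qed.

Lemma log_deriv_locally_bounded x : Om x ->
  exists M, exists2 e : R, 0 < e & forall y, cabs (y - x) < e -> u y <= M.
Proof.
move=> Ox; have [r r0 hr] : exists2 r : R, 0 < r & forall y, cabs (y - x) < r -> Om y.
  by move/open_cabsP: oOm => /(_ x Ox).
have px : 0 < cabs (phi x) by rewrite cabs_gt0 (uniformizer_neq0 hF Ox).
have /cont_cabsP/(_ (cabs (phi x) / 2))[|d d0 hd] := cderiv_cont (cderiv_phi Ox).
  by rewrite divr_gt0.
have r2 : 0 < r / 2 by rewrite divr_gt0.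
(* The numerator is the derivative estimate on a disk of radius [r / 2], where [phi] oscillates by
   at most 2; the denominator is half of [|phi x|]. *)
exists ((2 * 2 / (r / 2)) / (cabs (phi x) / 2)); exists (Num.min d (r / 2)).
  by rewrite lt_min d0.
move=> y; rewrite lt_min => /andP[/hd yd yr].
have hy z : cabs (z - y) < r / 2 -> Om z.
  move=> zy; apply: hr; apply: le_lt_trans (ler_cabs_distD y z x) _.
  by lra.
have Oy : Om y by apply: hy; rewrite subrr cabs0.
have dy : cabs ('D_1 phi y) <= 2 * 2 / (r / 2).
  apply: (cauchy_estimate r2 _ _ (cderiv_phi Oy)).
  - by move=> z /hy Oz; exists ('D_1 phi z); exact: cderiv_phi.
  - move=> z /hy Oz; apply: (le_trans (ler_cabsD _ _)); rewrite cabsN.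
    have := uniformizer_lt1 hF Oz; have := uniformizer_lt1 hF Oy.
    by lra.
have py : cabs (phi x) / 2 <= cabs (phi y).
  have := ler_cabsB (phi x) (phi y); rewrite cabsC; lra.
apply: ler_pM => //; rewrite ?invr_ge0 ?cabs_ge0//.
by rewrite lef_pV2 ?posrE ?divr_gt0// cabs_gt0 (uniformizer_neq0 hF Oy).
Qed.

(** In the coordinate [w = 1 / (z - b)] the map is bounded and holomorphic near 0, so its derivative
    is bounded there; the chain rule contributes [|z - b|^-2 <= 4 |z|^-2]. *)
Lemma deriv_far_field : exists C, exists R1, [/\ 0 < C, R0 <= R1 &
  forall z, R1 <= cabs z -> cabs ('D_1 (F \o Some) z) <= C / cabs z ^+ 2].
Proof.
have [b fb] := exists_fixed_point a0 m2.
have bOm : ~ Om b := fixed_notin_basin m2 aR R03 fb.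
have OmR z : R0 <= cabs z -> Om z by exact: (basin_of_large m2 aR R03).
have [r r0 hr] := exists_chart_radius b R0.
have hball := chart_dom_ball OmR r0 hr.
have [_ [dF dF0]] := hF; pose Fh := F \o chart_infty b.
have dFh w : cabs w < r -> exists k, cderiv Fh w k.
  by move=> /hball Dw; exact: (@cderiv_chart _ Om b F dF (dF0 I) w Dw).
have Fh1 w : cabs w < r -> cabs (Fh w) < 1.
  move=> /hball; have [->|w0] := eqVneq w 0.
    by rewrite /Fh /= /chart_infty eqxx => _; exact: (F_None_lt1 hF).
  by move=> /(chart_domP Om b w0) h; rewrite /Fh /= chart_infty_neq0//; exact: (F_lt1 hF).
have r2 : 0 < r / 2 by rewrite divr_gt0.
(* In the radius, [R0] places [z] in the basin, [2 |b|] gives [|z - b| >= |z| / 2], and [4 / r]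
   gives [|w| < r / 2]. *)
exists (2 * 2 / (r / 2) * 4), (R0 + 2 * cabs b + 4 / r + 1).
have b0 := cabs_ge0 b; have R3 := R03.
have r4 : 0 < 4 / r by rewrite divr_gt0.
split.
- by rewrite mulr_gt0// divr_gt0.
- by lra.
move=> z zR; have Oz : Om z by apply: OmR; lra.
have z0 : 0 < cabs z by lra.
have zb : cabs z / 2 <= cabs (z - b).
  by have := ler_cabsB z b; lra.
have zb0 : 0 < cabs (z - b) by apply: lt_le_trans zb; rewrite divr_gt0.
have [w0 wE] := chart_dom_inv bOm Oz; set w := (z - b)^-1 in w0 wE.
have wr : cabs w < r / 2.
  rewrite /w cabsV invf_plt ?posrE//; apply: lt_le_trans zb.
  by rewrite invf_div ltr_pdivlMr// mulrAC; lra.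
have hw y : cabs (y - w) < r / 2 -> cabs y < r.
  move=> yw; rewrite -(subrK w y); apply: le_lt_trans (ler_cabsD _ _) _.
  by lra.
have [k dk] : exists k, cderiv Fh w k by apply: dFh; apply: hw; rewrite subrr cabs0.
have kle : cabs k <= 2 * 2 / (r / 2).
  apply: (cauchy_estimate r2 _ _ dk); first by move=> y /hw; exact: dFh.
  move=> y /hw yr; apply: (le_trans (ler_cabsD _ _)); rewrite cabsN.
  have wr' : cabs w < r by apply: hw; rewrite subrr cabs0.
  by have := Fh1 y yr; have := Fh1 w wr'; lra.
have zb1 : z - b != 0 by rewrite -cabs_gt0.
have dw := @cderivV _ (fun y => y - b) z _ zb1 (cderiv_subr b (cderiv_id z)).
have dz : cderiv (F \o Some) z (k * (- 1 / (z - b) ^+ 2)).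
  apply: cderiv_near (cderiv_comp dw dk).
  apply/nbhs_cabsP; exists (cabs (z - b)) => // y yz.
  have yb : y - b != 0.
    by rewrite subr_eq0; apply: contraTneq yz => ->; rewrite cabsC ltxx.
  by rewrite /Fh /= chart_infty_neq0 ?invr_eq0// invrK addrC subrK.
have [_ ->] := cderiv_derivable dz.
rewrite mulN1r cabsM cabsN cabsV cabsX -(mulrA _ 4) ler_pM ?invr_ge0 ?exprn_ge0 ?cabs_ge0//.
rewrite -[X in _ <= X]invrK invf_div lef_pV2 ?posrE ?exprn_gt0 ?divr_gt0//; last first.
  by rewrite exprn_gt0.
have -> : cabs z ^+ 2 / 4 = (cabs z / 2) ^+ 2 by field.
by rewrite lerXn2r ?nnegrE ?cabs_ge0// divr_ge0 ?cabs_ge0.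
Qed.
End LogDerivative.

(** * Measurability *)

Section MeasurableOnOpen.
Variable R : realType.
Local Notation toC p := (p.1 +i* p.2)%C.
Implicit Types (O : set R[i]) (z : R[i]).

(** The plane carries the product sigma-algebra, so an open set is exhibited as a countable union of
    open squares with rational centre and half-side. *)
Lemma measurable_open_plane O : open O -> measurable [set p : R * R | O (toC p)].
Proof.
move=> oO.
pose B (a b r : rat) : set (R * R) :=
  `]ratr a - ratr r, ratr a + ratr r[%classic `*` `]ratr b - ratr r, ratr b + ratr r[%classic.
pose U (a b r : rat) := [set p | B a b r p /\ forall p', B a b r p' -> O (toC p')].
have mU a b r : measurable (U a b r).
  have [H|H] := pselect (forall p', B a b r p' -> O (toC p')).
    rewrite (_ : U a b r = B a b r); first by apply: measurableX; exact: measurable_itv.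
    by apply/seteqP; split=> [p []|p Bp].
  by rewrite (_ : U a b r = set0)//; apply/seteqP; split=> // p [].
rewrite (_ : [set p | _] = \bigcup_a \bigcup_b \bigcup_r U a b r).
  by do 3! apply: bigcupT_measurable_rat => ?.
apply/seteqP; split=> [[x y] /= Oxy|p [a _ [b _ [r _ [Bp]]]]]; last exact.
have /open_cabsP/(_ _ Oxy)[e e0 he] := oO.
(* Two points of a square of half-side [r] differ by less than [2 r] in each coordinate, hence by
   less than [4 r < e]. *)
have e4 : 0 < e / 4 by rewrite divr_gt0.
have [r] := rat_in_itvoo e4; rewrite in_itv /= => /andP[r0 re].
have [a] : exists a : rat, ratr a \in `](x - ratr r), (x + ratr r)[.
  by apply: rat_in_itvoo; lra.
rewrite in_itv /= => /andP[a1 a2].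
have [b] : exists b : rat, ratr b \in `](y - ratr r), (y + ratr r)[.
  by apply: rat_in_itvoo; lra.
rewrite in_itv /= => /andP[b1 b2].
exists a => //; exists b => //; exists r => //; split.
  by rewrite /B /= !in_itv /=; split; apply/andP; split; lra.
move=> [x' y']; rewrite /B /= !in_itv /= => -[/andP[x1 x2] /andP[y1 y2]].
apply: he; apply: le_lt_trans (ler_cabs_ReIm _) _ => /=.
have h1 : `|x' - x| < 2 * ratr r by rewrite ltr_norml; apply/andP; split; lra.
have h2 : `|y' - y| < 2 * ratr r by rewrite ltr_norml; apply/andP; split; lra.
lra.
Qed.

Lemma measurable_mem_open O : open O ->
  measurable_fun setT (fun p : R * R => toC p \in O).
Proof.
move=> oO; apply: (measurable_fun_bool true); rewrite setTI.
rewrite (_ : _ @^-1` _ = [set p : R * R | O (toC p)]); first exact: measurable_open_plane.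
by apply/seteqP; split=> p /= h; [exact: set_mem|exact: mem_set].
Qed.

Lemma mR_if_open O (h1 h2 : R[i] -> R) : open O -> mR h1 -> mR h2 ->
  mR (fun z => if z \in O then h1 z else h2 z).
Proof. by move=> oO m1 m2; apply: measurable_fun_ifT => //; exact: measurable_mem_open. Qed.

Lemma mR_continuous_on O (h : R[i] -> R) : open O ->
  (forall z, O z -> {for z, continuous h}) -> mR (fun z => if z \in O then h z else 0).
Proof.
move=> oO ch; apply: (measurability _ (RGenOInfty.measurableE R)) => //.
move=> _ [_ [a ->] <-]; rewrite setTI.
have oP : open [set z | O z /\ a < h z].
  apply/open_cabsP => z [Oz az].
  have /open_cabsP/(_ z Oz)[d d0 hd] := oO.
  have /contR_cabsP/(_ (h z - a))[|e e0 he] := ch z Oz; first by rewrite subr_gt0.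
  exists (Num.min d e); first by rewrite lt_min d0.
  move=> y; rewrite lt_min => /andP[/hd Oy /he hy]; split => //.
  by move: hy; rewrite ltr_norml => /andP[]; lra.
have mP := measurable_open_plane oP; have mO := measurable_open_plane oO.
have [a0|a0] := ltP a 0.
  rewrite (_ : _ @^-1` _ = [set p : R * R | O (toC p) /\ a < h (toC p)] `|`
     ~` [set p : R * R | O (toC p)]); first by apply: measurableU => //; exact: measurableC.
  apply/seteqP; split=> p /=; rewrite in_itv /= andbT; case: ifPn => [/set_mem Op|/negP nOp].
  - by left.
  - by move=> _; right => Op; apply: nOp; exact: mem_set.
  - by case=> [[]|].
  - by [].
rewrite (_ : _ @^-1` _ = [set p : R * R | O (toC p) /\ a < h (toC p)])//.
apply/seteqP; split=> p /=; rewrite in_itv /= andbT; case: ifPn => [/set_mem Op|/negP nOp].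
- by [].
- by rewrite ltNge a0.
- by case.
- by case=> Op; case: nOp; exact: mem_set.
Qed.

Lemma measurable_cfun_continuous_on O (h : R[i] -> R[i]) : open O ->
  (forall z, O z -> {for z, continuous h}) ->
  measurable_cfun (fun p : R * R => if toC p \in O then h (toC p) else 0).
Proof.
move=> oO ch; split.
- have H : mR (fun z => if z \in O then complex.Re (h z) else 0).
    apply: mR_continuous_on => // z Oz; apply: (@continuous_comp _ _ _ h (@complex.Re R)).
      exact: ch.
    exact: continuous_Re.
  by move: H; congr measurable_fun; apply/funext => p; case: ifP.
- have H : mR (fun z => if z \in O then complex.Im (h z) else 0).
    apply: mR_continuous_on => // z Oz; apply: (@continuous_comp _ _ _ h (@complex.Im R)).
      exact: ch.
    exact: continuous_Im.
  by move: H; congr measurable_fun; apply/funext => p; case: ifP.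
Qed.

(** The derivative is the pointwise limit of difference quotients with real steps [1 / (n + 1)].
    Extending [h] by 0 makes these quotients measurable on the plane, and for large [n] the shifted
    point is in [O]. *)
Lemma mR_deriv_on O (h : R[i] -> R[i]) : open O -> (forall z, O z -> exists l, cderiv h z l) ->
  mR (fun z => if z \in O then cabs ('D_1 h z) else 0).
Proof.
move=> oO dh.
pose ht z := if z \in O then h z else 0.
have mht : measurable_cfun (fun p : R * R => ht (toC p)).
  by apply: measurable_cfun_continuous_on => // z /dh[l /cderiv_cont].
pose s (n : nat) : R := n.+1%:R.
pose q n z := (s n)%:C * (ht (z + ((s n)^-1)%:C) - ht z).
have mq n : measurable_cfun (fun p : R * R => q n (toC p)).
  have [m1 m2] := mht.
  have mt : measurable_cfun (fun p : R * R => toC p + ((s n)^-1)%:C).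
    exact: (measurable_cfunD (measurable_cfun_toC R) (measurable_cfun_cst _ _)).
  have ms : measurable_cfun (fun p : R * R => ht (toC p + ((s n)^-1)%:C)).
    by split; [exact: (@mR_comp _ _ _ (fun z => complex.Re (ht z)) _ m1 mt)
              |exact: (@mR_comp _ _ _ (fun z => complex.Im (ht z)) _ m2 mt)].
  have mN := measurable_cfunM (measurable_cfun_cst _ (-1)) mht.
  have := measurable_cfunM (measurable_cfun_cst _ (s n)%:C) (measurable_cfunD ms mN).
  by congr measurable_cfun; apply/funext => p; rewrite mulN1r.
have mg n : mR (fun z => if z \in O then cabs (q n z) else 0).
  apply: mR_if_open => //; last exact: mR_cst.
  exact: (mR_comp (@mR_cabs R) (mq n)).
apply: (measurable_fun_cvg mg) => p _.
have [/set_mem Op|_] := boolP (toC p \in O); last exact: cvg_cst.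
set z := toC p in Op *; have [l dl] := dh z Op.
have [_ ->] := cderiv_derivable dl.
have /open_cabsP/(_ z Op)[r r0 hr] := oO.
apply/cvgrPdist_lt => e e0.
have [d d0 hd] := cderiv_epsP dl (divr_gt0 e0 (ltr0n _ 2)).
have rd0 : 0 < Num.min r d by rewrite lt_min r0.
near=> n.
have sn0 : 0 < s n by rewrite ltr0n.
have : (s n)^-1 < Num.min r d.
  by near: n; exact: near_infty_natSinv_lt (PosNum rd0).
rewrite lt_min => /andP[nr nd].
have zs : cabs (z + ((s n)^-1)%:C - z) = (s n)^-1.
  by rewrite [z + _]addrC addrK cabs_real gtr0_norm ?invr_gt0.
have Oz' : z + ((s n)^-1)%:C \in O by apply: mem_set; apply: hr; rewrite zs.
have sC : (s n)%:C * ((s n)^-1)%:C = 1 :> R[i] by rewrite -rmorphM /= mulfV ?gt_eqF.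
have := hd (z + ((s n)^-1)%:C); rewrite zs => /(_ nd) h1.
apply: le_lt_trans (cabs_lip _ _) _; rewrite cabsC.
rewrite /q /ht Oz' mem_set//.
have -> : (s n)%:C * (h (z + ((s n)^-1)%:C) - h z) - l =
    (s n)%:C * (h (z + ((s n)^-1)%:C) - h z - l * (z + ((s n)^-1)%:C - z)).
  rewrite [z + _ - z]addrAC subrr add0r [in RHS]mulrBr; congr (_ - _).
  by rewrite mulrCA sC mulr1.
rewrite cabsM cabs_real gtr0_norm//.
apply: (@le_lt_trans _ _ (s n * (e / 2 / s n))); first by rewrite ler_wpM2l// ltW.
by rewrite mulrCA mulfV ?gt_eqF// mulr1 ltr_pdivrMr// ltr_pMr// ltr1n.
Unshelve. all: by end_near. Qed.
End MeasurableOnOpen.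

(** * Contraction of the shell masses *)

Section Averaging.
Variable R : realType.
Implicit Types (z w : R[i]).

(** At [t = 1] the inequality forces [rho >= 2], so the room below [m] is small and the case [m = 3]
    needs its own constant. *)
Lemma rho_inequality (m : nat) : (2 < m)%N -> exists2 rho : R, 0 < rho < m%:R &
  forall t, 0 <= t -> t ^+ m.-1 * (3 + t) <= rho * (1 + t ^+ m).
Proof.
move=> m2; have m0 : (0 < m)%N by exact: ltn_trans m2.
have mR0 : 0 < m%:R :> R by rewrite ltr0n.
have mE t : t ^+ m = t * t ^+ m.-1 :> R by rewrite -exprS prednK.
(* For [m = 3] the general constant [4 - 3 / m] would be 3, not strictly below [m]. With [5 / 2],
   twice the difference is the cubic below, whose minimum on [t >= 0] is [13 / 9], at
   [t = 4 / 3]. *)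
have [m3|m4] := eqVneq m 3%N.
  exists (5 / 2); first by rewrite m3; apply/andP; split; lra.
  move=> t t0; rewrite m3 /=; suff : 0 <= 5 - 6 * t ^+ 2 + 3 * t ^+ 3 by lra.
  have -> : 5 - 6 * t ^+ 2 + 3 * t ^+ 3 =
    3 * ((t - 4 / 3) ^+ 2 * (t + 2 / 3)) + 13 / 9 :> R by field.
  by rewrite addr_ge0// mulr_ge0// mulr_ge0 ?sqr_ge0//; lra.
have {}m4 : (4 <= m)%N by rewrite ltn_neqAle eq_sym m4.
have m4R : 4 <= m%:R :> R by rewrite ler_nat.
(* By the arithmetic-geometric inequality [3 t^(m-1) <= (3 / m) (1 + (m - 1) t^m)]; adding [t^m]
   makes the coefficient of [t^m] equal to [4 - 3 / m]. *)
exists (4 - 3 / m%:R).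
  have h : 3 / m%:R <= 3 / 4 :> R by rewrite ler_pM2l// lef_pV2 ?posrE.
  have h0 : 0 < 3 / m%:R :> R by rewrite divr_gt0.
  by apply/andP; split; lra.
move=> t t0.
have amgm : m%:R * t ^+ m.-1 <= 1 + (m%:R - 1) * t ^+ m.
  have : forall k, 0 <= 1 + k%:R * t ^+ k.+1 - (k.+1)%:R * t ^+ k.
    elim=> [|k IH]; first by rewrite mul0r addr0 expr0 mulr1 subrr.
    have -> : 1 + k.+1%:R * t ^+ k.+2 - k.+2%:R * t ^+ k.+1 =
      (1 + k%:R * t ^+ k.+1 - k.+1%:R * t ^+ k) + k.+1%:R * (t ^+ k * (t - 1) ^+ 2).
      by rewrite !exprS -!natr1; ring.
    apply: addr_ge0 => //; apply: mulr_ge0 => //.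
    by apply: mulr_ge0; [exact: exprn_ge0|exact: sqr_ge0].
  have mP : m.-1%:R = m%:R - 1 :> R by rewrite -[in RHS](prednK m0) -natr1 addrK.
  by move=> /(_ m.-1); rewrite prednK// mP; lra.
have -> : t ^+ m.-1 * (3 + t) = 3 / m%:R * (m%:R * t ^+ m.-1) + t ^+ m.
  by rewrite mE; field; rewrite gt_eqF.
have h0 : 0 <= 3 / m%:R :> R by rewrite divr_ge0// ltW.
apply: (le_trans (lerD (ler_wpM2l h0 amgm) (lexx _))).
rewrite -subr_ge0.
have -> : (4 - 3 / m%:R) * (1 + t ^+ m) - (3 / m%:R * (1 + (m%:R - 1) * t ^+ m) + t ^+ m)
   = 4 - 6 / m%:R by field; rewrite gt_eqF.
have : 6 / m%:R <= 6 / 4 :> R by rewrite ler_pM2l// lef_pV2 ?posrE.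
lra.
Qed.

(** A root of [1 + x + ... + x^(m-1)], primitive or not: the averaging relies only on the vanishing
    sum and on [omega^m = 1]. *)
Lemma exists_root_sum0 (m : nat) : (1 < m)%N ->
  exists2 omega : R[i], \sum_(i < m) omega ^+ i = 0 & cabs omega = 1 /\ omega ^+ m = 1.
Proof.
move=> m1; have m10 : (0 < m.-1)%N by rewrite -subn1 subn_gt0.
have m0 : (0 < m)%N by exact: ltnW.
have [w wE] := @solve_monicpoly (R[i] : closedFieldType) m.-1 (fun=> -1) m10.
have S0 : \sum_(i < m) w ^+ i = 0.
  rewrite -(prednK m0) big_ord_recr /= wE -big_split big1// => i _.
  by rewrite /= mulN1r addrN.
have wm : w ^+ m = 1 by apply/eqP; rewrite -subr_eq0 subrX1 S0 mulr0.
exists w => //; split => //; apply/eqP.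
by rewrite -(@pexpr_eq1 _ _ m)// ?cabs_ge0// -cabsX wm cabs1.
Qed.

(** The cross terms are the real parts of [omega^k] times a fixed number, so they sum to 0. *)
Lemma sum_rotated_sqr (m : nat) (omega z a : R[i]) :
  \sum_(i < m) omega ^+ i = 0 -> cabs omega = 1 ->
  \sum_(k < m) (1 + cabs (omega ^+ k * z - a) ^+ 2) =
  m%:R * (1 + cabs z ^+ 2 + cabs a ^+ 2).
Proof.
move=> S0 o1.
have E (k : 'I_m) : 1 + cabs (omega ^+ k * z - a) ^+ 2 =
    1 + cabs z ^+ 2 + cabs a ^+ 2 - 2 * complex.Re (omega ^+ k * (z * conjc a)).
  have : cabs (omega ^+ k * z) = cabs z by rewrite cabsM cabsX o1 expr1n mul1r.
  rewrite mulrA; move: (omega ^+ k * z) => v; move=> <-; rewrite !sqr_cabs.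
  by case: v a => x y [c d] /=; ring.
rewrite (eq_bigr _ (fun k _ => E k)) sumrB sumr_const card_ord.
rewrite -mulr_sumr -(big_morph _ (@ReD R) (erefl : complex.Re 0 = 0)).
by rewrite -mulr_suml S0 mul0r mulr0 subr0 mulr_natl.
Qed.
End Averaging.

Section Contraction.
Variables (R : realType) (m : nat) (a0 : R[i]).
Local Notation f := (unicritical m a0).
Local Open Scope ereal_scope.
Implicit Types (z w : R[i]) (g : R[i] -> \bar R).

(** With [a = a0], the weight at [f z] is [1 + |z|^(2m)], a function of [|z|] alone. *)
Definition shifted_weight a z : R := (1 + cabs (z - a) ^+ 2)%R.
Local Notation W := shifted_weight.

Lemma shifted_weight_ge1 a z : (1 <= W a z)%R.
Proof. by rewrite lerDl exprn_ge0// cabs_ge0. Qed.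

Lemma shifted_weight_ge0 a z : (0 <= W a z)%R.
Proof. by apply: le_trans (shifted_weight_ge1 _ _); rewrite ler01. Qed.

Lemma mR_shifted_weight a : mR (W a).
Proof.
apply: mRD (mR_cst 1%R) _; apply: (mRX 2).
apply: (mR_comp (@mR_cabs R)).
exact: (measurable_cfunD (measurable_cfun_toC R) (measurable_cfun_cst _ (- a)%R)).
Qed.

(** Of the powers of [|z|] under the integral, [|z|^(2(m-1))] serves as Jacobian, and the remaining
    [t^(m-1)] multiplies the averaged weight, where [rho_inequality] applies. *)
Lemma pullback_contraction : (2 < m)%N -> (cabs a0 ^+ 2 <= 2)%R ->
  exists2 r : R, (0 < r < 1)%R & forall g, mC g -> (forall z, 0 <= g z) ->
  cint (fun z => g (f z) * ((cabs z ^+ m.-1) ^+ 4 * W a0 z)%R%:E) <=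
    r%:E * cint (fun z => g z * (W a0 z)%:E).
Proof.
move=> m2 a2; have m1 : (1 < m)%N by exact: ltnW.
have m0 : (0 < m)%N by exact: ltnW.
have mR0 : (0 < m%:R :> R)%R by rewrite ltr0n.
have [rho /andP[rho0 rhom] hrho] := rho_inequality R m2.
exists (rho / m%:R)%R; first by rewrite divr_gt0// ltr_pdivrMr ?mul1r.
move=> g mg g0.
have [om S0 [c1 om1]] := exists_root_sum0 R m1.
have o0 : om != 0%R by rewrite -cabs_eq0 c1 oner_eq0.
(* Translating by [a0] turns [f] into the pure power [z^m], so that [P] below is invariant under
   multiplication by [om]. *)
pose H w := g (w + a0)%R.
have H0 w : 0 <= H w by exact: g0.
have mH : mC H.
  exact: (mC_comp mg (measurable_cfunD (measurable_cfun_toC R) (measurable_cfun_cst _ a0))).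
pose P z := H (z ^+ m)%R * ((cabs z ^+ m.-1) ^+ 4)%R%:E.
have P0 z : 0 <= P z by rewrite mule_ge0// lee_fin !exprn_ge0 ?cabs_ge0.
have mP : mC P.
  apply: mCM (mC_expn m mH) _; apply: mC_EFin.
  exact: (mRX 4 (mRX m.-1 (@mR_cabs R))).
have mPW a : mC (fun z => P z * (W a z)%:E).
  by apply: mCM mP _; apply: mC_EFin; exact: mR_shifted_weight.
have PW0 a z : 0 <= P z * (W a z)%:E.
  by rewrite mule_ge0// lee_fin shifted_weight_ge0.
have -> : cint (fun z => g (f z) * ((cabs z ^+ m.-1) ^+ 4 * W a0 z)%R%:E) =
    cint (fun z => P z * (W a0 z)%:E).
  by congr cint; apply/funext => z; rewrite EFinM muleA.
set J := cint (fun z => P z * (W a0 z)%:E).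
(* Only the weight sees the rotation; the other factors depend on [z^m] and [|z|], and area is
   preserved. *)
have rot k : cint (fun z => P z * (W a0 (om ^+ k * z)%R)%:E) = J.
  have ok0 : (om ^+ k != 0)%R by rewrite expf_neq0.
  have := cint_mulc ok0 (mPW a0) (PW0 a0).
  rewrite cabsX c1 !expr1n invr1 mul1e -/J => <-.
  congr cint; apply/funext => z; congr (_ * _).
  by rewrite /P exprMn [((om ^+ k) ^+ m)%R]exprAC om1 expr1n mul1r cabsM cabsX c1 expr1n mul1r.
have mrot k : mC (fun z => P z * (W a0 (om ^+ k * z)%R)%:E).
  apply: mCM mP _; apply: mC_EFin; apply: (mR_comp (@mR_shifted_weight a0)).
  exact: (measurable_cfunM (measurable_cfun_cst _ _) (measurable_cfun_toC R)).
have mJ : m%:R%:E * J = cint (fun z => P z * (m%:R * (1 + cabs z ^+ 2 + cabs a0 ^+ 2))%R%:E).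
  have -> : m%:R%:E * J = \sum_(k < m) cint (fun z => P z * (W a0 (om ^+ k * z)%R)%:E).
    by rewrite (eq_bigr (fun=> J)) => [|k _]; [rewrite sumr_const card_ord mule_natl|exact: rot].
  rewrite /cint -ge0_integral_sum//; last 2 first.
  - by move=> k; exact: mrot.
  - by move=> k p _; rewrite mule_ge0 ?lee_fin ?shifted_weight_ge0.
  congr integral; apply/funext => p; rewrite -(sum_rotated_sqr _ a0 S0 c1) -sumEFin.
  by rewrite ge0_sume_distrr// => k _; rewrite lee_fin shifted_weight_ge0.
pose V w := H w * (W 0 w)%:E.
have mV : mC V by apply: mCM mH _; apply: mC_EFin; exact: mR_shifted_weight.
have V0 w : 0 <= V w by rewrite mule_ge0 ?lee_fin ?shifted_weight_ge0.
have VE : cint V = cint (fun z => g z * (W a0 z)%:E).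
  rewrite -(@cint_translate _ (fun z => g z * (W a0 z)%:E) a0).
  - by congr cint; apply/funext => z; rewrite /V /H /W addrK subr0.
  - by apply: mCM mg _; apply: mC_EFin; exact: mR_shifted_weight.
  - by move=> z; rewrite mule_ge0 ?lee_fin ?shifted_weight_ge0.
have mVm : mC (fun z => V (z ^+ m)%R * ((cabs z ^+ m.-1) ^+ 2)%R%:E).
  by apply: mCM (mC_expn m mV) _; apply: mC_EFin; exact: (mRX 2 (mRX m.-1 (@mR_cabs R))).
have Vm0 z : 0 <= V (z ^+ m)%R * ((cabs z ^+ m.-1) ^+ 2)%R%:E.
  by rewrite mule_ge0// lee_fin !exprn_ge0 ?cabs_ge0.
(* A pointwise comparison: [rho_inequality] is used after replacing [|a0|^2] by 2 and multiplying by
   the Jacobian [t^(m-1)]. *)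
have le1 : m%:R%:E * J <= (m%:R * rho)%R%:E *
    cint (fun z => V (z ^+ m)%R * ((cabs z ^+ m.-1) ^+ 2)%R%:E).
  have mrho : 0 <= (m%:R * rho)%R%:E by rewrite lee_fin mulr_ge0 ?ltW.
  rewrite mJ -cintZl//; apply: le_cint.
  - apply: mCM mP _; apply: mC_EFin; apply: (mRM (mR_cst _)).
    by apply: mRD; [apply: mRD; [exact: mR_cst|exact: (mRX 2 (@mR_cabs R))]|exact: mR_cst].
  - by apply: mCM mVm; apply: mC_EFin; exact: mR_cst.
  - by move=> z; rewrite mule_ge0// lee_fin mulr_ge0 ?ler0n// !addr_ge0// exprn_ge0// cabs_ge0.
  move=> z; rewrite /P /V -!muleA [X in _ <= X]muleCA lee_wpmul2l// -!EFinM lee_fin.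
  rewrite /W subr0 cabsX.
  set t := (cabs z ^+ 2)%R; have t0 : (0 <= t)%R by rewrite exprn_ge0// cabs_ge0.
  have -> : ((cabs z ^+ m.-1) ^+ 4 = t ^+ m.-1 * t ^+ m.-1)%R.
    by rewrite /t [((cabs z ^+ 2) ^+ _)%R]exprAC -exprD.
  have -> : ((cabs z ^+ m.-1) ^+ 2 = t ^+ m.-1)%R by rewrite exprAC.
  have -> : ((cabs z ^+ m) ^+ 2 = t ^+ m)%R by rewrite exprAC.
  have ht := hrho t t0; have tm : (0 <= t ^+ m.-1)%R by exact: exprn_ge0.
  have h3 : (1 + t + cabs a0 ^+ 2 <= 3 + t)%R by lra.
  have := ler_wpM2l tm (le_trans (ler_wpM2l tm h3) ht).
  move/(ler_wpM2l (ltW mR0)); move=> h; apply: etrans h; congr (_ <= _)%R; ring.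
have mrho : 0 <= (m%:R * rho)%R%:E by rewrite lee_fin mulr_ge0 ?ltW.
have := le_trans le1 (lee_wpmul2l mrho (power_substitution m1 mV V0)).
rewrite VE => le2.
have : (m%:R^-1)%R%:E * (m%:R%:E * J) <= (m%:R^-1)%R%:E *
    ((m%:R * rho)%R%:E * ((m%:R^-1)%R%:E * cint (fun z => g z * (W a0 z)%:E))).
  by rewrite lee_wpmul2l// lee_fin invr_ge0 ltW.
have mE : (m%:R != 0 :> R)%R by rewrite gt_eqF.
rewrite !muleA -!EFinM mulVf// mul1e => h; apply: le_trans h _.
by rewrite mulrA mulVf// mul1r.
Qed.
End Contraction.

(** * Integrability *)

Section SeriesOfIntegrals.
Variable R : realType.
Local Open Scope ereal_scope.

Lemma nneseries_geometric_lty (a : nat -> \bar R) (r : R) (c : \bar R) :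
  (0 < r < 1)%R -> c < +oo -> (forall n, 0 <= a n) ->
  (forall n, a n <= (r ^+ n)%:E * c) -> \sum_(n <oo) a n < +oo.
Proof.
move=> /andP[r0 r1] cy a0 ar.
have c0 : 0 <= c by apply: le_trans (a0 0%N) _; rewrite -[c]mul1e; exact: ar.
have : c \is a fin_num by rewrite ge0_fin_numE.
move=> /fineK cE; set k := fine c in cE.
have k0 : (0 <= k)%R by rewrite -lee_fin cE.
apply: (@le_lt_trans _ _ (k / (1 - r))%:E); last by rewrite ltry.
apply: lime_le; first by apply: is_cvg_nneseries => n _ _; exact: a0.
apply: nearW => n.
apply: (@le_trans _ _ (\sum_(0 <= i < n) (r ^+ i * k)%:E)).
  by apply: lee_sum => i _; rewrite EFinM cE; exact: ar.
rewrite sumEFin lee_fin -mulr_suml big_mkord mulrC ler_wpM2l//.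
have h : (0 < 1 - r)%R by rewrite subr_gt0.
rewrite -[leRHS]mul1r ler_pdivlMr// mulrC -opprB mulNr -subrX1 opprB lerBlDr lerDl.
by rewrite exprn_ge0// ltW.
Qed.

(** Pointwise domination by a single term suffices, which accommodates shells that overlap along
    their boundaries. *)
Lemma cint_le_nneseries (g : R[i] -> \bar R) (h : nat -> R[i] -> \bar R) :
  mC g -> (forall z, 0 <= g z) -> (forall n, mC (h n)) -> (forall n z, 0 <= h n z) ->
  (forall z, 0 < g z -> exists n, g z <= h n z) ->
  cint g <= \sum_(n <oo) cint (h n).
Proof.
move=> mg g0 mh h0 gh.
rewrite /cint -integral_nneseries//.
apply: ge0_le_integral => //.
- by apply: ge0_emeasurable_sum => // n _; exact: mh.
move=> p _; set z := (p.1 +i* p.2)%C.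
have := g0 z; rewrite le_eqVlt => /orP[/eqP <-|/gh[n gn]].
  by apply: nneseries_ge0 => n _ _; exact: h0.
apply: (le_trans gn).
have := @nneseries_lim_ge R (fun n => h n z) xpredT 0%N n.+1 (fun n _ _ => h0 n z).
apply: le_trans; rewrite big_nat_recr//= leeDr// sume_ge0// => i _; exact: h0.
Qed.
End SeriesOfIntegrals.

Section NearField.
Variables (R : realType) (m : nat) (a0 : R[i]) (F : Chat R -> R[i]).
Local Notation f := (unicritical m a0).
Hypothesis m2 : (2 < m)%N.
Local Notation Om := [set z : R[i] | basin_infty f (Some z)].
Hypothesis hF : biholomorphic_onto_disk (basin_infty f) F.
Local Notation u := (log_deriv F).
Local Notation W := (shifted_weight a0).
Local Notation toC p := (p.1 +i* p.2)%C.
Variable R1 : R.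
Hypotheses (aR : cabs a0 <= R1) (R3 : 3 <= R1).
Implicit Types z : R[i].

Let oOm : open Om. Proof. exact: (open_basin m2 aR R3). Qed.

(** Extended by 0, [u] is measurable on the plane, and complete invariance of the basin makes its
    functional equation hold at every point. *)
Definition log_deriv_on z : R := if z \in Om then u z else 0.
Local Notation U := log_deriv_on.

Lemma log_deriv_on_ge0 z : 0 <= U z.
Proof. by rewrite /U; case: ifP => // _; rewrite divr_ge0 ?cabs_ge0. Qed.

Lemma mR_log_deriv_on : mR U.
Proof.
have d1 z : Om z -> exists l, cderiv (uniformizer F) z l.
  by move=> Oz; exists ('D_1 (uniformizer F) z); exact: (cderiv_phi hF Oz).
have m1 := mR_deriv_on oOm d1.
have m3 : mR (fun z => if z \in Om then cabs (uniformizer F z) else 0).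
  apply: mR_continuous_on => // z /d1[l /cderiv_cont cu].
  exact: (@continuous_comp _ _ _ (uniformizer F) (@cabs R) z cu (@continuous_cabs R _)).
have m4 := measurable_fun_inv (fun p => _) m3.
have {}m4 : mR (fun z => (if z \in Om then cabs (uniformizer F z) else 0)^-1).
  by apply: m4 => p; case: ifP => // _; exact: cabs_ge0.
have := mRM m1 m4; congr measurable_fun; apply/funext => p.
by rewrite /U /log_deriv; case: ifP => //; rewrite mul0r.
Qed.

Lemma log_deriv_on_functional z : U z = U (f z) * cabs z ^+ m.-1.
Proof.
rewrite /U; have E := basin_unicritical m2 aR R3 z.
have [/set_mem Oz|nOz] := boolP (z \in Om).
  by rewrite mem_set; [exact: (log_deriv_functional m2 hF Oz)|exact/E].
by case: ifPn => [/set_mem/E Oz|]; [move: nOz; rewrite mem_set|rewrite mul0r].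
Qed.

(* The points whose orbit leaves the disk of radius [R1] at time [n + 1]. *)
Definition shell n z := (cabs (iter n f z) <= R1) && (R1 <= cabs (iter n.+1 f z)).

Local Open Scope ereal_scope.
Definition shell_density n z : \bar R := (if shell n z then U z ^+ 4 else 0)%R%:E.
Local Notation G := shell_density.

Lemma shell_density_ge0 n z : 0 <= G n z.
Proof. by rewrite lee_fin; case: ifP => // _; rewrite exprn_ge0// log_deriv_on_ge0. Qed.

Lemma mC_shell_density n : mC (G n).
Proof.
have mit k : measurable_cfun (fun p : R * R => iter k f (toC p)).
  elim: k => [|k IH]; first exact: measurable_cfun_toC.
  exact: (measurable_cfunD (measurable_cfunX m IH) (measurable_cfun_cst _ a0)).
have mcit k : measurable_fun setT (fun p : R * R => cabs (iter k f (toC p))).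
  exact: (mR_comp (@mR_cabs R) (mit k)).
apply: mC_EFin; apply: measurable_fun_ifT.
- apply: measurable_and; apply: measurable_fun_ler => //; exact: measurable_cst.
- exact: (mRX 4 mR_log_deriv_on).
- exact: measurable_cst.
Qed.

Lemma shell_density_succ n z :
  G n.+1 z = G n (f z) * ((cabs z ^+ m.-1) ^+ 4)%R%:E.
Proof.
rewrite /G -EFinM; congr EFin; rewrite /shell -!iterSr.
by case: ifP; rewrite ?mul0r// log_deriv_on_functional exprMn.
Qed.

Lemma shell_mass_bound : exists2 r : R, (0 < r < 1)%R & forall n,
  cint (fun z => G n z * (W z)%:E) <= (r ^+ n)%:E * cint (fun z => G 0 z * (W z)%:E).
Proof.
have [r r01 H] := pullback_contraction m2 (parameter_bound m2 hF).
exists r => //; elim=> [|n IH]; first by rewrite expr0 mul1e.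
have := H (G n) (mC_shell_density n) (shell_density_ge0 n) => /le_trans h.
have r0 : 0 <= r%:E by case/andP: r01 => r0 _; rewrite lee_fin ltW.
rewrite exprS EFinM -muleA; apply: le_trans (lee_wpmul2l r0 IH).
apply: le_trans (H _ (mC_shell_density n) (shell_density_ge0 n)).
rewrite le_eqVlt; apply/orP; left; apply/eqP; congr cint; apply/funext => z.
by rewrite shell_density_succ [in RHS]EFinM muleA.
Qed.

(** The shell of index 0 is compact, thanks to its non-strict inequalities, and lies in the basin,
    where [u] is locally bounded. *)
Lemma shell0_mass_lty : cint (fun z => G 0 z * (W z)%:E) < +oo.
Proof.
pose D0 := [set z | (cabs z <= R1 /\ R1 <= cabs (f z))%R].
have cD0 : compact D0.
  apply: (@compact_cabs_bounded _ _ R1) => [|z []//].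
  have -> : D0 = (fun z => cabs z) @^-1` [set t : R | (t <= R1)%R] `&`
      (fun z => cabs (f z)) @^-1` [set t : R | (R1 <= t)%R] by [].
  apply: closedI.
    by apply: closed_comp; [move=> z _; exact: continuous_cabs|exact: closed_le].
  apply: closed_comp; last exact: closed_ge.
  move=> z _; have cf := cderiv_cont (cderiv_unicritical m a0 z).
  exact: (@continuous_comp _ _ _ f (@cabs R) z cf (@continuous_cabs R _)).
have [M M0 uM] : exists2 M : R, (0 < M)%R & forall y, D0 y -> (u y <= M)%R.
  apply: compact_locally_bounded cD0 _ => x [_ xR].
  apply: (log_deriv_locally_bounded m2 hF).
  by apply/(basin_unicritical m2 aR R3); exact: (basin_of_large m2 aR R3).
pose K := (M ^+ 4 * (1 + (R1 + cabs a0) ^+ 2))%R.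
have K0 : (0 <= K)%R by rewrite mulr_ge0 ?exprn_ge0 ?ltW// ltr_wpDr// sqr_ge0.
have R10 : (0 <= R1)%R by move: R3; lra.
apply: (@le_lt_trans _ _ (\int[@area R]_p (K%:E * (\1_(box (- R1) R1 (- R1) R1) p)%:E))).
  apply: ge0_le_integral => //.
  - by move=> p _; rewrite mule_ge0 ?shell_density_ge0 ?lee_fin ?shifted_weight_ge0.
  - exact: (mCM (mC_shell_density 0) (mC_EFin (@mR_shifted_weight R a0))).
  - apply: emeasurable_funM; first exact: measurable_cst.
    by apply/measurable_EFinP; apply: measurable_indic; exact: measurable_box.
  move=> p _; rewrite /G /shell /=.
  case: ifPn => [/andP[z1 z2]|_]; last by rewrite mul0e mule_ge0// lee_fin// indicE ler0n.
  rewrite indicE mem_set; last first.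
    apply/boxP; rewrite -!ler_norml; split; apply: le_trans z1.
      exact: (ler_Re_cabs (toC p)).
    exact: (ler_Im_cabs (toC p)).
  rewrite mule1 -EFinM lee_fin ler_pM ?exprn_ge0 ?log_deriv_on_ge0 ?shifted_weight_ge0//.
    rewrite lerXn2r ?nnegrE ?log_deriv_on_ge0 ?(ltW M0)// /U.
    by case: ifP => _; [exact: (uM (toC p))|exact: ltW].
  rewrite lerD2l lerXn2r ?nnegrE ?cabs_ge0 ?addr_ge0 ?cabs_ge0//.
  by rewrite (le_trans (ler_cabsD _ _))// cabsN lerD2r.
rewrite ge0_integralZl//.
- by rewrite integral_box ?ge0_cp// -EFinM ltry.
- by apply/measurable_EFinP; apply: measurable_indic; exact: measurable_box.
Qed.

Lemma near_field_lty :
  cint (fun z => (if (z \in Om) && (cabs z <= R1)%R then U z ^+ 4 else 0)%R%:E) < +oo.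
Proof.
have [r r01 H] := shell_mass_bound.
have GW0 n z : 0 <= G n z * (W z)%:E.
  by rewrite mule_ge0 ?shell_density_ge0 ?lee_fin ?shifted_weight_ge0.
apply: (le_lt_trans _ (nneseries_geometric_lty r01 shell0_mass_lty _ H)); last first.
  by move=> n; apply: cint_ge0.
apply: cint_le_nneseries.
- apply: mC_EFin; apply: measurable_fun_ifT.
  + apply: measurable_and; first exact: measurable_mem_open.
    by apply: measurable_fun_ler; [exact: mR_cabs|exact: measurable_cst].
  + exact: (mRX 4 mR_log_deriv_on).
  + exact: measurable_cst.
- by move=> z; rewrite lee_fin; case: ifP => // _; rewrite exprn_ge0// log_deriv_on_ge0.
- by move=> n; exact: (mCM (mC_shell_density n) (mC_EFin (@mR_shifted_weight R a0))).
- exact: GW0.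
move=> z; case: ifP => [/andP[/set_mem Oz zR] _|_]; last by rewrite ltxx.
have [n [n1 n2]] := first_escape m2 aR R3 Oz zR.
(* The weight is at least 1, so it may be inserted for free. *)
exists n; rewrite /G /shell n1 iterS n2 -EFinM lee_fin ler_peMr ?shifted_weight_ge1//.
by rewrite exprn_ge0// log_deriv_on_ge0.
Qed.
End NearField.

(** * Integrability near infinity *)

Section FarField.
Variable R : realType.
Implicit Types (z : R[i]).

Lemma powR_le_1Dexpr4 (x p : R) : 0 <= x -> 0 < p -> p <= 4 -> x `^ p <= 1 + x ^+ 4.
Proof.
move=> x0 p0 p4; have [x1|x1] := leP x 1.
  have := @ge0_ler_powR R p (ltW p0) x 1; rewrite !nnegrE powR1 => h.
  by rewrite (le_trans (h x0 ler01 x1))// lerDl exprn_ge0.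
rewrite (@le_trans _ _ (x ^+ 4))//; last by rewrite lerDr.
by rewrite -powR_mulrn// ler_powR// ltW.
Qed.

Local Open Scope ereal_scope.

(** On dyadic annuli, [|z|^(-2p)] is the Haar weight times [|z|^(-2(p-1))]. All these annuli have
    the same Haar mass, so the second factor yields a geometric series. *)
Lemma far_field_lty (C R1 p : R) : (0 <= C)%R -> (1 <= R1)%R -> (1 < p)%R ->
  cint (fun z => (if R1 <= cabs z then (C / cabs z ^+ 2) `^ p else 0)%R%:E) < +oo.
Proof.
move=> C0 R11 p1; have p0 : (0 < p)%R by lra.
have p10 : (0 < p - 1)%R by lra.
(* On the [n]-th annulus [|z|^-2 <= (1/4)^n], and raising this to the power [p - 1 > 0] gives
   [s^n]. *)
pose s : R := ((1 / 4) `^ (p - 1))%R.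
have s01 : (0 < s < 1)%R.
  rewrite powR_gt0 ?divr_gt0//=.
  have := @gt0_ltr_powR R (p - 1) p10 (1 / 4)%R 1%R; rewrite !nnegrE powR1.
  by apply; lra.
have Cp0 : (0 <= C `^ p)%R by exact: powR_ge0.
pose h n z : \bar R := (s ^+ n * C `^ p)%R%:E *
  (itv_indic (2 ^+ n) (2 ^+ n.+1) (cabs z) * haar_weight z).
have hc0 n : 0 <= (s ^+ n * C `^ p)%R%:E.
  by rewrite lee_fin mulr_ge0// exprn_ge0//; case/andP: s01 => /ltW.
have hi0 n z : 0 <= itv_indic (2 ^+ n) (2 ^+ n.+1) (cabs z) * haar_weight z.
  by rewrite mule_ge0 ?itv_indic_ge0 ?wt_ge0.
have mhi n : mC (fun z : R[i] => itv_indic (2 ^+ n) (2 ^+ n.+1) (cabs z) * haar_weight z).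
  exact: (mCM (mC_itv_indic _ _) (@mC_wt R)).
have hE n : cint (h n) = (s ^+ n)%:E * ((C `^ p)%:E * annulus_mass 1 2).
  rewrite /h cintZl// EFinM -muleA; congr (_ * (_ * _)).
  exact: annulus_mass_dyadic.
have mass : (C `^ p)%:E * annulus_mass 1 2 < +oo.
  have : annulus_mass (1 : R) 2 \is a fin_num.
    by rewrite ge0_fin_numE ?annulus_mass_lty// ltW ?annulus_mass_gt0.
  by move=> /fineK <-; rewrite -EFinM ltry.
have hfin : \sum_(n <oo) cint (h n) < +oo.
  apply: (nneseries_geometric_lty s01 mass) => n; last by rewrite hE.
  by apply: cint_ge0 => z; rewrite mule_ge0.
apply: le_lt_trans hfin.
apply: cint_le_nneseries.
- apply: mC_EFin; apply: measurable_fun_ifT.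
  + by apply: measurable_fun_ler; [exact: measurable_cst|exact: mR_cabs].
  + apply: (measurableT_comp (measurable_powR p)).
    apply: measurable_funM; first exact: measurable_cst.
    apply: measurable_fun_inv => [q|]; first by rewrite exprn_ge0// cabs_ge0.
    exact: (mRX 2 (@mR_cabs R)).
  + exact: measurable_cst.
- by move=> z; rewrite lee_fin; case: ifP => // _; exact: powR_ge0.
- by move=> n; exact: (mCM (mC_EFin (@mR_cst R _)) (mhi n)).
- by move=> n z; rewrite mule_ge0.
move=> z; case: ifPn => [zR _|_]; last by rewrite ltxx.
have z1 : (1 <= cabs z)%R by exact: le_trans zR.
have z0 : (0 < cabs z)%R by exact: lt_le_trans z1.
have [n /andP[n1 n2]] : exists n, (2 ^+ n <= cabs z < 2 ^+ n.+1)%R.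
  have ex : exists n, (cabs z < 2 ^+ n)%R.
    exists (Num.bound (cabs z)); rewrite (lt_trans (archi_boundP (ltW z0)))//.
    by rewrite -natrX ltr_nat ltn_expl.
  case: (ex_minnP ex) => -[|k] kz kmin; first by move: kz; rewrite expr0 ltNge z1.
  exists k; rewrite kz andbT leNgt; apply/negP => h'.
  by have := kmin k h'; rewrite ltnn.
exists n; rewrite /h /itv_indic n1 n2 mul1e /haar_weight -EFinM lee_fin.
set x := (cabs z ^- 2)%R; have x0 : (0 < x)%R by rewrite invr_gt0 exprn_gt0.
rewrite powRM ?(ltW x0)// -(@mulr_powRB1 R x p) ?(ltW x0)//.
rewrite [(s ^+ n * _)%R]mulrC -mulrA ler_wpM2l// mulrC ler_wpM2r ?(ltW x0)//.
have -> : (s ^+ n = ((1 / 4) ^+ n) `^ (p - 1))%R.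
  by rewrite /s -powR_mulrn ?powR_ge0// powRAC powR_mulrn ?divr_ge0.
apply: ge0_ler_powR; rewrite ?nnegrE ?exprn_ge0 ?divr_ge0 ?(ltW x0) ?(ltW p10)//.
have -> : ((1 / 4) ^+ n = ((2 ^+ n) ^+ 2)^-1 :> R)%R.
  by rewrite div1r exprVn exprAC; congr ((_ ^+ _)^-1)%R; ring.
rewrite /x lef_pV2 ?posrE ?exprn_gt0// lerXn2r ?nnegrE ?exprn_ge0 ?(ltW z0)//.
Qed.
End FarField.

(** * Joining the near and far estimates *)

Section Assembly.
Variables (R : realType) (m : nat) (a0 : R[i]) (F : Chat R -> R[i]) (p : R).
Local Notation f := (unicritical m a0).
Hypothesis m2 : (2 < m)%N.
Local Notation Om := [set z : R[i] | basin_infty f (Some z)].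
Hypothesis hF : biholomorphic_onto_disk (basin_infty f) F.
Local Notation toC p := (p.1 +i* p.2)%C.
Local Open Scope ereal_scope.

(** The exponent 4 is included because the near field is controlled through the fourth power itself;
    [1 < p] is what the far field demands. *)
Lemma unicritical_brennan : (1 < p <= 4)%R ->
  \int[@area R]_(xy in [set xy : R * R | basin_infty f (Some (toC xy))])
    (cabs ('D_1 (F \o Some) (toC xy)) `^ p)%:E < +oo.
Proof.
move=> /andP[p1 p4]; have p0 : (0 < p)%R by lra.
have [C [R1 [C0 R1a farF]]] := deriv_far_field m2 hF.
have [K K0 nearF] := deriv_le_uniformizer hF.
have aR : (cabs a0 <= R1)%R by apply: le_trans R1a; rewrite lerDl.
have R3 : (3 <= R1)%R by apply: le_trans R1a; rewrite lerDr cabs_ge0.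
have R10 : (0 <= R1)%R by lra.
have oOm : open Om := open_basin m2 aR R3.
pose Fd z := (if z \in Om then cabs ('D_1 (F \o Some) z) else 0)%R.
have Fd0 z : (0 <= Fd z)%R by rewrite /Fd; case: ifP => // _; exact: cabs_ge0.
have mFd : mR Fd.
  have [_ [dF _]] := hF; apply: mR_deriv_on => // z Oz.
  by exists ('D_1 (F \o Some) z); exact: derivable_cderiv (dF z Oz).
have -> : \int[@area R]_(xy in [set xy : R * R | basin_infty f (Some (toC xy))])
    (cabs ('D_1 (F \o Some) (toC xy)) `^ p)%:E = cint (fun z => (Fd z `^ p)%:E).
  rewrite integral_mkcond /cint; congr integral; apply/funext => xy.
  rewrite /patch /Fd; case: ifPn => [/set_mem /= Oz|].
    by rewrite mem_set.
  by move=> nO; rewrite ifN ?powR0 ?gt_eqF.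
(* On the disk of radius [R1], [g1] carries the constant 1 (on a square containing the disk) and
   [g2] the fourth power; [g3] is the tail. *)
pose g1 z : \bar R := (\1_(box (- R1) R1 (- R1) R1) (complex.Re z, complex.Im z))%:E.
pose g2 z : \bar R := (K ^+ 4)%:E *
  (if (z \in Om) && (cabs z <= R1)%R then log_deriv_on m a0 F z ^+ 4 else 0)%R%:E.
pose g3 z : \bar R := (if (R1 <= cabs z)%R then ((C / cabs z ^+ 2) `^ p)%R else 0%R)%:E.
have U0 := log_deriv_on_ge0 m a0 F.
have mu4 : mR (fun z => if (z \in Om) && (cabs z <= R1)%R then log_deriv_on m a0 F z ^+ 4 else 0)%R.
  apply: measurable_fun_ifT.
  - apply: measurable_and; first exact: measurable_mem_open.
    by apply: measurable_fun_ler; [exact: mR_cabs|exact: measurable_cst].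
  - exact: (mRX 4 (mR_log_deriv_on m2 hF aR R3)).
  - exact: measurable_cst.
have mg1 : mC g1.
  have m1 : measurable_fun setT (\1_(box (- R1) R1 (- R1) R1) : R * R -> R).
    by apply: measurable_indic; exact: measurable_box.
  have := measurableT_comp (@EFin_measurable R setT) m1.
  by congr measurable_fun; apply/funext => -[].
have mg2 : mC g2 by exact: (mCM (mC_EFin (@mR_cst R _)) (mC_EFin mu4)).
have mg3 : mC g3.
  apply: mC_EFin; apply: measurable_fun_ifT.
  - by apply: measurable_fun_ler; [exact: measurable_cst|exact: mR_cabs].
  - apply: (measurableT_comp (measurable_powR p)).
    apply: measurable_funM; first exact: measurable_cst.
    apply: measurable_fun_inv => [q|]; first by rewrite exprn_ge0// cabs_ge0.
    exact: (mRX 2 (@mR_cabs R)).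
  - exact: measurable_cst.
have K40 : 0 <= (K ^+ 4)%R%:E by rewrite lee_fin exprn_ge0// ltW.
have u40 z : 0 <= (if (z \in Om) && (cabs z <= R1)%R then log_deriv_on m a0 F z ^+ 4 else 0)%R%:E.
  by rewrite lee_fin; case: ifP => // _; rewrite exprn_ge0.
have g10 z : 0 <= g1 z by rewrite lee_fin indicE ler0n.
have g20 z : 0 <= g2 z by rewrite mule_ge0.
have g30 z : 0 <= g3 z by rewrite lee_fin; case: ifP => // _; exact: powR_ge0.
have g1y : cint g1 < +oo.
  rewrite (_ : cint g1 = \int[@area R]_xy (\1_(box (- R1) R1 (- R1) R1) xy)%:E).
    by rewrite integral_box ?ltry// ge0_cp.
  by congr integral; apply/funext => -[].
have g2y : cint g2 < +oo.
  have nf := near_field_lty m2 hF aR R3.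
  rewrite /g2 cintZl//; last exact: mC_EFin.
  move: nf; set I := cint _ => nf.
  have : I \is a fin_num by rewrite ge0_fin_numE// cint_ge0.
  by move=> /fineK <-; rewrite -EFinM ltry.
have g3y : cint g3 < +oo by apply: far_field_lty => //; [exact: ltW|lra].
have mg12 : mC (fun z => g1 z + g2 z) by exact: emeasurable_funD.
have : cint (fun z => g1 z + g2 z + g3 z) < +oo.
  rewrite cintD//; last by move=> z; rewrite adde_ge0.
  by rewrite cintD//; apply: lte_add_pinfty => //; exact: lte_add_pinfty.
apply: le_lt_trans; apply: le_cint.
- apply: mC_EFin; exact: (measurableT_comp (measurable_powR p) mFd).
- exact: emeasurable_funD.
- by move=> z; rewrite lee_fin powR_ge0.
move=> z; rewrite /Fd; have [/set_mem Oz|nO] := boolP (z \in Om); last first.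
  by rewrite powR0 ?gt_eqF// !adde_ge0.
have [zR|zR] := leP (cabs z) R1; last first.
  rewrite -[leLHS]add0e leeD ?adde_ge0// /g3 (ltW zR) lee_fin.
  apply: ge0_ler_powR; rewrite ?nnegrE ?cabs_ge0 ?(ltW p0) ?divr_ge0 ?(ltW C0) ?exprn_ge0 ?cabs_ge0//.
  by apply: farF; exact: ltW.
rewrite -[leLHS]adde0 leeD// /g1 /g2 zR andbT mem_set// indicE mem_set; last first.
  apply/boxP; rewrite -!ler_norml; split; apply: (le_trans _ zR).
    exact: ler_Re_cabs.
  exact: ler_Im_cabs.
rewrite -EFinM -EFinD lee_fin.
apply: (le_trans (powR_le_1Dexpr4 (cabs_ge0 _) p0 p4)).
rewrite lerD2l -exprMn lerXn2r ?nnegrE ?cabs_ge0 ?mulr_ge0 ?(ltW K0)//.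
apply: (le_trans (nearF z Oz)); rewrite ler_wpM2l ?(ltW K0)//.
(* Since [|phi| < 1], division by [|phi|] can only increase: [|phi'| <= u]. *)
rewrite /log_deriv_on mem_set// /log_deriv ler_pdivlMr ?cabs_gt0 ?(uniformizer_neq0 hF Oz)//.
by rewrite ler_piMr ?cabs_ge0// ltW// (uniformizer_lt1 hF Oz).
Qed.
End Assembly.

Theorem mainTheorem1 (R : realType) (m : nat) (a0 : R[i]) :
  (3 <= m)%N ->
  simply_connected R (basin_infty (fun z : R[i] => z ^+ m + a0)) ->
  brennan_holds (basin_infty (fun z : R[i] => z ^+ m + a0)).
Proof.
move=> m3 _ F hF p /andP[p1 p4].
have p14 : 1 < p <= 4 by apply/andP; split; lra.
exact: (unicritical_brennan m3 hF p14).
Qed.
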